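(* Let $N\ge2$, $s\in(0,1)$, $0<r<R$ and $\mathcal{B}_0=B_R(0)\setminus\overline{B_r(0)}\subset\mathbb{R}^N$. Let $g_0=1$ and $V_0=\alpha\chi_D$ for some $\alpha>0$ and some measurable $D\subset\mathcal{B}_0$. Let $\underline{V}\in\mathcal{E}(V_0)$ be a minimizing weight, i.e. $$\lambda_1(1,\underline{V})=\min\{\lambda_1(1,V): V\in\mathcal{E}(V_0)\}.$$ Then $\underline{V}=\alpha\chi_{\underline{D}}$ for some $\underline{D}\subset\mathcal{B}_0$ with $|\underline{D}|=|D|$. Furthermore, $\underline{D}$ is symmetric with respect to the axis $\gamma\mathbb{R}$ for some $\gamma\in\mathbb{S}^{N-1}$.
   Context: $B_\rho(x)$ is the open ball of radius $\rho$ centered at $x$; $\chi_D$ is the characteristic function of $D$; $|\cdot|$ is Lebesgue measure. Put $\Omega=\mathcal{B}_0$. $C_{N,s}>0$ is the normalization constant of the fractional Laplacian $(-\Delta)^s u(x)=C_{N,s}\,\mathrm{P.V.}\int_{\mathbb{R}^N}\frac{u(x)-u(y)}{|x-y|^{N+2s}}\,dy$. $[u]_s=\left(\int_{\mathbb{R}^N}\int_{\mathbb{R}^N}\frac{|u(x)-u(y)|^2}{|x-y|^{N+2s}}\,dx\,dy\right)^{1/2}$; $H_0^s(\Omega)=\{u\in L^2(\mathbb{R}^N):[u]_s<\infty,\ u=0\text{ in }\mathbb{R}^N\setminus\Omega\}$. $$\lambda_1(g,V)=\inf\left\{\frac{\frac{C_{N,s}}{2}[u]_s^2+\int_\Omega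 V|u|^2dx}{\int_\Omega g|u|^2dx}: u\in H_0^s(\Omega),\ \int_\Omega g|u|^2dx>0\right\}.$$ For measurable $\phi:\Omega\to\mathbb{R}$, $\mathcal{E}(\phi)$ is the set of measurable $\psi:\Omega\to\mathbb{R}$ with $|\{\psi>t\}|=|\{\phi>t\}|$ for all $t\in\mathbb{R}$. (For $g_0=1$, $\mathcal{E}(g_0)=\{1\}$ up to null sets.) A set is symmetric with respect to the axis $\gamma\mathbb{R}$ if its characteristic function at $x$ depends only on $|x|$ and the angle $\arccos\left(\frac{x\cdot\gamma}{|x|}\right)$. Functions equal a.e. (and sets differing by a null set) are identified. *)

(* Defs.v *)
From HB Require Import structures.
From mathcomp Require Import all_boot all_order all_algebra.
From mathcomp Require Import all_classical all_reals all_analysis.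

Set Implicit Arguments.
Unset Strict Implicit.
Unset Printing Implicit Defensive.
Import Order.TTheory GRing.Theory Num.Theory.
Import numFieldNormedType.Exports.

Local Open Scope classical_set_scope.
Local Open Scope ring_scope.

Section borel_lebesgue_step.
Local Open Scope ereal_scope.
Context (R : realType) (n : nat).

Definition tuple_consp (p : R * n.-tuple R) : n.+1.-tuple R :=
  [the n.+1.-tuple R of p.1 :: p.2].

Lemma measurable_tuple_consp : measurable_fun [set: R * n.-tuple R] tuple_consp.
Proof. exact: measurable_cons. Qed.

Variable mu : {sigma_finite_measure set (n.-tuple R) -> \bar R}.

Definition borel_lebesgue_step : set (n.+1.-tuple R) -> \bar R :=
  pushforward (@lebesgue_measure R \x mu) tuple_consp.

Let step0 : borel_lebesgue_step set0 = 0.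
Proof. by rewrite /borel_lebesgue_step /pushforward preimage_set0 measure0. Qed.

Let step_ge0 A : 0 <= borel_lebesgue_step A.
Proof. by rewrite /borel_lebesgue_step /pushforward measure_ge0. Qed.

Let step_sigma_additive : semi_sigma_additive borel_lebesgue_step.
Proof.
have mf := measurable_tuple_consp.
move=> F mF tF mUF; rewrite /borel_lebesgue_step /pushforward preimage_bigcup.
apply: measure_semi_sigma_additive.
- by move=> k; rewrite -[X in measurable X]setTI; exact: mf.
- apply/trivIsetP => /= i j _ _ ij; rewrite -preimage_setI.
  by move/trivIsetP : tF => /(_ _ _ _ _ ij) ->//; rewrite preimage_set0.
- by rewrite -preimage_bigcup -[X in measurable X]setTI; exact: mf.
Qed.

HB.instance Definition _ := isMeasure.Build _ _ _ borel_lebesgue_step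
  step0 step_ge0 step_sigma_additive.

Let step_sigma_finite : sigma_finite setT borel_lebesgue_step.
Proof.
have /sigma_finiteP[F [TF ndF Foo]] := sigma_finiteT (@lebesgue_measure R).
have /sigma_finiteP[G [TG ndG Goo]] := sigma_finiteT mu.
pose f (t : n.+1.-tuple R) : R * n.-tuple R := (thead t, [tuple of behead t]).
have mf : measurable_fun [set: n.+1.-tuple R] f.
  apply: measurable_fun_pair; first exact: (measurable_tnth ord0).
  exact: measurable_behead.
have fK : f \o tuple_consp = id.
  by apply/funext => -[x t]; congr pair; exact/val_inj.
exists (fun k => f @^-1` (F k `*` G k)).
  rewrite -preimage_bigcup (_ : \bigcup_k _ = setT) ?preimage_setT//.
  rewrite -setXTT TF TG predeqE => -[x y]; split.
    by move=> [k _ []/= ? ?]; split; exists k.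
  move=> [/= [k _ Fkx] [l _ Gly]]; exists (maxn k l) => //; split.
  - by move: x Fkx; exact/subsetPset/ndF/leq_maxl.
  - by move: y Gly; exact/subsetPset/ndG/leq_maxr.
move=> k; have [mF Fk] := Foo k; have [mG Gk] := Goo k; split.
  by rewrite -[X in measurable X]setTI; apply: mf => //; exact: measurableX.
rewrite /borel_lebesgue_step /pushforward.
rewrite -comp_preimage fK preimage_id.
by rewrite product_measure1E// lte_mul_pinfty// ge0_fin_numE.
Qed.

HB.instance Definition _ := Measure_isSigmaFinite.Build _ _ _ borel_lebesgue_step
  step_sigma_finite.
End borel_lebesgue_step.

Fixpoint borel_lebesgue (R : realType) (n : nat) :
    {sigma_finite_measure set (n.-tuple R) -> \bar R} :=
  match n with
  | 0%N => @dirac _ (0.-tuple R) [tuple] R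
  | n'.+1 => borel_lebesgue_step (borel_lebesgue R n')
  end.

(* R^N with the sigma-algebra of Lebesgue measurable sets, i.e. the completion
   of the Borel product sigma-algebra, and its Lebesgue measure. *)
Definition euclid (R : realType) (N : nat) :=
  caratheodory_type ((borel_lebesgue R N)^*)%mu.

Section lebesgueN.
Context (R : realType) (N : nat).

Definition lebesgueN : set (euclid R N) -> \bar R :=
  @completed_measure_extension _ _ _ (borel_lebesgue R N).

HB.instance Definition _ := Measure.on lebesgueN.

Let lebesgueN_sigma_finite : sigma_finite setT lebesgueN.
Proof. exact/completed_measure_extension_sigma_finite/sigma_finiteT. Qed.

HB.instance Definition _ := Measure_isSigmaFinite.Build _ _ _ lebesgueN
  lebesgueN_sigma_finite.
End lebesgueN.
Arguments lebesgueN {R N}.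

Section definitions.
Context {R : realType} {N : nat}.
Implicit Types (x y gamma : euclid R N) (Omega A : set (euclid R N)).
Implicit Types (u g V phi psi : euclid R N -> R) (s : R).

Definition edot x y : R := \sum_(i < N) tnth x i * tnth y i.
Definition enorm x : R := Num.sqrt (edot x x).
Definition edist x y : R := Num.sqrt (\sum_(i < N) (tnth x i - tnth y i) ^+ 2).

Definition open_ball (c : euclid R N) (rho : R) : set (euclid R N) :=
  [set x | edist x c < rho].
Definition closed_ball (c : euclid R N) (rho : R) : set (euclid R N) :=
  [set x | edist x c <= rho].

Definition origin : euclid R N := [tuple 0 | _ < N].

Definition annulus (r rho : R) : set (euclid R N) :=
  open_ball origin rho `\` closed_ball origin r.

(* The constant for which (-Delta)^s has Fourier symbol |xi|^(2s); the default
   coordinate of nth is only used when N = 0. *)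
Definition fraclap_const s : R :=
  (fine (\int[@lebesgueN R N]_z
     ((1 - cos (nth 0 z 0%N)) / (enorm z `^ (N%:R + 2 * s)))%:E))^-1.

Definition gagliardo s u : \bar R :=
  ((\int[lebesgueN]_y \int[lebesgueN]_x
      (`|u x - u y| ^+ 2 / (edist x y `^ (N%:R + 2 * s)))%:E) `^ 2^-1)%E.

Definition Hs0 s Omega : set (euclid R N -> R) :=
  [set u | [/\ u \in Lfun (@lebesgueN R N) 2%:E,
              (gagliardo s u < +oo)%E &
              {ae @lebesgueN R N, forall x, ~ Omega x -> u x = 0}]].

Definition weighted_sqnorm Omega V u : \bar R :=
  \int[lebesgueN]_(x in Omega) (V x * `|u x| ^+ 2)%:E.

Definition rayleigh s Omega g V u : \bar R :=
  (((fraclap_const s / 2)%:E * gagliardo s u ^+ 2 + weighted_sqnorm Omega V u)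
     / weighted_sqnorm Omega g u)%E.

Definition lambda1 s Omega g V : \bar R :=
  ereal_inf [set rayleigh s Omega g V u | u in
    [set u | Hs0 s Omega u /\ (0 < weighted_sqnorm Omega g u)%E]].

(* Functions on Omega are represented by functions on R^N whose values outside
   Omega are irrelevant. *)
Definition rearrangements Omega phi : set (euclid R N -> R) :=
  [set psi | measurable_fun Omega psi /\
    forall t : R, lebesgueN (Omega `&` [set x | t < psi x]) =
                  lebesgueN (Omega `&` [set x | t < phi x])].

Definition axially_symmetric gamma A :=
  exists h : R -> R -> R,
    forall x, \1_A x = h (enorm x) (acos (edot x gamma / enorm x)).

End definitions.
Arguments fraclap_const {R} N s.

(* Main.v *)
Require Import Defs.
From HB Require Import structures.
From mathcomp Require Import all_boot all_order all_algebra.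
From mathcomp Require Import all_classical all_reals all_analysis.
From mathcomp Require Import measurable_realfun.
From mathcomp Require Import ring lra.

(** Write [k] for the kernel [|x - y| ^ - (N + 2 s)], [E u] for the integral of
[(u x - u y) ^ 2 * k x y] and [Q W u = c * E u + alpha * \int_W u ^ 2], where
[c] is half the constant of the fractional Laplacian.  A weight with the
distribution of [alpha * \1_D] is almost everywhere [alpha * \1_A] for a set
[A] with the measure of [D] ([rearrangement_indic]), so the hypothesis says
that [A] minimizes, among the sets [W] of its measure, the infimum of [Q W u]
over functions of norm 1.  Let [u >= 0] attain the infimum for [A]
([nonneg_minimizer]).

The set [A] is a sublevel set of [u] ([minimizing_set_is_sublevel]).  Suppose
that [A1] outside [A] and [B1] inside [A] have the same measure, that
[u <= t] on [A1] and [t <= u] on [B1].  Exchanging them gives a set [W] with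
[Q W u <= Q A u], so [u] is a minimizer for [W] too, and the difference of the
two Euler-Lagrange equations says that [u * phi] has the same integral over
[A1] and [B1] for every test function [phi] ([exchange]).  If [A1] and [B1]
lie on two sides of a hyperplane, this is absurd for a [phi] that vanishes on
one side and is positive on the other, because [u] is positive
([ae_pos_minimizer]).

The symmetry comes from polarization: at [x] and at its mirror image in the
hyperplane orthogonal to a unit vector [e], the two values of [u] are
exchanged if necessary to put the larger one on the side of [e].  This does
not increase [E], as the kernel is smaller between points on opposite sides.
Since [A] is where [u] lies in some down-set [J], the polarized function [p]
and the set where [p] lies in [J] again have the norm of [u], the measure of
[A] and the same integral of the square.  So [E p = E u], and equality forces
the difference between [u] and its reflection to have a constant sign on the
side of [e] ([polarize_rigid], [minimizer_rigid]).  If furthermore the first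
moment of [u ^ 2 dx] in the direction [e] is zero, this sign condition makes
[u] equal to its reflection almost everywhere ([moment_rigid]).  Now let
[gamma] be the direction of the moment vector [\int x * u x ^ 2]: every [e]
orthogonal to [gamma] has this property.

It remains to pass from almost everywhere invariance under each reflection to
one set that is exactly symmetric.  The limits of the averages of [u] over
small balls agree with [u] almost everywhere and have its symmetries at every
point ([representative_ae], [representative_reflection]); the points of the
annulus where this limit lies in [J] form the required set, since two points
with the same norm and the same angle to [gamma] are exchanged by a reflection
in a hyperplane containing [gamma] ([axially_symmetric_of_reflections]).

Minimizers exist by compactness: a domain is cut into small cells, on each of
which the kernel is bounded below, which gives a Poincare inequality and hence
the total boundedness in [L^2] of sets of bounded energy ([finite_classes]).
The same inequality with balls instead of cells gives the convergence of the
averages. *)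

Set Implicit Arguments.
Unset Strict Implicit.
Unset Printing Implicit Defensive.
Import Order.TTheory GRing.Theory Num.Theory.
Import numFieldNormedType.Exports.

Local Open Scope classical_set_scope.
Local Open Scope ring_scope.

(* The name edist also denotes the extended distance of a pseudometric space. *)
Local Notation edist := Defs.edist.

(** * Translations and reflections preserve Lebesgue measure *)

Section real_translation.
Local Open Scope ereal_scope.
Context (R : realType).

Lemma lebesgue_measure_translation (c : R) (A : set (measurableTypeR R)) : measurable A ->
  pushforward lebesgue_measure (fun x : measurableTypeR R => (x + c)%R : measurableTypeR R) A = lebesgue_measure A.
Proof.
have mf : measurable_fun setT (fun x : measurableTypeR R => (x + c)%R : measurableTypeR R).
  by apply: measurable_funD.
pose f : {mfun measurableTypeR R >-> measurableTypeR R} :=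
  HB.pack (fun x : measurableTypeR R => (x + c)%R : measurableTypeR R) (isMeasurableFun.Build _ _ _ _ _ mf).
move=> mA; apply/esym.
apply: (@lebesgue_measure_unique _ (pushforward lebesgue_measure f)) => //= _ [[a b]] _ <-.
rewrite /pushforward (_ : _ @^-1` _ = `](a - c)%R, (b - c)%R]%classic); last first.
  by apply/seteqP; split => x /=; rewrite !in_itv/= ltrBlDr lerBrDr.
rewrite /=.
have := @lebesgue_measure_itv R (Interval (BRight (a - c)%R) (BRight (b-c)%R)).
have := @lebesgue_measure_itv R (Interval (BRight a) (BRight b)).
rewrite /= !lte_fin ltrD2r => -> ->; case: ifP => // _.
by rewrite -!EFinB opprB addrA subrK.
Qed.

Lemma ge0_integral_translation (c : R) (g : R -> \bar R) : measurable_fun setT g ->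
  (forall x, 0 <= g x) ->
  \int[lebesgue_measure]_x g (x + c)%R = \int[lebesgue_measure]_x g x.
Proof.
move=> mg g0.
have mf : measurable_fun setT (fun x : measurableTypeR R => (x + c)%R : measurableTypeR R).
  by apply: measurable_funD.
rewrite -[LHS](@ge0_integral_pushforward _ _ _ _ _ _ mf _ setT g) //.
by apply: eq_measure_integral => //= A mA AS; exact: lebesgue_measure_translation.
Qed.
End real_translation.

Section tuples.
Context (R : realType).

Definition tadd n (x v : n.-tuple R) : n.-tuple R :=
  [tuple tnth x i + tnth v i | i < n].

Lemma tnth_tadd n (x v : n.-tuple R) i : tnth (tadd x v) i = tnth x i + tnth v i.
Proof. by rewrite tnth_mktuple. Qed.

Lemma measurable_fun_tuple d (T : measurableType d) n (f : T -> 'I_n -> R) :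
  (forall i, measurable_fun setT (fun x => f x i)) ->
  measurable_fun setT (fun x => [tuple f x i | i < n]).
Proof.
move=> mf; apply/measurable_fun_tnthP => i.
by apply: eq_measurable_fun (mf i) => x _ /=; rewrite tnth_mktuple.
Qed.

Lemma measurable_fun_tnth_comp d (T : measurableType d) n (f : T -> n.-tuple R) i :
  measurable_fun setT f -> measurable_fun setT (fun x => tnth (f x) i).
Proof. by move=> mf; apply: (measurableT_comp (measurable_tnth i)). Qed.

Lemma measurable_fun_tadd d (T : measurableType d) n (f g : T -> n.-tuple R) :
  measurable_fun setT f -> measurable_fun setT g ->
  measurable_fun setT (fun x => tadd (f x) (g x)).
Proof.
move=> mf mg; apply: measurable_fun_tuple => i; apply: measurable_funD;
  exact: measurable_fun_tnth_comp.
Qed.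

Lemma tadd_cons n (x : R) (t : n.-tuple R) (v : n.+1.-tuple R) :
  tadd (tuple_consp (x, t)) v =
  tuple_consp (x + thead v, tadd t [tuple of behead v]).
Proof.
apply/eq_from_tnth => i; rewrite tnth_tadd; case: (unliftP ord0 i) => [j|] ->.
  rewrite !tnthS/= tnth_tadd tnth_behead; congr (_ + tnth _ _); apply/val_inj.
  by rewrite /= inordK// ltnS.
by rewrite !tnth0.
Qed.
End tuples.

Section borel.
Local Open Scope ereal_scope.
Context (R : realType).

Lemma borel_lebesgueSE n (A : set (n.+1.-tuple R)) :
  borel_lebesgue R n.+1 A =
  \int[lebesgue_measure]_x borel_lebesgue R n [set t | A (tuple_consp (x, t))].
Proof.
rewrite /= /borel_lebesgue_step /pushforward /= /product_measure1.
apply: eq_integral => x _ /=; congr (borel_lebesgue R n _).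
by apply/seteqP; split => t; rewrite /xsection /= inE.
Qed.

Lemma preimage_measurable d d' (T : measurableType d) (U : measurableType d') (f : T -> U) (A : set U) :
  measurable_fun setT f -> measurable A -> measurable (f @^-1` A).
Proof. by move=> mf mA; rewrite -[X in measurable X]setTI; exact: mf. Qed.

Lemma borel_lebesgue_translation n (v : n.-tuple R) (A : set (n.-tuple R)) :
  measurable A -> borel_lebesgue R n [set x | A (tadd x v)] = borel_lebesgue R n A.
Proof.
elim: n => [|n IH] in v A *.
  move=> _; congr (borel_lebesgue _ _ _); apply/seteqP; split => x /=; by rewrite (tuple0 (tadd x v)) (tuple0 x).
move=> mA; rewrite !borel_lebesgueSE.
pose g (x : R) := borel_lebesgue R n [set t | A (tuple_consp (x, t))].
have mcA : measurable ((@tuple_consp R n) @^-1` A).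
  exact: (preimage_measurable (@measurable_tuple_consp R n)).
have mg : measurable_fun setT g.
  have -> : g = (borel_lebesgue R n) \o xsection ((@tuple_consp R n) @^-1` A).
    apply/funext => x; rewrite /g/=; congr (borel_lebesgue _ _ _).
    by apply/seteqP; split => t; rewrite /xsection /= inE.
  exact: measurable_fun_xsection.
rewrite -(@ge0_integral_translation _ (thead v) g)//.
apply: eq_integral => x _; rewrite /g -[RHS](IH [tuple of behead v]).
  by congr (borel_lebesgue _ _ _); apply/seteqP; split => t /=; rewrite tadd_cons.
have := measurable_xsection (x + thead v)%R mcA; rewrite /xsection.
by congr measurable; apply/seteqP; split => t /=; rewrite inE.
Qed.

End borel.

Section borel2.
Local Open Scope ereal_scope.
Context (R : realType).

Lemma inord_lift n (j : 'I_n) : inord j.+1 = lift ord0 j :> 'I_n.+1.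
Proof. by apply/val_inj; rewrite /= inordK// ltnS. Qed.

Definition tbox n (a : n.-tuple R) (h : R) : set (n.-tuple R) :=
  [set x | forall i, (tnth a i <= tnth x i < tnth a i + h)%R].

Lemma measurable_tbox n (a : n.-tuple R) h : measurable (tbox a h).
Proof.
have -> : tbox a h = \bigcap_(i in [set: 'I_n])
    ((fun x : n.-tuple R => tnth x i) @^-1` `[tnth a i, (tnth a i + h)%R[%classic).
  apply/seteqP; split => x /= H i; first by move=> _ /=; rewrite in_itv/=.
  by have := H i I; rewrite /= in_itv.
apply: fin_bigcap_measurable => // i _; apply: preimage_measurable => //.
exact: measurable_tnth.
Qed.

Lemma borel_lebesgue_tbox n (a : n.-tuple R) h : (0 <= h)%R ->
  borel_lebesgue R n (tbox a h) = (h ^+ n)%:E.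
Proof.
move=> h0; elim: n => [|n IH] in a *.
  rewrite expr0 /= diracE mem_set//; by case.
rewrite borel_lebesgueSE.
rewrite (_ : (fun x => _) = ((cst (h ^+ n)%:E) \_ `[thead a, (thead a + h)%R[%classic)); last first.
  apply/funext => x; rewrite patchE mem_setE in_itv/=.
  have E t : tbox a h (tuple_consp (x, t)) <-> ((thead a <= x < thead a + h)%R /\ tbox [tuple of behead a] h t).
    split.
      move=> H; split; first by have := H ord0; rewrite tnth0.
      move=> i; have := H (lift ord0 i); rewrite /tuple_consp/= tnthS tnth_behead inord_lift; exact.
    move=> [H1 H2] i; case: (unliftP ord0 i) => [j|] ->; last by rewrite tnth0.
    have := H2 j; rewrite /tuple_consp/= tnthS tnth_behead inord_lift; exact.
  case: ifPn => [xa|xa].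
    rewrite -[RHS](IH [tuple of behead a]); congr (borel_lebesgue _ _ _).
    by apply/seteqP; split => t /=; [case/E|move=> ?; apply/E].
  rewrite -[RHS](@measure0 _ _ _ (borel_lebesgue R n)); congr (borel_lebesgue _ _ _).
  by apply/seteqP; split => t //= /E[]; rewrite (negbTE xa).
rewrite -integral_mkcond integral_cst//.
have := @lebesgue_measure_itv R (Interval (BLeft (thead a)) (BLeft (thead a + h)%R)).
rewrite /= lte_fin => ->; rewrite -EFinB; have [h1|] := ltP (thead a) (thead a + h)%R.
  by rewrite exprS addrC addKr mulrC -EFinM.
rewrite -[X in (_ <= X)%R]addr0 lerD2l => h1.
have -> : h = 0%R by apply/le_anti; rewrite h0 h1.
by rewrite exprS mul0r mule0.
Qed.

Lemma tonelli_set d1 d2 (T1 : measurableType d1) (T2 : measurableType d2)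
  (m1 : {sigma_finite_measure set T1 -> \bar R}) (m2 : {sigma_finite_measure set T2 -> \bar R})
  (C : set (T1 * T2)) : measurable C ->
  \int[m1]_x m2 [set y | C (x, y)] = \int[m2]_y m1 [set x | C (x, y)].
Proof.
move=> mC; have := indic_fubini_tonelli m1 m2 mC.
rewrite (indic_fubini_tonelli_FE m2 mC) (indic_fubini_tonelli_GE m1 mC) => H.
transitivity (\int[m1]_x (m2 \o xsection C) x).
  apply: eq_integral => x _ /=; congr (m2 _).
  by apply/seteqP; split => t; rewrite /xsection /= inE.
rewrite H; apply: eq_integral => x _ /=; congr (m1 _).
by apply/seteqP; split => t; rewrite /ysection /= inE.
Qed.

Lemma integral_measureI d1 d2 (T1 : measurableType d1) (T2 : measurableType d2)
  (m1 : {measure set T1 -> \bar R}) (m2 : {measure set T2 -> \bar R})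
  (A : set T1) (B : T1 -> set T2) (c : \bar R) : measurable A ->
  (forall x, A x -> m2 (B x) = c) ->
  \int[m1]_x m2 [set y | A x /\ B x y] = c * m1 A.
Proof.
move=> mA AB; rewrite (_ : (fun x => _) = (cst c \_ A)); last first.
  apply/funext => x; rewrite patchE; case: ifPn => [/set_mem Ax|/negP Ax].
    by rewrite -[in RHS](AB _ Ax); congr (m2 _); apply/seteqP; split => y /=; [case|].
  rewrite -[RHS](@measure0 _ _ _ m2); congr (m2 _).
  by apply/seteqP; split => y //= -[/mem_set].
by rewrite -integral_mkcond integral_cst.
Qed.

(** Let [c] be the measure of [S @^-1` (- Q)] for the unit cube [Q].  Integrating
over [y] in [Q] the measure of the [x] with [S x + y] in [A], which does not
depend on [y], and exchanging the integrals shows that the preimage of [A] has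
measure [c * mu A].  Applied twice to [Q], this gives [c * c = 1] because
[S] is an involution. *)
Lemma borel_lebesgue_involution n (S : n.-tuple R -> n.-tuple R) :
  measurable_fun setT S -> (forall x y, S (tadd x y) = tadd (S x) (S y)) ->
  involutive S ->
  forall A, measurable A -> borel_lebesgue R n (S @^-1` A) = borel_lebesgue R n A.
Proof.
move=> mS SD SS; pose mu := borel_lebesgue R n.
pose tsub (y x : n.-tuple R) := [tuple (tnth y i - tnth x i)%R | i < n].
pose Q := tbox [tuple 0%R | _ < n] 1.
have mQ : measurable Q by exact: measurable_tbox.
have Q1 : mu Q = 1 by rewrite /mu borel_lebesgue_tbox// expr1n.
pose c := mu [set x | Q (tsub [tuple 0%R | _ < n] (S x))].
have m1 : measurable_fun setT (fun z : n.-tuple R * n.-tuple R => tadd (S z.1) z.2).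
  by apply: measurable_fun_tadd => //; apply: measurableT_comp.
have m2 : measurable_fun setT (fun z : n.-tuple R * n.-tuple R => tsub z.2 (S z.1)).
  apply: measurable_fun_tuple => i; apply: measurable_funB.
    exact: measurable_fun_tnth_comp.
  by apply: measurable_fun_tnth_comp; apply: measurableT_comp.
have mQs y : measurable [set x | Q (tsub y (S x))].
  apply: (@preimage_measurable _ _ _ _ (fun x => tsub y (S x)) Q) => //.
  apply: measurable_fun_tuple => i; apply: measurable_funB => //.
  exact: measurable_fun_tnth_comp.
have key A : measurable A -> mu (S @^-1` A) = c * mu A.
  move=> mA.
  have mSA : measurable (S @^-1` A) by exact: preimage_measurable.
  transitivity (\int[mu]_y mu [set x | Q y /\ A (tadd (S x) y)]).
    rewrite (@integral_measureI _ _ _ _ mu mu Q (fun y => [set x | A (tadd (S x) y)]) (mu (S @^-1` A)))//.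
      by rewrite [X in _ * X]Q1 mule1.
    move=> y _; rewrite -[RHS](borel_lebesgue_translation (S y))//.
    by congr (mu _); apply/seteqP; split => x /=; rewrite SD SS.
  (* The inner measure is that of the preimage of A, whatever y is. *)
  rewrite -(@tonelli_set _ _ _ _ mu mu [set z | Q z.2 /\ A (tadd (S z.1) z.2)]); last first.
    by apply: measurableI; [apply: (@preimage_measurable _ _ _ _ snd)|exact: (preimage_measurable m1)].
  (* Substitute y - S x for y, then exchange the integrals again. *)
  transitivity (\int[mu]_x mu [set y | A y /\ Q (tsub y (S x))]).
    apply: eq_integral => x _ /=; rewrite -[RHS](borel_lebesgue_translation (S x)).
      congr (mu _); apply/seteqP; split => y /=; have -> : tadd y (S x) = tadd (S x) y.
      - by apply/eq_from_tnth => i; rewrite !tnth_tadd addrC.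
      - have -> : tsub (tadd (S x) y) (S x) = y; last by case.
        by apply/eq_from_tnth => i; rewrite tnth_mktuple tnth_tadd addrAC subrr add0r.
      - by apply/eq_from_tnth => i; rewrite !tnth_tadd addrC.
      - have -> : tsub (tadd (S x) y) (S x) = y; last by case.
        by apply/eq_from_tnth => i; rewrite tnth_mktuple tnth_tadd addrAC subrr add0r.
    apply: measurableI => //; apply: (@preimage_measurable _ _ _ _ (fun y => tsub y (S x)) Q) => //.
    by apply: measurable_fun_tuple => i; apply: measurable_funB => //; exact: measurable_tnth.
  rewrite (@tonelli_set _ _ _ _ mu mu [set z | A z.2 /\ Q (tsub z.2 (S z.1))]); last first.
    by apply: measurableI; [apply: (@preimage_measurable _ _ _ _ snd)|exact: (preimage_measurable m2)].
  rewrite (@integral_measureI _ _ _ _ mu mu A (fun y => [set x | Q (tsub y (S x))]) c)//.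
  move=> y _; rewrite -[LHS](borel_lebesgue_translation (S y))//.
  congr (mu _); apply/seteqP; split => x /=; rewrite SD SS; congr Q;
    by apply/eq_from_tnth => i; rewrite !tnth_mktuple; ring.
have c1 : c * c = 1.
  have := key _ (preimage_measurable mS mQ); rewrite (key _ mQ) Q1 mule1 => <-.
  rewrite -[RHS]Q1; congr (mu _); apply/seteqP; split => x /=; by rewrite SS.
have c0 : 0 <= c by exact: measure_ge0.
move=> A mA; change (mu (S @^-1` A) = mu A); rewrite key//.
suff -> : c = 1 by rewrite mul1e.
move: c0 c1; case: (c) => [r|_|]; [|by rewrite mulyy|by rewrite leeNy_eq].
rewrite lee_fin -EFinM => r0 [r1]; congr EFin.
have /eqP : ((r - 1) * (r + 1) = 0)%R by move: r1; lra.
rewrite mulf_eq0 => /orP[|/eqP]; last by lra.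
by rewrite subr_eq0 => /eqP.
Qed.
End borel2.

Section euclid_measure.
Local Open Scope ereal_scope.
Context (R : realType) (N : nat).
Local Notation T := (euclid R N).
Local Notation mu := (@lebesgueN R N).

Lemma measurable_euclid (A : set (N.-tuple R)) : measurable A ->
  measurable (A : set T).
Proof. by move=> mA; exact: caratheodory_measurable_mu_ext. Qed.

Lemma lebesgueNE (A : set (N.-tuple R)) : measurable A ->
  mu A = borel_lebesgue R N A.
Proof. by move=> mA; rewrite /lebesgueN /completed_measure_extension /= measurable_mu_extE. Qed.

Lemma measurable_fun_euclid d (U : measurableType d) (f : N.-tuple R -> U) :
  measurable_fun setT f -> measurable_fun [set: T] f.
Proof.
move=> mf _ B mB; rewrite setTI; apply: measurable_euclid.
exact: preimage_measurable.
Qed.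

Lemma lebesgueN_complete (A : set T) : mu.-negligible A -> measurable A.
Proof.
move=> nA; have := @measure_is_complete_caratheodory R _ ((borel_lebesgue R N)^*)%mu.
exact.
Qed.

Lemma measurable_coord (i : 'I_N) : measurable_fun [set: T] (fun x : T => tnth x i).
Proof. by apply: measurable_fun_euclid; exact: measurable_tnth. Qed.

Lemma measurable_fun_coord d (U : measurableType d) (f : U -> T) i :
  measurable_fun setT f -> measurable_fun setT (fun x => tnth (f x) i).
Proof. by move=> mf; apply: (measurableT_comp (measurable_coord i)). Qed.

(** Both the map and its inverse are tested on Borel sets only; the outer measure,
and with it all Lebesgue measurable sets, follows. *)
Definition preserving (f g : T -> T) :=
  [/\ cancel f g, cancel g f,
    forall A : set (N.-tuple R), measurable A ->
      measurable (f @^-1` A : set (N.-tuple R)) /\ borel_lebesgue R N (f @^-1` A) = borel_lebesgue R N A &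
    forall A : set (N.-tuple R), measurable A ->
      measurable (g @^-1` A : set (N.-tuple R)) /\ borel_lebesgue R N (g @^-1` A) = borel_lebesgue R N A].

Let mu_ext_le (f g : T -> T) A : preserving f g -> mu (f @^-1` A) <= mu A.
Proof.
move=> [fg gf pf pg]; rewrite /lebesgueN /completed_measure_extension /=.
apply: le_ereal_inf_tmp => _ [B [mB AB] <-].
apply: ereal_inf_lbound; exists (fun k => f @^-1` (B k)).
  split=> [k|x /= /AB[k _ Bk]]; last by exists k.
  by have [] := pf _ (mB k).
by apply: eq_eseriesr => k _; have [] := pf _ (mB k).
Qed.

Lemma lebesgueN_preserved (f g : T -> T) A : preserving f g ->
  mu (f @^-1` A) = mu A.
Proof.
move=> pfg; apply/eqP; rewrite eq_le (mu_ext_le _ pfg)/=.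
have pgf : preserving g f by case: pfg.
have := mu_ext_le (f @^-1` A) pgf; rewrite -comp_preimage.
by case: pfg => fg gf _ _; rewrite (_ : f \o g = id)//; apply/funext.
Qed.

(** Caratheodory's criterion for the preimage, tested on [X], is the criterion for
the set itself tested on [g @^-1` X], because the outer measure is invariant
on all sets. *)
Lemma measurable_preserving (f g : T -> T) : preserving f g ->
  measurable_fun setT f.
Proof.
move=> pfg _ A mA; rewrite setTI.
suff : caratheodory_measurable ((borel_lebesgue R N)^*)%mu (f @^-1` A) by exact.
move=> X.
have pgf : preserving g f by case: pfg.
have E (Y : set T) : g @^-1` (f @^-1` Y) = Y.
  by rewrite -comp_preimage; case: pfg => fg gf _ _; rewrite (_ : f \o g = id)//; apply/funext.
transitivity (mu (g @^-1` X)); first exact/esym/(lebesgueN_preserved X pgf).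
transitivity (mu ((g @^-1` X) `&` A) + mu ((g @^-1` X) `&` ~` A)).
  exact: mA.
congr (_ + _).
  transitivity (mu (g @^-1` (X `&` f @^-1` A))); last exact: (lebesgueN_preserved _ pgf).
  by rewrite preimage_setI E.
transitivity (mu (g @^-1` (X `&` ~` (f @^-1` A)))); last exact: (lebesgueN_preserved _ pgf).
by rewrite preimage_setI preimage_setC E.
Qed.

Definition reflection (e x : T) : T :=
  [tuple (tnth x i - 2 * edot x e * tnth e i)%R | i < N].

Lemma edotC (x y : T) : edot x y = edot y x.
Proof. by apply: eq_bigr => i _; rewrite mulrC. Qed.

Lemma edot_reflection (e x y : T) :
  edot (reflection e x) y = (edot x y - 2 * edot x e * edot e y)%R.
Proof.
rewrite /reflection; move: (2 * edot x e)%R => c.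
by rewrite /edot mulr_sumr -sumrB; apply: eq_bigr => i _; rewrite tnth_mktuple; ring.
Qed.

Lemma edotNN (e x y : T) : edot e e = 1%R ->
  edot (reflection e x) (reflection e y) = edot x y.
Proof.
move=> e1; rewrite edot_reflection ![edot _ (reflection _ _)]edotC !edot_reflection e1.
rewrite (edotC y x) (edotC e x); ring.
Qed.

Lemma reflectionK (e : T) : edot e e = 1%R -> involutive (reflection e).
Proof.
move=> e1 x; apply/eq_from_tnth => i.
by rewrite tnth_mktuple edot_reflection e1 tnth_mktuple; ring.
Qed.

Lemma preserving_reflection (e : T) : edot e e = 1%R ->
  preserving (reflection e) (reflection e).
Proof.
move=> e1.
have mS : measurable_fun setT (reflection e : N.-tuple R -> N.-tuple R).
  apply: measurable_fun_tuple => i; apply: measurable_funB; first exact: measurable_tnth.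
  apply: measurable_funM => //; apply: measurable_funM => //.
  by apply: measurable_sum => j; apply: measurable_funM => //; exact: measurable_tnth.
have H : forall A : set (N.-tuple R), measurable A ->
   measurable (reflection e @^-1` A : set (N.-tuple R)) /\
   borel_lebesgue R N (reflection e @^-1` A) = borel_lebesgue R N A.
  move=> A mA; split; first exact: (preimage_measurable mS).
  apply: borel_lebesgue_involution => //; last exact: reflectionK.
  move=> x y; apply/eq_from_tnth => i; rewrite !tnth_mktuple.
  have -> : edot (tadd x y : T) e = (edot x e + edot y e)%R.
    by rewrite /edot -big_split/=; apply: eq_bigr => j _; rewrite tnth_mktuple mulrDl.
  ring.
by split => //; exact: reflectionK.
Qed.

End euclid_measure.

(** * Euclidean geometry *)

Section cauchy_schwarz.
Context (R : realType) (N : nat).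
Implicit Types x y z : euclid R N.

Lemma sum_CauchySchwarz (a b : 'I_N -> R) :
  (\sum_i a i * b i) ^+ 2 <= (\sum_i a i ^+ 2) * (\sum_i b i ^+ 2).
Proof.
set P := \sum_i a i * b i; set A := \sum_i a i ^+ 2; set B := \sum_i b i ^+ 2.
have B0 : 0 <= B by apply: sumr_ge0 => i _; exact: sqr_ge0.
have : 0 <= \sum_i (B * a i - P * b i) ^+ 2 by apply: sumr_ge0 => i _; exact: sqr_ge0.
have -> : \sum_i (B * a i - P * b i) ^+ 2 = B * (A * B - P ^+ 2).
  have H (c d : R) : \sum_i (c * a i - d * b i) ^+ 2 =
      c ^+ 2 * A - 2 * c * d * P + d ^+ 2 * B.
    rewrite /A /P /B !mulr_sumr -sumrB -big_split/=.
    by apply: eq_bigr => i _; ring.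
  by rewrite H; ring.
move: B0; rewrite le_eqVlt => /orP[/eqP B0 _|B0]; last by rewrite pmulr_rge0// subr_ge0.
have b0 i : b i = 0.
  apply/eqP; rewrite -sqrf_eq0; apply/eqP.
  have := @psumr_eq0P _ _ predT (fun i => b i ^+ 2) (fun i _ => sqr_ge0 (b i)) (esym B0) i.
  exact.
by rewrite /P big1 ?expr0n ?mulr_ge0 ?sumr_ge0 // => i _; rewrite ?b0 ?mulr0// sqr_ge0.
Qed.

Lemma edist_ge0 x y : 0 <= edist x y. Proof. exact: sqrtr_ge0. Qed.

Lemma sqr_edist x y : edist x y ^+ 2 = \sum_(i < N) (tnth x i - tnth y i) ^+ 2.
Proof. by rewrite sqr_sqrtr// sumr_ge0// => i _; exact: sqr_ge0. Qed.

Lemma edistC x y : edist x y = edist y x.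
Proof. by congr Num.sqrt; apply: eq_bigr => i _; rewrite -sqrrN opprB. Qed.

Lemma coord_le_edist x y i : `|tnth x i - tnth y i| <= edist x y.
Proof.
rewrite -ler_sqr ?nnegrE ?edist_ge0// sqr_edist real_normK ?num_real//.
by rewrite (bigD1 i)//= lerDl sumr_ge0// => j _; exact: sqr_ge0.
Qed.

Lemma edist_triangle y x z : edist x z <= edist x y + edist y z.
Proof.
rewrite -ler_sqr ?nnegrE ?addr_ge0 ?edist_ge0// sqrrD !sqr_edist.
have -> : \sum_(i < N) (tnth x i - tnth z i) ^+ 2 =
  \sum_(i < N) (tnth x i - tnth y i) ^+ 2 +
  2 * \sum_(i < N) (tnth x i - tnth y i) * (tnth y i - tnth z i) +
  \sum_(i < N) (tnth y i - tnth z i) ^+ 2.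
  by rewrite mulr_sumr -!big_split/=; apply: eq_bigr => i _; ring.
rewrite lerD2r lerD2l -[leRHS]mulr_natl ler_pM2l//.
rewrite (le_trans (ler_norm _))// -ler_sqr ?nnegrE ?mulr_ge0 ?edist_ge0//.
by rewrite exprMn !sqr_edist real_normK ?num_real// sum_CauchySchwarz.
Qed.

Lemma edist_eq0 x y : edist x y = 0 -> x = y.
Proof.
move=> xy; apply/eq_from_tnth => i; apply/eqP; rewrite -subr_eq0 -normr_le0.
by rewrite -xy coord_le_edist.
Qed.

Lemma enorm_edist x : enorm x = edist x origin.
Proof.
congr Num.sqrt; apply: eq_bigr => i _.
by rewrite tnth_mktuple subr0 expr2.
Qed.

Lemma edot_sqr_ge0 x : 0 <= edot x x.
Proof. by apply: sumr_ge0 => i _; rewrite -expr2 sqr_ge0. Qed.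

Lemma sqr_enorm x : enorm x ^+ 2 = edot x x.
Proof. by rewrite sqr_sqrtr// edot_sqr_ge0. Qed.

Lemma edot_le x y : `|edot x y| <= enorm x * enorm y.
Proof.
rewrite -ler_sqr ?nnegrE ?mulr_ge0 ?sqrtr_ge0// exprMn !sqr_enorm real_normK ?num_real//.
apply: le_trans (sum_CauchySchwarz _ _) _.
by rewrite le_eqVlt; apply/orP; left; apply/eqP; congr (_ * _); apply: eq_bigr => i _; rewrite expr2.
Qed.

Lemma enorm_lip x y : `|enorm x - enorm y| <= edist x y.
Proof.
rewrite !enorm_edist ler_norml lerBlDr lerBrDr.
have := edist_triangle y x origin; have := edist_triangle x y origin.
rewrite (edistC y x); lra.
Qed.

Lemma edist_sqrE x y : edist x y ^+ 2 = edot x x - 2 * edot x y + edot y y.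
Proof.
rewrite sqr_edist /edot mulr_sumr -sumrB -big_split/=.
by apply: eq_bigr => i _; ring.
Qed.

Lemma edist_reflection e x y : edot e e = 1 ->
  edist (reflection e x) (reflection e y) = edist x y.
Proof.
move=> e1; apply/eqP; rewrite -(@eqrXn2 _ 2)// ?edist_ge0// !edist_sqrE.
by rewrite !edotNN.
Qed.

(** For points strictly on the same side of the hyperplane, reflecting one of them
increases the distance: all polarization inequalities come from this. *)
Lemma edist_reflection_sqr e x y : edot e e = 1 ->
  edist (reflection e x) y ^+ 2 = edist x y ^+ 2 + 4 * edot x e * edot y e.
Proof.
move=> e1; rewrite !edist_sqrE edotNN// edot_reflection (edotC e y); ring.
Qed.

Lemma enorm_reflection e x : edot e e = 1 -> enorm (reflection e x) = enorm x.
Proof. by move=> e1; rewrite /enorm edotNN. Qed.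

End cauchy_schwarz.

(** * Balls, boxes and half-spaces *)

Section sublevel_sets.
Context d (U : measurableType d) (R : realType) (f : U -> R).
Hypothesis mf : measurable_fun setT f.

Lemma measurable_lt_cst h : measurable [set x | f x < h].
Proof.
rewrite (_ : [set _ | _] = f @^-1` `]-oo, h[%classic); last first.
  by apply/seteqP; split => x /=; rewrite in_itv.
exact: preimage_measurable mf (measurable_itv _).
Qed.

Lemma measurable_le_cst h : measurable [set x | f x <= h].
Proof.
rewrite (_ : [set _ | _] = f @^-1` `]-oo, h]%classic); last first.
  by apply/seteqP; split => x /=; rewrite in_itv.
exact: preimage_measurable mf (measurable_itv _).
Qed.

End sublevel_sets.

Section euclid_sets.
Local Open Scope ereal_scope.
Context (R : realType) (N : nat).
Local Notation T := (euclid R N).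
Local Notation mu := (@lebesgueN R N).

Lemma measurable_edist d (U : measurableType d) (f g : U -> T) :
  measurable_fun setT f -> measurable_fun setT g ->
  measurable_fun setT (fun x => edist (f x) (g x)).
Proof.
move=> mf mg.
have ms : measurable_fun [set: R] (@Num.sqrt R).
  by apply: continuous_measurable_fun; exact: sqrt_continuous.
apply: (measurableT_comp ms).
apply: measurable_sum => i; apply: measurable_funX.
by apply: measurable_funB; exact: measurable_fun_coord.
Qed.

Lemma measurable_edistl (y : T) : measurable_fun setT (fun x : T => edist x y).
Proof. apply: measurable_edist; [exact: measurable_id|exact: measurable_cst]. Qed.

Lemma measurable_edot (e : T) : measurable_fun setT (fun x : T => edot x e).
Proof.
apply: measurable_sum => i.
apply: measurable_funM; [exact: measurable_coord|exact: measurable_cst].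
Qed.

Lemma measurable_ball_edist (y : T) h : measurable [set x : T | (edist x y < h)%R].
Proof. exact: measurable_lt_cst (measurable_edistl y) h. Qed.

Lemma lebesgueN_tbox (a : T) h : (0 <= h)%R -> mu (tbox a h) = (h ^+ N)%:E.
Proof.
by move=> h0; rewrite lebesgueNE ?borel_lebesgue_tbox//; exact: measurable_tbox.
Qed.

Lemma measurable_tboxN (a : T) h : measurable (tbox a h : set T).
Proof. by apply: measurable_euclid; exact: measurable_tbox. Qed.

Lemma ball_edist_le (y : T) h : (0 <= h)%R ->
  mu [set x | (edist x y < h)%R] <= ((2 * h) ^+ N)%:E.
Proof.
move=> h0; rewrite -(@lebesgueN_tbox [tuple (tnth y i - h)%R | i < N]) ?mulr_ge0//.
apply: le_measure; rewrite ?inE; [exact: measurable_ball_edist|exact: measurable_tboxN|].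
move=> x /= xy i; rewrite tnth_mktuple.
by have := le_lt_trans (coord_le_edist x y i) xy; rewrite ltr_norml => /andP[]; lra.
Qed.

Lemma tbox_edist (a x y : T) h : tbox a h x -> tbox a h y -> (edist x y <= N%:R * h)%R.
Proof.
case: N a x y => [|n] a x y ax ay; first by rewrite /Defs.edist big_ord0 sqrtr0 mul0r.
have h0 : (0 <= h)%R by have := ax ord0; lra.
rewrite -ler_sqr ?nnegrE ?edist_ge0 ?mulr_ge0// sqr_edist.
apply: (@le_trans _ _ (\sum_(i < n.+1) h ^+ 2)%R).
  apply: ler_sum => i _; rewrite -real_normK ?num_real// ler_sqr ?nnegrE//.
  by rewrite ler_norml; have := ax i; have := ay i; lra.
rewrite sumr_const card_ord -[leLHS]mulr_natl exprMn ler_wpM2r ?sqr_ge0//.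
by rewrite -natrX ler_nat leq_pmull.
Qed.

Lemma ball_edist_ge (y : T) h : (0 < h)%R -> (0 < N)%N ->
  ((h / (2 * N%:R)) ^+ N)%:E <= mu [set x | (edist x y < h)%R].
Proof.
move=> h0 N0; have N0' : (0 < N%:R :> R)%R by rewrite ltr0n.
have hN : (0 < h / (2 * N%:R))%R by rewrite divr_gt0// mulr_gt0.
rewrite -(@lebesgueN_tbox y); last exact: ltW.
apply: le_measure; rewrite ?inE; [exact: measurable_tboxN|exact: measurable_ball_edist|].
move=> x yx /=; have yy : tbox y (h / (2 * N%:R)) y by move=> i; rewrite lexx ltrDl.
apply: le_lt_trans (tbox_edist yx yy) _.
suff -> : (N%:R * (h / (2 * N%:R)) = h / 2)%R by lra.
by field; rewrite gt_eqF.
Qed.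

Lemma mu_bounded_lty (A : set T) (y : T) h : (forall x, A x -> (edist x y < h)%R) ->
  measurable A -> mu A < +oo.
Proof.
move=> Ah mA; apply: (@le_lt_trans _ _ ((2 * `|h|) ^+ N)%:E); last exact: ltry.
apply: le_trans (ball_edist_le y (normr_ge0 h)); apply: le_measure; rewrite ?inE//.
  exact: measurable_ball_edist.
by move=> x /Ah /= /lt_le_trans; apply; exact: ler_norm.
Qed.

End euclid_sets.

Section first_coordinate.
Local Open Scope ereal_scope.
Context (R : realType) (n : nat).
Local Notation T := (euclid R n.+1).
Local Notation mu := (@lebesgueN R n.+1).

Lemma hyperplane0 (t : R) : mu [set x | thead x = t] = 0.
Proof.
have m : measurable ([set x | thead x = t] : set (n.+1.-tuple R)).
  exact: (preimage_measurable (measurable_tnth ord0) (measurable_set1 t)).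
rewrite lebesgueNE// borel_lebesgueSE.
rewrite (_ : (fun x => _) = (fun x => borel_lebesgue R n [set y | [set t] x /\ [set: n.-tuple R] y])).
  rewrite (@integral_measureI _ _ _ _ _ lebesgue_measure (borel_lebesgue R n) [set t] (fun _ => setT) (borel_lebesgue R n setT))//.
  by rewrite [X in _ * X](lebesgue_measure_set1 t) mule0.
apply/funext => x; congr (borel_lebesgue _ _ _); apply/seteqP.
by split => y /=; [|case].
Qed.

Lemma measurable_thead_le (t : R) : measurable [set x : T | (thead x <= t)%R].
Proof. exact: measurable_le_cst (measurable_coord ord0) t. Qed.

Lemma measurable_thead_lt (t : R) : measurable [set x : T | (thead x < t)%R].
Proof. exact: measurable_lt_cst (measurable_coord ord0) t. Qed.

(** The measure of [E] below the level [t] is a continuous function of [t], because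
hyperplanes are null, and it increases from 0 to the measure of [E]. *)
Lemma measure_slice (E : set T) (m : R) : measurable E -> mu E < +oo ->
  (0 < m)%R -> m%:E < mu E ->
  exists t, mu (E `&` [set x | (thead x <= t)%R]) = m%:E.
Proof.
move=> mE Eoo m0 mEm.
pose S t := E `&` [set x : T | (thead x <= t)%R].
have mS t : measurable (S t) by apply: measurableI => //; exact: measurable_thead_le.
have Sle s t : (s <= t)%R -> mu (S s) <= mu (S t).
  move=> st; apply: le_measure; rewrite ?inE// => x [Ex /= xs]; split => //=.
  exact: le_trans st.
(* The level is the supremum of G; G is nonempty and bounded above by continuity of the measure at both ends. *)
pose G := [set t | mu (S t) <= m%:E].
have G0 : G !=set0.
  have : mu \o (fun k : nat => S (- k%:R)%R) @ \oo --> mu (\bigcap_k S (- k%:R)%R).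
    apply: nonincreasing_cvg_mu => //.
    - by apply: le_lt_trans Eoo; apply: le_measure; rewrite ?inE//; exact: subIsetl.
    - exact: bigcapT_measurable.
    - move=> k l kl; apply/subsetPset => x [Ex /= xs]; split => //=.
      by apply: le_trans xs _; rewrite lerN2 ler_nat.
  rewrite (_ : \bigcap_k _ = set0) ?measure0; last first.
    apply/seteqP; split => x //= H.
    have := H (Num.truncn `|thead x|).+1 I => -[_ /=].
    apply/negP; rewrite -ltNge; have := truncnS_gt `|thead x|%R.
    have := ler_norm (- thead x); rewrite normrN; lra.
  move=> /fine_cvgP[fS /cvgrPdist_lt/(_ _ m0)[k _ H]].
  case: fS => k' _ fS.
  exists (- (maxn k k')%:R)%R; rewrite /G /=.
  have := H (maxn k k') (leq_maxl _ _); rewrite /= sub0r normrN => Hm.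
  rewrite -[leLHS]fineK ?fS//= ?leq_maxr// lee_fin.
  by apply/ltW/(le_lt_trans (ler_norm _)).
have [t1 Gt1] : exists t1, m%:E < mu (S t1).
  have : mu \o (fun k : nat => S (k%:R)%R) @ \oo --> mu (\bigcup_k S (k%:R)%R).
    apply: nondecreasing_cvg_mu => //.
    - exact: bigcupT_measurable.
    - move=> k l kl; apply/subsetPset => x [Ex /= xs]; split => //=.
      by apply: le_trans xs _; rewrite ler_nat.
  rewrite (_ : \bigcup_k _ = E); last first.
    apply/seteqP; split => x; first by case=> k _ [].
    move=> Ex; exists (Num.truncn `|thead x|).+1 => //; split => //=.
    have := truncnS_gt `|thead x|%R.
    have := ler_norm (thead x); lra.
  move=> cS; apply: contrapT => H; have : mu E <= m%:E.
    rewrite -(cvg_lim _ cS)//; apply: lime_le; first by apply/cvg_ex; exists (mu E).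
    by apply: nearW => k /=; rewrite leNgt; apply/negP => Hk; apply: H; exists k%:R.
  by apply/negP; rewrite -ltNge.
have Gub : ubound G t1.
  move=> t /= Gt; rewrite leNgt; apply/negP => /ltW /Sle.
  by move=> /(lt_le_trans Gt1) /lt_le_trans /(_ Gt); rewrite ltxx.
have hG : has_sup G by split => //; exists t1.
pose t := sup G; exists t; apply/eqP; rewrite eq_le; apply/andP; split.
  (* Continuity from the left at the supremum, up to the null hyperplane. *)
  have null : mu (S t) <= mu (E `&` [set x : T | (thead x < t)%R]).
    rewrite -[leRHS]adde0 -(hyperplane0 t).
    have mh : measurable [set x : T | thead x = t].
      exact: (preimage_measurable (measurable_coord ord0) (measurable_set1 t)).
    have mlt : measurable (E `&` [set x : T | (thead x < t)%R]).
      by apply: measurableI => //; exact: measurable_thead_lt.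
    apply: le_trans (measureU2 _ mlt mh); apply: le_measure; rewrite ?inE//.
      exact: measurableU.
    move=> x [Ex /=]; rewrite le_eqVlt => /orP[/eqP|] ?; [by right|by left].
  apply: le_trans null _.
  have : mu \o (fun k : nat => S (t - k.+1%:R^-1)%R) @ \oo --> mu (\bigcup_k S (t - k.+1%:R^-1)%R).
    apply: nondecreasing_cvg_mu => //.
    - exact: bigcupT_measurable.
    - move=> k l kl; apply/subsetPset => x [Ex /= xs]; split => //=.
      by apply: le_trans xs _; rewrite lerD2l lerN2 lef_pV2 ?posrE// ler_nat.
  rewrite (_ : \bigcup_k _ = E `&` [set x : T | (thead x < t)%R]); last first.
    apply/seteqP; split => x.
      case=> k _ [Ex /= xt]; split => //=; apply: le_lt_trans xt _.
      by rewrite ltrBlDr ltrDl invr_gt0.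
    move=> [Ex /=]; rewrite -subr_gt0 => /ltr_add_invr[k].
    by rewrite add0r => H; exists k => //; split => //=; rewrite lerBrDr addrC -lerBrDr ltW.
  move=> /cvg_lim <- //; apply: lime_le; first by apply: ereal_nondecreasing_is_cvgn => k l kl; apply: Sle; rewrite lerD2l lerN2 lef_pV2 ?posrE// ler_nat.
  apply: nearW => k /=.
  have : (0 < k.+1%:R^-1 :> R)%R by rewrite invr_gt0.
  move=> /(sup_adherent)/(_ hG)[u Gu /ltW utk].
  by apply: le_trans (Sle _ _ utk) _.
(* Continuity from the right. *)
have : mu \o (fun k : nat => S (t + k.+1%:R^-1)%R) @ \oo --> mu (\bigcap_k S (t + k.+1%:R^-1)%R).
  apply: nonincreasing_cvg_mu => //.
  - by apply: le_lt_trans Eoo; apply: le_measure; rewrite ?inE//; exact: subIsetl.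
  - exact: bigcapT_measurable.
  - move=> k l kl; apply/subsetPset => x [Ex /= xs]; split => //=.
    by apply: le_trans xs _; rewrite lerD2l lef_pV2 ?posrE// ler_nat.
rewrite (_ : \bigcap_k _ = S t); last first.
  apply/seteqP; split => x.
    move=> H; split; first by have [] := H 0%N I.
    rewrite /= leNgt; apply/negP; rewrite -subr_gt0 => /ltr_add_invr[k].
    by rewrite add0r => kt; have [_ /=] := H k I; rewrite addrC -lerBlDr leNgt kt.
  move=> [Ex /= xt] k _; split => //=; apply: le_trans xt _.
  by rewrite lerDl invr_ge0.
move=> /cvg_lim <- //; apply: lime_ge; first by apply: ereal_nonincreasing_is_cvgn => k l kl; apply: Sle; rewrite lerD2l lef_pV2 ?posrE// ler_nat.
apply: nearW => k /=; rewrite leNgt; apply/negP => /ltW Gk.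
have : (t + k.+1%:R^-1 <= t)%R by apply: ub_le_sup => //; exists t1.
by apply/negP; rewrite -ltNge ltrDl invr_gt0.
Qed.

End first_coordinate.

(** * The singular kernel *)

Section real_powers.
Context (R : realType).

Lemma geometric_eseries_le (c q : R) : 0 <= c -> 0 <= q < 1 ->
  (\sum_(k <oo) (c * q ^+ k)%:E <= (c / (1 - q))%:E)%E.
Proof.
move=> c0 /andP[q0 q1]; apply: lime_le.
  by apply: is_cvg_nneseries => k _ _; rewrite lee_fin mulr_ge0// exprn_ge0.
apply: nearW => n; rewrite sumEFin lee_fin.
have -> : \sum_(0 <= i < n) c * q ^+ i = series (geometric c q) n by [].
rewrite geometric_seriesE ?lt_eqF//= ler_pM2r ?invr_gt0 ?subr_gt0//.
by rewrite ler_piMr// gerBl exprn_ge0.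
Qed.

Lemma powRXn (x p : R) k : 0 <= x -> (x ^+ k) `^ p = (x `^ p) ^+ k.
Proof.
move=> x0; elim: k => [|k IH]; first by rewrite !expr0 powR1.
by rewrite !exprS powRM ?exprn_ge0// IH.
Qed.

Lemma dyadic_small (t : R) : 0 < t < 1 ->
  exists k, (2^-1) ^+ k.+1 <= t < (2^-1) ^+ k.
Proof.
move=> /andP[t0 t1].
have ex : exists n, (2^-1) ^+ n.+1 <= t.
  exists (Num.truncn t^-1).
  rewrite exprVn invf_ple ?posrE ?exprn_gt0//.
  apply: ltW; apply: lt_le_trans (truncnS_gt t^-1) _.
  by rewrite -natrX ler_nat ltnW// ltn_expl.
case: (ex_minnP ex) => k Hk Hmin; exists k; rewrite Hk/=.
case: k Hk Hmin => [|k] Hk Hmin; first by rewrite expr0.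
by rewrite ltNge; apply/negP => /Hmin; rewrite ltnn.
Qed.

Lemma dyadic_large (t : R) : 1 <= t -> exists k, 2 ^+ k <= t < 2 ^+ k.+1.
Proof.
move=> t1.
have ex : exists n, t < 2 ^+ n.+1.
  exists (Num.truncn t); apply: lt_trans (truncnS_gt t) _.
  by rewrite -natrX ltr_nat ltn_expl.
case: (ex_minnP ex) => k Hk Hmin; exists k; rewrite Hk andbT.
case: k Hk Hmin => [|k] Hk Hmin; first by rewrite expr0.
by rewrite leNgt; apply/negP => /Hmin; rewrite ltnn.
Qed.

(** The sum of two geometric series: the dyadic shells inside and outside of the
unit ball, see [integral_min_powR]. *)
Definition kernel_bound (N : nat) (s : R) : R :=
  2 `^ (N%:R + 2 * s) * 2 ^+ N / (1 - 2 `^ (2 * s) / 4) + 4 ^+ N / (1 - (2 `^ (2 * s))^-1).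

End real_powers.

Section shells.
Context d (T : measurableType d) (R : realType) (mu : {measure set T -> \bar R}).
Context (N : nat) (dist : T -> R).
Hypothesis mdist : measurable_fun setT dist.
Hypothesis dist_ge0 : forall x, 0 <= dist x.
Hypothesis dist_le : forall h, 0 <= h ->
  (mu [set x | (dist x < h)%R] <= ((2 * h) ^+ N)%:E)%E.

(** [G] is at most the sum of the multiples [a k] of the indicators of the balls of
radius [h k]. *)
Lemma integral_shells (G : T -> R) (a h : nat -> R) (c q : R) :
  measurable_fun setT G -> (forall x, 0 <= G x) ->
  (forall k, 0 <= a k) -> (forall k, 0 <= h k) -> 0 <= c -> 0 <= q < 1 ->
  (forall k, a k * (2 * h k) ^+ N <= c * q ^+ k) ->
  (forall x, 0 < G x -> exists2 k, dist x < h k & G x <= a k) ->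
  (\int[mu]_x (G x)%:E <= (c / (1 - q))%:E)%E.
Proof.
move=> mG G0 a0 h0 c0 q01 ah cov.
pose B k := [set x : T | dist x < h k].
pose f k (x : T) : \bar R := ((a k)%:E * (\1_(B k) x)%:E)%E.
have mB k : measurable (B k) by exact: measurable_lt_cst.
have f0 k x : (0 <= f k x)%E by rewrite mule_ge0 ?lee_fin.
have mf k : measurable_fun setT (f k).
  apply: emeasurable_funM; first exact: measurable_cst.
  by apply/measurable_EFinP; exact: measurable_indic.
apply: (@le_trans _ _ (\int[mu]_x \sum_(k <oo) f k x)%E).
  apply: ge0_le_integral => //.
  - by move=> x _; rewrite lee_fin.
  - exact/measurable_EFinP.
  - exact: ge0_emeasurable_sum.
  - move=> x _; have [Gx|Gx] := ltP 0 (G x); last first.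
      by apply: (@le_trans _ _ 0%E); [rewrite lee_fin|apply: nneseries_ge0].
    have [k xk Gk] := cov x Gx.
    apply: le_trans (nneseries_lim_ge k.+1 _); last by [].
    rewrite big_nat_recr//=; apply: (@le_trans _ _ (f k x)).
      by rewrite /f indicE mem_set// mule1 lee_fin.
    by rewrite leeDr// sume_ge0.
rewrite integral_nneseries//; apply: le_trans (geometric_eseries_le c0 q01).
apply: lee_nneseries => [k _ _|k _]; first by apply: integral_ge0.
rewrite /f ge0_integralZl_EFin//; last first.
  by apply/measurable_EFinP; exact: measurable_indic.
rewrite integral_indic// setIT.
apply: (@le_trans _ _ ((a k)%:E * ((2 * h k) ^+ N)%:E)%E).
  by apply: lee_wpmul2l; rewrite ?lee_fin//; exact: dist_le.
by rewrite -EFinM lee_fin.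
Qed.

(** The shell at distance about [2 ^ - k] contributes about [2 ^ (- k (2 - 2 s))], the
shell at distance about [2 ^ k] contributes about [2 ^ (- 2 s k)]; both series
converge since [0 < s < 1]. *)
Lemma integral_min_powR (s : R) : 0 < s < 1 ->
  (\int[mu]_x (Num.min 1 (dist x ^+ 2) * (dist x `^ (N%:R + 2 * s))^-1)%:E <= (kernel_bound N s)%:E)%E.
Proof.
move=> /andP[s0 s1]; pose p := N%:R + 2 * s.
pose b : R := 2 `^ p; pose g : R := 2 `^ (2 * s).
have p0 : 0 < p by rewrite /p ltr_wpDl// mulr_gt0.
have bE : b = 2 ^+ N * g by rewrite /b /p powRD ?pnatr_eq0 ?implybT// powR_mulrn.
have pow1 (a r : R) : 1 < a -> 0 < r -> 1 < a `^ r.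
  move=> a1 r0; have H : (1 : R) `^ r = 1 by rewrite powR1.
  by rewrite -[ltLHS]H gt0_ltr_powR ?nnegrE//; lra.
have g1 : 1 < g by apply: pow1; rewrite ?ltr1n// mulr_gt0.
have g4 : g < 4.
  have -> : g = 4 `^ s by rewrite /g powRrM powR_mulrn//; congr (_ `^ _); ring.
  rewrite -[ltRHS](@powRr1 _ 4)// -[X in _ < _ `^ X](subrK s) addrC powRD ?pnatr_eq0 ?implybT//.
  by rewrite ltr_pMr ?powR_gt0// pow1 ?ltr1n// subr_gt0.
have b0 : 0 < b by rewrite bE mulr_gt0 ?exprn_gt0//; lra.
pose F x := Num.min 1 (dist x ^+ 2) * (dist x `^ (N%:R + 2 * s))^-1.
have mF : measurable_fun setT F.
  apply: measurable_funM; last first.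
    under eq_fun do rewrite -powRN.
    exact: measurableT_comp (measurable_powR _) mdist.
  by apply: measurable_minr => //; exact: measurable_funX.
have F0 x : 0 <= F x by rewrite mulr_ge0 ?invr_ge0 ?powR_ge0// le_min ler01 sqr_ge0.
pose B := [set x : T | dist x < 1].
have mB : measurable B by exact: measurable_lt_cst.
have FE x : F x = F x * \1_B x + F x * \1_(~` B) x.
  by rewrite !indicE in_setC; case: (x \in B); rewrite ?mulr1 ?mulr0 ?addr0 ?add0r.
have dist_pos x : 0 < F x -> 0 < dist x.
  move=> Fx; rewrite lt_neqAle dist_ge0 andbT; apply/eqP => xy.
  by move: Fx; rewrite /F -xy expr0n/= min_r// mul0r ltxx.
under eq_integral do rewrite -/(F _) FE EFinD.
have mi (A : set T) : measurable A -> measurable_fun setT (fun x => F x * \1_A x).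
  by move=> mA; apply: measurable_funM; [exact: mF|exact: measurable_indic].
rewrite ge0_integralD//; last 4 first.
- by move=> x _; rewrite lee_fin mulr_ge0.
- by apply/measurable_EFinP; exact: mi.
- by move=> x _; rewrite lee_fin mulr_ge0.
- by apply/measurable_EFinP; apply: mi; exact: measurableC.
rewrite /kernel_bound EFinD; apply: leeD.
- apply: (@integral_shells _ (fun k => b * (b / 4) ^+ k) (fun k => 2^-1 ^+ k)).
  + exact: mi.
  + by move=> x; rewrite mulr_ge0.
  + by move=> k; rewrite mulr_ge0 ?exprn_ge0 ?divr_ge0// ltW.
  + by move=> k; rewrite exprn_ge0.
  + by rewrite mulr_ge0 ?powR_ge0// exprn_ge0.
  + by rewrite -/g; lra.
  + move=> k; rewrite -/p -/b -/g.
    have -> : (2 * 2^-1 ^+ k) ^+ N = 2 ^+ N * (2^-1 ^+ N) ^+ k :> R.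
      by rewrite exprMn -!exprM mulnC.
    have -> : g / 4 = b / 4 * 2^-1 ^+ N.
      by rewrite bE exprVn; field; rewrite expf_neq0.
    move: (b / 4) (2^-1 ^+ N) => w z.
    by rewrite exprMn le_eqVlt; apply/orP; left; apply/eqP; ring.
  + move=> x; rewrite indicE; case: (boolP (x \in B)) => [/set_mem xB|]; last by rewrite mulr0 ltxx.
    rewrite mulr1 => Fx; have [//|k /andP[k1 k2]] := @dyadic_small _ (dist x).
      by rewrite dist_pos.
    exists k => //; rewrite /F -/p.
    apply: (@le_trans _ _ ((2^-1 ^+ k) ^+ 2 * ((2^-1 ^+ k.+1) `^ p)^-1)).
      apply: ler_pM; rewrite ?invr_ge0 ?powR_ge0//.
      * by rewrite le_min ler01 sqr_ge0.
      * by rewrite ge_min; apply/orP; right; rewrite ler_sqr ?nnegrE ?dist_ge0 ?exprn_ge0// ltW.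
      * rewrite lef_pV2 ?posrE ?powR_gt0 ?dist_pos// ?exprn_gt0//.
        by rewrite ge0_ler_powR ?nnegrE ?dist_ge0 ?exprn_ge0// ltW.
    rewrite powRXn ?invr_ge0//.
    have -> : 2^-1 `^ p = b^-1.
      have : 2^-1 `^ p * b = 1 by rewrite -powRM// mulVf// powR1.
      by move=> H; apply: (mulIf (lt0r_neq0 b0)); rewrite H mulVf// gt_eqF.
    rewrite -[X in _ * X]exprVn invrK /= (_ : b / 4 = 2^-1 ^+ 2 * b); last by field.
    rewrite (exprS b k) [in leRHS]exprMn (exprAC 2^-1 2 k).
    by rewrite le_eqVlt; apply/orP; left; apply/eqP; ring.
- apply: (@integral_shells _ (fun k => (b^-1) ^+ k) (fun k => 2 ^+ k.+1)).
  + apply: mi; exact: measurableC.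
  + by move=> x; rewrite mulr_ge0.
  + by move=> k; rewrite exprn_ge0// invr_ge0 ltW.
  + by move=> k; rewrite exprn_ge0.
  + by rewrite exprn_ge0.
  + by rewrite -/g invr_ge0 invf_lt1; lra.
  + move=> k; rewrite -/g.
    have -> : (2 * 2 ^+ k.+1) ^+ N = 4 ^+ N * (2 ^+ N) ^+ k :> R.
      rewrite exprS mulrA exprMn -!exprM mulnC; congr (_ ^+ _ * _); ring.
    have -> : g^-1 = b^-1 * 2 ^+ N.
      by rewrite bE; field; rewrite expf_neq0//= gt_eqF//; lra.
    move: (b^-1) (2 ^+ N : R) => w z.
    by rewrite exprMn le_eqVlt; apply/orP; left; apply/eqP; ring.
  + move=> x; rewrite indicE in_setC; case: (boolP (x \in B)) => [|xB]; first by rewrite mulr0 ltxx.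
    rewrite mulr1 => Fx; have [|k /andP[k1 k2]] := @dyadic_large _ (dist x).
      by rewrite leNgt; apply/negP => /mem_set; exact/negP.
    exists k => //; rewrite /F -/p.
    apply: (@le_trans _ _ (1 * ((2 ^+ k) `^ p)^-1)).
      apply: ler_pM; rewrite ?invr_ge0 ?powR_ge0//.
      * by rewrite le_min ler01 sqr_ge0.
      * by rewrite ge_min lexx.
      * rewrite lef_pV2 ?posrE ?powR_gt0 ?dist_pos// ?exprn_gt0//.
        by rewrite ge0_ler_powR ?nnegrE ?dist_ge0 ?exprn_ge0// ltW.
    by rewrite mul1r powRXn// exprVn.
Qed.

End shells.

Section kernel.
Context (R : realType) (N : nat).
Local Notation T := (euclid R N).
Local Notation mu := (@lebesgueN R N).

Definition kern (s : R) (x y : T) : R := (edist x y `^ (N%:R + 2 * s))^-1.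

Lemma kern_ge0 s x y : 0 <= kern s x y.
Proof. by rewrite invr_ge0 powR_ge0. Qed.

Lemma kern_gt0 s x y : x <> y -> 0 < kern s x y.
Proof.
move=> xy; rewrite invr_gt0 powR_gt0// lt_neqAle edist_ge0 andbT.
by apply/eqP => /esym/edist_eq0.
Qed.

Lemma kernC s x y : kern s x y = kern s y x.
Proof. by rewrite /kern edistC. Qed.

Lemma measurable_kern s d (U : measurableType d) (f g : U -> T) :
  measurable_fun setT f -> measurable_fun setT g ->
  measurable_fun setT (fun x => kern s (f x) (g x)).
Proof.
move=> mf mg; rewrite /kern; under eq_fun do rewrite -powRN.
apply: (measurableT_comp (measurable_powR _)); exact: measurable_edist.
Qed.

Lemma integral_min_kern (s : R) (y : T) : 0 < s < 1 ->
  (\int[mu]_x (Num.min 1 (edist x y ^+ 2) * kern s x y)%:E <= (kernel_bound N s)%:E)%E.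
Proof.
move=> s01; exact: (integral_min_powR (measurable_edistl y) (fun x => edist_ge0 x y) (@ball_edist_le _ _ y) s01).
Qed.

Lemma sin_sqr_le (x : R) : (sin x) ^+ 2 <= x ^+ 2.
Proof.
wlog x0 : x / 0 <= x.
  move=> H; have [|x0] := leP 0 x; first exact: H.
  by rewrite -sqrrN -sinN -[leRHS]sqrrN; apply: H; rewrite oppr_ge0 ltW.
have [c _] := @MVT_segment R sin cos 0 x x0 (fun x _ => is_derive_sin x)
  (continuous_subspaceT (@continuous_sin R)).
rewrite sin0 !subr0 => ->; rewrite exprMn ler_piMl ?sqr_ge0//.
Qed.

Lemma one_sub_cosE (x : R) : 1 - cos x = 2 * sin (x / 2) ^+ 2.
Proof.
have -> : cos x = cos ((x / 2) *+ 2) by rewrite -mulr_natr divfK.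
by rewrite cos_mulr2n; have := cos2Dsin2 (x / 2); lra.
Qed.

Lemma one_sub_cos_le (x : R) : 1 - cos x <= 2 * Num.min 1 (x ^+ 2).
Proof.
rewrite minEle; case: ifP => _; first by have := cos_geN1 x; lra.
rewrite one_sub_cosE; have := sin_sqr_le (x / 2); rewrite expr_div_n.
by have := sqr_ge0 x; lra.
Qed.

(** The constant is the inverse of an integral; the integral is finite because
[1 - cos t <= 2 min (1, t ^ 2)], and not zero because the integrand is positive
on a cube. *)
Lemma fraclap_const_gt0 (s : R) : (0 < N)%N -> 0 < s < 1 -> 0 < @fraclap_const R N s.
Proof.
move=> N0 s01; rewrite invr_gt0.
pose i := Ordinal N0.
pose F (z : T) := (1 - cos (tnth z i)) * kern s z origin.
have FE : (\int[mu]_z ((1 - cos (nth 0 z 0%N)) / (enorm z `^ (N%:R + 2 * s)))%:E)%E =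
    (\int[mu]_z (F z)%:E)%E.
  by apply: eq_integral => z _; rewrite /F /kern enorm_edist (tnth_nth 0).
rewrite FE {FE}.
have mF : measurable_fun setT (EFin \o F).
  apply/measurable_EFinP; apply: measurable_funM.
    apply: measurable_funB; first exact: measurable_cst.
    apply: measurableT_comp; last exact: measurable_coord.
    by apply: continuous_measurable_fun; exact: continuous_cos.
  apply: measurable_kern; [exact: measurable_id|exact: measurable_cst].
have F0 z : 0 <= F z by rewrite mulr_ge0 ?kern_ge0// subr_ge0 cos_le1.
have mG : measurable_fun setT (fun z : T => (Num.min 1 (edist z origin ^+ 2) * kern s z origin)%:E).
  apply/measurable_EFinP; apply: measurable_funM.
    apply: measurable_minr; first exact: measurable_cst.
    exact: measurable_funX (measurable_edistl _).
  apply: measurable_kern; [exact: measurable_id|exact: measurable_cst].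
have G0 z : (0 <= (Num.min 1 (edist z origin ^+ 2) * kern s z origin)%:E)%E.
  by rewrite lee_fin mulr_ge0 ?kern_ge0// le_min ler01 sqr_ge0.
apply: fine_gt0; apply/andP; split; last first.
  apply: (@le_lt_trans _ _ (2 * kernel_bound N s)%:E); last exact: ltry.
  rewrite EFinM; apply: le_trans (lee_wpmul2l _ (integral_min_kern origin s01)); last by [].
  rewrite -(@ge0_integralZl_EFin _ _ _ mu setT measurableT _ (fun z _ => G0 z) mG 2)//.
  apply: (@ge0_le_integral _ _ _ mu setT measurableT _ _ _ mF).
  - by move=> z _; rewrite lee_fin.
  - by apply: emeasurable_funM; [exact: measurable_cst|exact: mG].
  - move=> z _; rewrite -EFinM lee_fin /F mulrA ler_wpM2r ?kern_ge0//.
    apply: le_trans (one_sub_cos_le _) _; rewrite ler_pM2l// le_min ge_min lexx/=.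
    rewrite ge_min; apply/orP; right.
    rewrite -[leLHS]real_normK ?num_real// ler_sqr ?nnegrE ?edist_ge0//.
    by apply: le_trans (coord_le_edist _ _ i); rewrite tnth_mktuple subr0.
rewrite lt_neqAle integral_ge0 ?andbT; last by move=> z _; rewrite lee_fin.
apply/eqP => F00.
(* On the unit cube with corner a, the first coordinate lies between 1/2 and 3/2, so that its cosine is not 1. *)
pose a : T := [tuple 2^-1 | _ < N].
have : ae_eq mu setT (EFin \o F) (cst 0%E).
  apply/(ae_eq_integral_abs mu measurableT mF); rewrite F00.
  by apply: eq_integral => z _; rewrite /= ger0_norm.
move=> [A [mA A0 HA]].
have : (mu (tbox a 1) <= mu A)%E.
  apply: le_measure; rewrite ?inE//; first exact: measurable_tboxN.
  move=> z za; apply: HA => /= /(_ I) [] /eqP.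
  have := za i; rewrite tnth_mktuple => zi.
  rewrite mulf_eq0 => /orP[|].
    rewrite one_sub_cosE mulf_eq0 pnatr_eq0/= sqrf_eq0 => /eqP s0.
    have : 0 < sin (tnth z i / 2) by apply: sin_gt0_pi; have := @pi_ge2 R; lra.
    by rewrite s0 ltxx.
  apply/negP; rewrite gt_eqF// kern_gt0// => z0.
  by move: zi; rewrite z0 tnth_mktuple; lra.
by rewrite A0 lebesgueN_tbox// expr1n lee_fin; lra.
Qed.

End kernel.

(** * Square integrable functions and the energy *)

Section square_integrable.
Context d (T : measurableType d) (R : realType).
Variables (m : {measure set T -> \bar R}) (D : set T).
Hypothesis mD : measurable D.
Implicit Types f g : T -> R.

Definition l2 f := measurable_fun D f /\
  (\int[m]_(x in D) (f x ^+ 2)%:E < +oo)%E.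

Definition ip f g : R := \int[m]_(x in D) (f x * g x).

Lemma l2_integrable f g : l2 f -> l2 g ->
  m.-integrable D (EFin \o (fun x => f x * g x)).
Proof.
move=> [mf f2] [mg g2].
have mf2 : measurable_fun D (fun x => (f x ^+ 2)%:E).
  by apply/measurable_EFinP; exact: measurable_funX.
have mg2 : measurable_fun D (fun x => (g x ^+ 2)%:E).
  by apply/measurable_EFinP; exact: measurable_funX.
have i : m.-integrable D (fun x => (f x ^+ 2)%:E + (g x ^+ 2)%:E)%E.
  by apply: integrableD => //; apply/integrableP; split => //;
    under eq_integral do rewrite gee0_abs ?lee_fin ?sqr_ge0//.
apply: le_integrable i => //.
  by apply/measurable_EFinP; exact: measurable_funM.
move=> x Dx; rewrite /= lee_fin [leRHS]ger0_norm ?addr_ge0 ?sqr_ge0//.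
rewrite normrM -(real_normK (num_real (f x))) -(real_normK (num_real (g x))).
by have := sqr_ge0 (`|f x| - `|g x|); have := sqr_ge0 (`|f x| + `|g x|); nra.
Qed.

Lemma ip_ge0 f : 0 <= ip f f.
Proof. by apply: Rintegral_ge0 => x _; rewrite -expr2 sqr_ge0. Qed.

Lemma ipE f : l2 f -> (ip f f)%:E = (\int[m]_(x in D) (f x ^+ 2)%:E)%E.
Proof.
move=> l2f; rewrite fineK; last exact: integrable_fin_num (l2_integrable l2f l2f).
by apply: eq_integral => x _; rewrite expr2.
Qed.

Lemma ipP f M : measurable_fun D f -> (\int[m]_(x in D) (f x ^+ 2)%:E <= M%:E)%E ->
  l2 f /\ ip f f <= M.
Proof.
move=> mf fM; have l2f : l2 f by split => //; apply: le_lt_trans fM (ltry _).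
by split=> //; rewrite -lee_fin ipE.
Qed.

Lemma ip_expand f g t : l2 f -> l2 g ->
  ip (fun x => f x + t * g x) (fun x => f x + t * g x) =
  ip f f + 2 * t * ip f g + t ^+ 2 * ip g g.
Proof.
move=> l2f l2g; have iff := l2_integrable l2f l2f; have ifg := l2_integrable l2f l2g.
have igg := l2_integrable l2g l2g.
have ifg' : m.-integrable D (EFin \o (fun x => 2 * t * (f x * g x))).
  exact: (integrableZl mD (2 * t) ifg).
have igg' : m.-integrable D (EFin \o (fun x => t ^+ 2 * (g x * g x))).
  exact: (integrableZl mD (t ^+ 2) igg).
have i2 : m.-integrable D (EFin \o (fun x => f x * f x + 2 * t * (f x * g x))).
  exact: (integrableD mD iff ifg').
rewrite /ip -RintegralZl// -[t ^+ 2 * _]RintegralZl// -RintegralD// -RintegralD//.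
by apply: eq_Rintegral => x _; ring.
Qed.

Lemma l2D f g t : l2 f -> l2 g -> l2 (fun x => f x + t * g x).
Proof.
move=> l2f l2g; have [mf _] := l2f; have [mg _] := l2g.
split.
  by apply: measurable_funD => //; exact: measurable_funM.
have iff := l2_integrable l2f l2f; have ifg := l2_integrable l2f l2g.
have igg := l2_integrable l2g l2g.
have ifg' := integrableZl mD (2 * t) ifg.
have igg' := integrableZl mD (t ^+ 2) igg.
have := integrableD mD (integrableD mD iff ifg') igg'.
move=> /integrableP[_]; apply: le_lt_trans.
apply: ge0_le_integral => //.
- by move=> x _; rewrite lee_fin sqr_ge0.
- apply/measurable_EFinP/measurable_funX.
  by apply: measurable_funD => //; exact: measurable_funM.
- apply: measurableT_comp => //.
  by apply: (measurable_int _ (integrableD mD (integrableD mD iff ifg') igg')).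
- move=> x _ /=; rewrite lee_fin.
  by rewrite (le_trans _ (ler_norm _))// le_eqVlt; apply/orP; left; apply/eqP; ring.
Qed.

Lemma ip_le f g : measurable_fun D g -> (forall x, D x -> `|g x| <= `|f x|) ->
  l2 f -> l2 g /\ ip g g <= ip f f.
Proof.
move=> mg gf l2f; have [mf _] := l2f; apply: ipP => //.
rewrite ipE//; apply: ge0_le_integral => //.
- by move=> x _; rewrite lee_fin sqr_ge0.
- by apply/measurable_EFinP; exact: measurable_funX.
- by apply/measurable_EFinP; exact: measurable_funX.
- move=> x Dx; rewrite lee_fin -(real_normK (num_real (g x))) -(real_normK (num_real (f x))).
  by rewrite ler_sqr ?nnegrE// gf.
Qed.

Lemma l2Zl f t : l2 f -> l2 (fun x => t * f x).
Proof.
move=> l2f; suff : l2 (fun x => f x + (t - 1) * f x).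
  by congr l2; apply/funext => x; ring.
exact: l2D.
Qed.

Lemma l2B f g : l2 f -> l2 g -> l2 (fun x => f x - g x).
Proof.
move=> l2f l2g; have := l2D (-1) l2f l2g; congr l2; apply/funext => x; ring.
Qed.

(** Young's inequality for [f = g + (f - g)], used to compare norms of nearby
functions. *)
Lemma ip_young f g e : 0 < e -> l2 f -> l2 g ->
  ip f f <= (1 + e) * ip g g + (1 + e^-1) * ip (fun x => f x - g x) (fun x => f x - g x).
Proof.
move=> e0 l2f l2g; have l2h := l2B l2f l2g; set h := (fun x => f x - g x) in l2h *.
have E : ip f f = ip g g + 2 * ip g h + ip h h.
  have := ip_expand 1 l2g l2h; rewrite mulr1 expr1n mul1r => <-.
  by apply: eq_Rintegral => x _; rewrite /h; ring.
have : 0 <= ip (fun x => g x + - e^-1 * h x) (fun x => g x + - e^-1 * h x) by exact: ip_ge0.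
rewrite ip_expand//.
have := ip_ge0 h; set a := ip g g; set b := ip g h; set c := ip h h => c0 H.
suff : 2 * b <= e * a + e^-1 * c by rewrite E -/a -/b -/c; lra.
have : 0 <= e * (a + 2 * - e^-1 * b + (- e^-1) ^+ 2 * c) by rewrite mulr_ge0// ltW.
have -> : e * (a + 2 * - e^-1 * b + (- e^-1) ^+ 2 * c) = e * a - 2 * b + e^-1 * c.
  by field; rewrite gt_eqF.
lra.
Qed.

End square_integrable.

Lemma l2S d (T : measurableType d) (R : realType) (m : {measure set T -> \bar R})
  (D E : set T) (f : T -> R) : measurable D -> measurable E -> E `<=` D ->
  l2 m D f -> l2 m E f /\ ip m E f f <= ip m D f f.
Proof.
move=> mD mE ED l2f; have [mf f2] := l2f.
apply: (ipP mE); first exact: (measurable_funS mD ED mf).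
rewrite ipE//; apply: ge0_subset_integral => //.
- by apply/measurable_EFinP; exact: measurable_funX.
- by move=> x _; rewrite lee_fin sqr_ge0.
Qed.

Section energy.
Context d (T : measurableType d) (R : realType).
Variables (mu : {sigma_finite_measure set T -> \bar R}) (k : T -> T -> R).
Hypothesis mk : measurable_fun setT (fun z : T * T => k z.1 z.2).
Hypothesis k0 : forall x y, 0 <= k x y.
Implicit Types u v : T -> R.

Definition mu2 : {measure set (T * T) -> \bar R} := (mu \x mu)%E.

(** With this difference quotient the energy is a squared [L^2] norm, so that
expansions and inequalities for [ip] apply to it. *)
Definition grad u (z : T * T) : R := (u z.1 - u z.2) * Num.sqrt (k z.1 z.2).

Definition energy u : R := ip mu2 setT (grad u) (grad u).

Lemma measurable_diff u : measurable_fun setT u ->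
  measurable_fun setT (fun z : T * T => u z.1 - u z.2).
Proof. by move=> mu_; apply: measurable_funB; exact: measurableT_comp. Qed.

Lemma measurable_grad u : measurable_fun setT u -> measurable_fun setT (grad u).
Proof.
move=> m_u; apply: measurable_funM; first exact: measurable_diff.
have ms : measurable_fun [set: R] (@Num.sqrt R).
  by apply: continuous_measurable_fun; exact: sqrt_continuous.
exact: (measurableT_comp ms).
Qed.

Lemma sqr_grad u z : grad u z ^+ 2 = (u z.1 - u z.2) ^+ 2 * k z.1 z.2.
Proof. by rewrite exprMn sqr_sqrtr. Qed.

Lemma gradD u v t : grad (fun x => u x + t * v x) = (fun z => grad u z + t * grad v z).
Proof. by apply/funext => z; rewrite /grad; ring. Qed.

Lemma energyE u : measurable_fun setT u ->
  (\int[mu2]_z (grad u z ^+ 2)%:E =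
   \int[mu]_y \int[mu]_x ((u x - u y) ^+ 2 * k x y)%:E)%E.
Proof.
move=> m_u.
have mf : measurable_fun setT (fun z => (grad u z ^+ 2)%:E).
  by apply/measurable_EFinP; apply: measurable_funX; exact: measurable_grad.
have f0 z : (0 <= (grad u z ^+ 2)%:E)%E by rewrite lee_fin sqr_ge0.
rewrite (fubini_tonelli2 _ mf f0).
by apply: eq_integral => y _; apply: eq_integral => x _; rewrite /= sqr_grad.
Qed.

(** The space [H_0^s], where the functions are required to vanish at every point
outside [Om]; a null set never has to be carried along in truncations. *)
Definition adm (Om : set T) u := [/\ measurable_fun setT u, l2 mu setT u,
  l2 mu2 setT (grad u) & forall x, ~ Om x -> u x = 0].

Lemma admD Om u v t : adm Om u -> adm Om v -> adm Om (fun x => u x + t * v x).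
Proof.
move=> [m_u l2u gu u0] [m_v l2v gv v0]; split.
- by apply: measurable_funD => //; exact: measurable_funM.
- exact: l2D.
- by rewrite gradD; exact: l2D.
- by move=> x Omx; rewrite u0// v0// mulr0 addr0.
Qed.

Lemma admZ Om u t : adm Om u -> adm Om (fun x => t * u x).
Proof.
move=> au; have := admD (t - 1) au au; congr adm; apply/funext => x; ring.
Qed.

Lemma admB Om u v : adm Om u -> adm Om v -> adm Om (fun x => u x - v x).
Proof.
move=> au av; have := admD (-1) au av; congr adm; apply/funext => x; ring.
Qed.

Lemma adm_contraction Om u v : adm Om u -> measurable_fun setT v ->
  (forall x, ~ Om x -> v x = 0) -> (forall x, `|v x| <= `|u x|) ->
  (forall x y, `|v x - v y| <= `|u x - u y|) ->
  adm Om v /\ energy v <= energy u.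
Proof.
move=> [m_u l2u gu u0] m_v v0 vu dvu.
have [l2v _] := ip_le measurableT m_v (fun x _ => vu x) l2u.
have [gv Ev] : l2 mu2 setT (grad v) /\ energy v <= energy u.
  apply: ip_le => //; first exact: measurable_grad.
  by move=> z _; rewrite !normrM ler_wpM2r.
by split.
Qed.

Lemma ae_prod (P : T -> Prop) : {ae mu, forall x, P x} ->
  {ae mu2, forall z, P z.1 /\ P z.2}.
Proof.
move=> [A [mA A0 PA]]; exists ((A `*` setT) `|` (setT `*` A)).
have E1 : mu2 (A `*` setT) = 0%E.
  by rewrite /mu2 /= product_measure1E// [X in (X * _)%E]A0 mul0e.
have E2 : mu2 (setT `*` A) = 0%E.
  by rewrite /mu2 /= product_measure1E// [X in (_ * X)%E]A0 mule0.
split.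
- by apply: measurableU; exact: measurableX.
- apply/eqP; rewrite -measure_le0.
  apply: le_trans (measureU2 _ _ _) _; [exact: measurableX|exact: measurableX|].
  by rewrite [X in (X + _)%E]E1 [X in (_ + X)%E]E2 adde0.
- move=> z /= /not_andP[] nP; [left|right]; split => //=; exact: PA.
Qed.

Lemma grad_ae u v : measurable_fun setT u -> measurable_fun setT v ->
  {ae mu, forall x, u x = v x} ->
  (\int[mu2]_z (grad u z ^+ 2)%:E = \int[mu2]_z (grad v z ^+ 2)%:E)%E.
Proof.
move=> m_u m_v /ae_prod uv; apply: ge0_ae_eq_integral => //.
- by apply/measurable_EFinP; apply: measurable_funX; exact: measurable_grad.
- by apply/measurable_EFinP; apply: measurable_funX; exact: measurable_grad.
- by move=> z _; rewrite lee_fin sqr_ge0.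
- by move=> z _; rewrite lee_fin sqr_ge0.
- by apply: filterS uv => z [] e1 e2 _; rewrite /grad e1 e2.
Qed.

Lemma sqr_ae (D : set T) u v : measurable D -> measurable_fun setT u -> measurable_fun setT v ->
  {ae mu, forall x, u x = v x} ->
  (\int[mu]_(x in D) (u x ^+ 2)%:E = \int[mu]_(x in D) (v x ^+ 2)%:E)%E.
Proof.
move=> mD m_u m_v uv; apply: ge0_ae_eq_integral => //.
- by apply/measurable_EFinP; apply: measurable_funX; exact: measurable_funTS.
- by apply/measurable_EFinP; apply: measurable_funX; exact: measurable_funTS.
- by move=> z _; rewrite lee_fin sqr_ge0.
- by move=> z _; rewrite lee_fin sqr_ge0.
- by apply: filterS uv => z e _; rewrite e.
Qed.

End energy.

(** * Averages *)

Section averaging.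
Context d (T : measurableType d) (R : realType).
Variables (mu : {sigma_finite_measure set T -> \bar R}) (k : T -> T -> R).
Hypothesis mk : measurable_fun setT (fun z : T * T => k z.1 z.2).
Hypothesis k0 : forall x y, 0 <= k x y.
Implicit Types (w : T -> R) (S : set T).

Definition mean S w : R := (fine (mu S))^-1 * \int[mu]_(y in S) w y.

Lemma l2_cst S (a : R) : measurable S -> (mu S < +oo)%E -> l2 mu S (cst a).
Proof.
move=> mS Soo; split => //.
under eq_integral do rewrite /=.
by rewrite integral_cst//= lte_mul_pinfty// ?lee_fin ?sqr_ge0.
Qed.

Lemma l2_integrable1 S w : measurable S -> (mu S < +oo)%E -> l2 mu S w ->
  mu.-integrable S (EFin \o w).
Proof.
move=> mS Soo l2w; have := l2_integrable mS l2w (l2_cst 1 mS Soo).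
by congr integrable; apply/funext => x /=; rewrite mulr1.
Qed.

(** The mean is the best constant: the mean square of [a - w] is the sum of the
variance of [w] and of the square of [a - mean S w]. *)
Lemma mean_sqr_le S w (a m : R) : measurable S -> 0 < m ->
  (m%:E <= mu S)%E -> (mu S < +oo)%E -> l2 mu S w ->
  ((m * (a - mean S w) ^+ 2)%:E <= \int[mu]_(y in S) ((a - w y) ^+ 2)%:E)%E.
Proof.
move=> mS m0 mS_ Soo l2w.
have Sfin : mu S \is a fin_num by rewrite ge0_fin_numE.
have mSr : m <= fine (mu S) by rewrite -lee_fin fineK.
have l21 := l2_cst 1 mS Soo.
have l2a := l2_cst a mS Soo.
have l2f : l2 mu S (fun y => a - w y) by exact: l2B.
have mean_f : ip mu S (fun y => a - w y) (cst 1) = fine (mu S) * (a - mean S w).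
  rewrite /ip /mean; under eq_Rintegral do rewrite mulr1.
  rewrite RintegralB//; last 2 first.
  - exact: l2_integrable1.
  - exact: l2_integrable1.
  by rewrite Rintegral_cst// mulrBr mulrA mulfV ?mul1r 1?mulrC// gt_eqF//; lra.
have one : ip mu S (cst 1) (cst 1) = fine (mu S).
  by rewrite /ip; under eq_Rintegral do rewrite mulr1; rewrite Rintegral_cst// mul1r.
rewrite -ipE// lee_fin.
have : 0 <= ip mu S (fun y => (a - w y) + - (a - mean S w) * cst 1 y)
               (fun y => (a - w y) + - (a - mean S w) * cst 1 y) by exact: ip_ge0.
rewrite ip_expand// mean_f one.
set c := a - mean S w; set F := fine (mu S); set J := ip _ _ _ _.
have : m * c ^+ 2 <= F * c ^+ 2 by rewrite ler_wpM2r ?sqr_ge0.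
nra.
Qed.

(** The square of [w x] minus the mean of [w] on the section of [B] at [x] is at most
the mean of [(w x - w y) ^ 2] there, and the kernel dominates [kap] on [B].
For [B] a union of squares of cells this is a Poincare inequality, for [B] a
neighbourhood of the diagonal it compares [w] with its averages on balls. *)
Lemma averaging (B : set (T * T)) (X : set T) (m kap : R) w :
  measurable B -> measurable X -> 0 < m -> 0 <= kap ->
  (forall x, X x -> (m%:E <= mu (xsection B x))%E) ->
  (forall x, X x -> (mu (xsection B x) < +oo)%E) ->
  measurable_fun setT w -> l2 mu setT w ->
  (forall x y, B (x, y) -> kap * (w x - w y) ^+ 2 <= (w x - w y) ^+ 2 * k x y) ->
  measurable_fun X (fun x => mean (xsection B x) w) ->
  ((m * kap)%:E * \int[mu]_(x in X) ((w x - mean (xsection B x) w) ^+ 2)%:E <=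
   \int[mu2 mu]_z (grad k w z ^+ 2)%:E)%E.
Proof.
move=> mB mX m0 kap0 mBx Bxoo m_w l2w Bk mmean.
have mg : measurable_fun setT (fun z => (grad k w z ^+ 2)%:E).
  by apply/measurable_EFinP; apply: measurable_funX; exact: measurable_grad.
have g0 z : (0 <= (grad k w z ^+ 2)%:E)%E by rewrite lee_fin sqr_ge0.
have mF : measurable_fun setT (fun x => \int[mu]_y (grad k w (x, y) ^+ 2)%:E)%E.
  exact: (measurable_fun_fubini_tonelli_F _ mg g0).
have md : measurable_fun X (fun x => ((w x - mean (xsection B x) w) ^+ 2)%:E).
  apply/measurable_EFinP; apply: measurable_funX; apply: measurable_funB => //.
  exact: measurable_funTS.
rewrite /mu2 (fubini_tonelli1 _ mg g0) -ge0_integralZl_EFin//; last 2 first.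
- by move=> x _; rewrite lee_fin sqr_ge0.
- by rewrite mulr_ge0// ltW.
apply: (@le_trans _ _ (\int[mu]_(x in X) \int[mu]_y (grad k w (x, y) ^+ 2)%:E)%E); last first.
  apply: ge0_subset_integral; [exact: mX|exact: measurableT|exact: mF| |by []].
  by move=> x _; apply: integral_ge0 => y _; exact: g0.
apply: ge0_le_integral => //.
- move=> x _; apply: mule_ge0; rewrite lee_fin ?sqr_ge0//.
  by apply: mulr_ge0 => //; exact: ltW.
- by apply: emeasurable_funM => //.
- exact: measurable_funTS.
move=> x Xx.
have mS : measurable (xsection B x) by exact: measurable_xsection.
have l2S' : l2 mu (xsection B x) w by have [] := l2S measurableT mS (@subsetT _ _) l2w.
have mwy : measurable_fun (xsection B x) (fun y => ((w x - w y) ^+ 2)%:E).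
  apply/measurable_EFinP; apply: measurable_funX; apply: measurable_funB => //.
  exact: measurable_funTS.
have mgx : measurable_fun setT (fun y => (grad k w (x, y) ^+ 2)%:E).
  by have := measurableT_comp mg (measurable_pair1 x).
have := mean_sqr_le (w x) mS m0 (mBx x Xx) (Bxoo x Xx) l2S'.
move=> /(lee_wpmul2l (_ : 0 <= kap%:E)%E).
rewrite lee_fin kap0 => /(_ isT).
rewrite -!EFinM mulrA (mulrC kap) => /le_trans; apply.
rewrite -ge0_integralZl_EFin//; last by move=> y _; rewrite lee_fin sqr_ge0.
apply: (@le_trans _ _ (\int[mu]_(y in xsection B x) (grad k w (x, y) ^+ 2)%:E)%E).
  apply: ge0_le_integral => //.
  - by move=> y _; rewrite -EFinM lee_fin mulr_ge0 ?sqr_ge0.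
  - exact: emeasurable_funM.
  - exact: measurable_funTS.
  - by move=> y /set_mem Bxy; rewrite -EFinM lee_fin sqr_grad//; exact: Bk.
exact: ge0_subset_integral.
Qed.

End averaging.

(** * Compactness *)

Section compactness.
Context d (T : measurableType d) (R : realType).
Variables (mu : {sigma_finite_measure set T -> \bar R}) (k : T -> T -> R).
Hypothesis mk : measurable_fun setT (fun z : T * T => k z.1 z.2).
Hypothesis k0 : forall x y, 0 <= k x y.
Variable Om : set T.
Implicit Types (u v w : T -> R).

(** All that is used of a grid of cubes. *)
Record cells (I : finType) (Q : I -> set T) (m kap : R) : Prop := Cells {
  cells_measurable : forall i, measurable (Q i) ;
  cells_disjoint : forall i j x, Q i x -> Q j x -> i = j ;
  cells_measure : forall i, mu (Q i) = m%:E ;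
  cells_gt0 : 0 < m ;
  cells_kernel_ge0 : 0 <= kap ;
  cells_kernel : forall i x y, Q i x -> Q i y -> x <> y -> kap <= k x y ;
  cells_cover : forall x, Om x -> exists i, Q i x }.

Section one_partition.
Context (I : finType) (Q : I -> set T) (m kap : R).
Hypothesis cQ : cells Q m kap.

Let mQ i : measurable (Q i) := cells_measurable cQ i.
Let m0 : 0 < m := cells_gt0 cQ.
Let Qoo i : (mu (Q i) < +oo)%E.
Proof. by rewrite (cells_measure cQ) ltry. Qed.

Let X := \bigcup_i Q i.
Let mX : measurable X.
Proof. by apply: fin_bigcup_measurable => // i _; exact: mQ. Qed.

(** The first term bounds [w] minus its cell means by [averaging], the second one is
the norm of the cell means themselves. *)
Lemma cells_poincare w (dl : R) : adm mu k Om w ->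
  (forall i, `|mean mu (Q i) w| <= dl) ->
  m * kap * ip mu setT w w <= 2 * energy mu k w + m * kap * (2 * dl ^+ 2 * (#|I|%:R * m)).
Proof.
move=> [mw l2w gw w0] mean_le.
pose B := \bigcup_i (Q i `*` Q i).
have mB : measurable B.
  by apply: fin_bigcup_measurable => // i _; apply: measurableX; exact: mQ.
have xB i x : Q i x -> xsection B x = Q i.
  move=> Qx; apply/seteqP; split => y; rewrite /xsection /= inE.
    by move=> [j _ [/= Qjx]]; rewrite (cells_disjoint cQ Qjx Qx).
  by move=> Qy; exists i.
have meanE x : X x -> mean mu (xsection B x) w = \sum_i mean mu (Q i) w * \1_(Q i) x.
  move=> [i _ Qx]; rewrite (xB i)// (bigD1 i)//= indicE mem_set// mulr1 big1 ?addr0//.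
  move=> j ji; rewrite indicE memNset ?mulr0// => Qjx.
  by move: ji; rewrite (cells_disjoint cQ Qjx Qx) eqxx.
have mm : measurable_fun X (fun x => mean mu (xsection B x) w).
  apply: (eq_measurable_fun (fun x => \sum_i mean mu (Q i) w * \1_(Q i) x)).
    by move=> x /set_mem Xx; rewrite meanE.
  by apply: measurable_sum => i; apply: measurable_funM.
have muX : (mu X <= (#|I|%:R * m)%:E)%E.
  rewrite /X -(_ : \big[setU/set0]_(i <- enum I) Q i = \bigcup_i Q i); last first.
    apply/seteqP; split => x.
      by rewrite -bigcup_seq => -[i _ Qx]; exists i.
    by move=> [i _ Qx]; rewrite -bigcup_seq; exists i => //=; rewrite mem_enum.
  have -> : (#|I|%:R * m)%:E = (\sum_(i <- enum I) m%:E)%E.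
    rewrite sumEFin big_const_seq count_predT -cardE iter_addr addr0.
    by rewrite mulr_natl.
  elim: (enum I) => [|i s IH]; first by rewrite !big_nil measure0.
  rewrite !big_cons; apply: le_trans (measureU2 _ _ _) _ => //.
    by apply: bigsetU_measurable => j _; exact: mQ.
  by apply: leeD; [rewrite [X in (X <= _)%E](cells_measure cQ)|].
have Xoo : (mu X < +oo)%E by apply: le_lt_trans muX (ltry _).
have := @averaging _ _ _ mu k mk k0 B X m kap w mB mX m0 (cells_kernel_ge0 cQ).
move=> H; have {H} : ((m * kap)%:E * (\int[mu]_(x in X) ((w x - mean mu (xsection B x) w) ^+ 2)%:E) <= \int[mu2 mu]_z (grad k w z ^+ 2)%:E)%E.
  apply: H => //.
  - by move=> x [i _ Qx]; rewrite (xB i)// (cells_measure cQ).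
  - by move=> x [i _ Qx]; rewrite (xB i)//.
  - move=> x y [i _ [/= Qx Qy]]; have [->|xy] := eqVneq (w x) (w y).
      by rewrite subrr expr0n/= mul0r mulr0.
    rewrite mulrC ler_wpM2l ?sqr_ge0//; apply: (cells_kernel cQ Qx Qy).
    by move=> xy'; move: xy; rewrite xy' eqxx.
have l2wX : l2 mu X w by have [] := l2S measurableT mX (@subsetT _ _) l2w.
have l2m : l2 mu X (fun x => mean mu (xsection B x) w) /\
   ip mu X (fun x => mean mu (xsection B x) w) (fun x => mean mu (xsection B x) w) <= dl ^+ 2 * (#|I|%:R * m).
  apply: ipP => //.
  apply: (@le_trans _ _ (\int[mu]_(x in X) (dl ^+ 2)%:E)%E); last first.
    by rewrite integral_cst// [leRHS]EFinM; apply: lee_wpmul2l; rewrite ?lee_fin ?sqr_ge0.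
  apply: ge0_le_integral => //.
  - by move=> x _; rewrite lee_fin sqr_ge0.
  - by apply/measurable_EFinP; exact: measurable_funX.
  - move=> x [i _ Qx]; rewrite lee_fin (xB i)//.
    have dl0 : 0 <= dl by apply: le_trans (mean_le i).
    by rewrite -(real_normK (num_real (mean _ _ _))) ler_sqr ?nnegrE.
have [l2m1 l2m2] := l2m.
rewrite -!ipE//; last exact: l2B.
rewrite -EFinM lee_fin -/(energy mu k w) => H.
have mk0 : 0 <= m * kap by rewrite mulr_ge0 ?(cells_kernel_ge0 cQ)// ltW.
have -> : ip mu setT w w = ip mu X w w.
  rewrite /ip [RHS]Rintegral_mkcond; apply: eq_Rintegral => x _.
  rewrite patchE; case: ifPn => // /negP Xx; rewrite w0 ?mulr0// => Omx.
  by apply: Xx; apply/mem_set; have [i Qx] := cells_cover cQ Omx; exists i.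
have := ip_young mX (ltr01 : 0 < 1 :> R) l2wX l2m1.
rewrite invr1 (_ : 1 + 1 = 2)// => /(ler_wpM2l mk0) /le_trans; apply.
rewrite mulrDr addrC; apply: lerD.
  by rewrite mulrCA ler_pM2l.
by rewrite ler_wpM2l// -mulrA ler_pM2l.
Qed.

Lemma mean_bounded u i : adm mu k Om u -> ip mu setT u u <= 1 ->
  `|mean mu (Q i) u| <= 1 + m^-1.
Proof.
move=> [mu_ l2u gu u0] u1.
have [l2q iq] := l2S measurableT (mQ i) (@subsetT _ _) l2u.
have l2q' : l2 mu (Q i) (fun y => 0 - u y).
  by have := l2Zl (mQ i) (-1) l2q; congr l2; apply/funext => x; rewrite sub0r mulN1r.
have := mean_sqr_le 0 (mQ i) m0 _ (Qoo i) l2q.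
rewrite (cells_measure cQ) lexx => /(_ isT); rewrite -ipE//.
have -> : ip mu (Q i) (fun y => 0 - u y) (fun y => 0 - u y) = ip mu (Q i) u u.
  by apply: eq_Rintegral => x _; rewrite !sub0r mulrNN.
rewrite lee_fin sub0r sqrrN => H.
have {}H : m * mean mu (Q i) u ^+ 2 <= 1 by apply: le_trans H (le_trans iq u1).
have b0 : 0 <= 1 + m^-1 by rewrite addr_ge0// invr_ge0 ltW.
rewrite -ler_sqr ?nnegrE// real_normK ?num_real//.
have : mean mu (Q i) u ^+ 2 <= m^-1 by rewrite -(ler_pM2l m0) mulfV ?gt_eqF.
move=> /le_trans; apply; have : 0 < m^-1 by rewrite invr_gt0.
set x := m^-1; nra.
Qed.

Lemma meanB u v i : adm mu k Om u -> adm mu k Om v ->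
  mean mu (Q i) (fun x => u x - v x) = mean mu (Q i) u - mean mu (Q i) v.
Proof.
move=> [_ l2u _ _] [_ l2v _ _].
have [l2uq _] := l2S measurableT (mQ i) (@subsetT _ _) l2u.
have [l2vq _] := l2S measurableT (mQ i) (@subsetT _ _) l2v.
rewrite /mean RintegralB ?mulrBr//; exact: l2_integrable1.
Qed.

End one_partition.

Lemma energyB_le u v : adm mu k Om u -> adm mu k Om v ->
  energy mu k (fun x => u x - v x) <= 2 * energy mu k u + 2 * energy mu k v.
Proof.
move=> [_ _ gu _] [_ _ gv _].
have gh : l2 (mu2 mu) setT (fun z => grad k u z - grad k v z) by exact: l2B.
have := ip_young measurableT (ltr01 : 0 < 1 :> R) gh gu.
rewrite invr1 (_ : 1 + 1 = 2)//; congr (_ <= _ + _ * _).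
  by apply: eq_Rintegral => z _; rewrite /grad; ring.
by apply: eq_Rintegral => z _; rewrite /=; ring.
Qed.

(** For cubes of side [h], [m * kap] is of the order of [h ^ (- 2 s)], hence as large
as needed. *)
Definition fine_cells := forall eta : R, 0 < eta ->
  exists (I : finType) (Q : I -> set T) (m kap : R), cells Q m kap /\ 1 <= eta * (m * kap).

(** Total boundedness in [L^2] of sets of bounded energy.  The class of [u] is the
family of its cell means, rounded to multiples of some [dl]; the difference of
two functions of the same class has small cell means. *)
Lemma finite_classes (M e : R) : fine_cells -> 0 <= M -> 0 < e ->
  exists (J : finType) (cls : (T -> R) -> J), forall u v,
    adm mu k Om u -> adm mu k Om v -> ip mu setT u u <= 1 -> ip mu setT v v <= 1 ->
    energy mu k u <= M -> energy mu k v <= M -> cls u = cls v ->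
    ip mu setT (fun x => u x - v x) (fun x => u x - v x) <= e.
Proof.
move=> fc M0 e0.
have [|I [Q [m [kap [cQ etaP]]]]] := fc (e / (16 * (M + 1))).
  by rewrite divr_gt0// mulr_gt0// ltr_wpDl.
have m0 := cells_gt0 cQ.
pose A := #|I|%:R * m.
have A0 : 0 <= A by rewrite mulr_ge0// ltW.
(* With this mesh the cell means contribute at most e / 2 to the squared norm, and eta was chosen to leave e / 2 for the energy. *)
pose dl := Num.min 1 (e / (4 * (A + 1))).
have dl0 : 0 < dl by rewrite lt_min ltr01/= divr_gt0// mulr_gt0// ltr_wpDl.
pose b := 1 + m^-1.
pose idx u i := Num.truncn ((mean mu (Q i) u + b) / dl).
pose K := Num.truncn ((2 * b) / dl).
exists {ffun I -> 'I_K.+1}, (fun u => [ffun i => inord (idx u i)]).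
move=> u v au av u1 v1 Eu Ev /ffunP cuv.
have idx_lt w i : adm mu k Om w -> ip mu setT w w <= 1 -> (idx w i < K.+1)%N.
  move=> aw w1; rewrite ltnS; apply: le_truncn.
  rewrite ler_pM2r ?invr_gt0//.
  by have := mean_bounded cQ i aw w1; rewrite ler_norml -/b => /andP[]; lra.
have close i : `|mean mu (Q i) (fun x => u x - v x)| <= dl.
  rewrite (meanB cQ)//.
  have : idx u i = idx v i.
    have := congr1 val (cuv i); rewrite !ffunE /=.
    by rewrite !inordK// ?idx_lt.
  have pos w : adm mu k Om w -> ip mu setT w w <= 1 -> 0 <= (mean mu (Q i) w + b) / dl.
    move=> aw w1; rewrite divr_ge0 ?(ltW dl0)//.
    by have := mean_bounded cQ i aw w1; rewrite ler_norml -/b => /andP[]; lra.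
  have := truncn_itv (pos u au u1); have := truncn_itv (pos v av v1); rewrite -/(idx u i) -/(idx v i).
  move=> + + idxE; rewrite idxE !ler_pdivlMr// !ltr_pdivrMr// -natr1.
  move=> /andP[v2 v3] /andP[u2 u3]; rewrite ler_norml; apply/andP; split; nra.
have auv := admB au av.
have := cells_poincare cQ auv close; rewrite -/A.
have := energyB_le au av.
set EE := energy _ _ _; set Z := ip _ _ _ _; set q := m * kap => EE4 H.
have q0 : 0 < q.
  rewrite ltNge; apply/negP => q0; move: etaP; apply/negP; rewrite -ltNge -/q.
  apply: (@le_lt_trans _ _ 0); last by []. 
  by rewrite mulr_ge0_le0// divr_ge0 ?ltW// mulr_gt0// ltr_wpDl.
have d2 : dl ^+ 2 * (2 * A) <= e / 2.
  have d1 : dl <= 1 by rewrite ge_min lexx.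
  have d3 : dl * (4 * (A + 1)) <= e.
    by rewrite -ler_pdivlMr ?ge_min ?lexx ?orbT// mulr_gt0// ltr_wpDl.
  have : dl ^+ 2 <= dl by rewrite expr2 ler_piMl// ltW.
  nra.
have M1 : 0 < M + 1 by rewrite ltr_wpDl.
have q1 : 16 * (M + 1) <= e * q.
  by move: etaP; rewrite -/q mulrAC ler_pdivlMr ?mulr_gt0// mul1r.
rewrite -(ler_pM2l q0).
apply: le_trans H _.
have : 2 * EE <= 8 * M by move: Eu Ev EE4; lra.
have : q * (2 * dl ^+ 2 * A) <= q * (e / 2).
  by rewrite ler_pM2l// (le_trans _ d2)// le_eqVlt; apply/orP; left; apply/eqP; ring.
by move: q1; lra.
Qed.

End compactness.

(** * Existence of minimizers *)

Section limits_of_integrals.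
Context d (T : measurableType d) (R : realType) (m : {measure set T -> \bar R}).

Lemma fatou_le (f : nat -> T -> R) (g : T -> R) (M : R) :
  (forall n, measurable_fun setT (f n)) -> (forall n x, 0 <= f n x) ->
  (forall x, f ^~ x @ \oo --> g x) ->
  (forall n, (\int[m]_x (f n x)%:E <= M%:E)%E) ->
  (\int[m]_x (g x)%:E <= M%:E)%E.
Proof.
move=> mf f0 fg fM.
have -> : (\int[m]_x (g x)%:E = \int[m]_x limn_einf (fun n => (f n x)%:E))%E.
  apply: eq_integral => x _.
  have c : (fun n => (f n x)%:E) @ \oo --> (g x)%:E by apply: cvg_EFin; [exact: nearW|exact: fg].
  rewrite is_cvg_limn_einfE; first by apply/esym/cvg_lim.
  by apply/cvg_ex; exists (g x)%:E.
apply: le_trans (@fatou _ _ _ m setT measurableT (fun n x => (f n x)%:E) _ _) _.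
- by move=> n; apply/measurable_EFinP.
- by move=> n x _; rewrite lee_fin.
rewrite limn_einf_lim; apply: lime_le; first exact: is_cvg_einfs.
apply: nearW => n; apply: le_trans (fM n); apply: ereal_inf_lbound.
by exists n => //=.
Qed.

(** The integrals have a finite sum, so the sum of the functions is integrable. *)
Lemma ae_summable (f : nat -> T -> R) (c q : R) :
  (forall n, measurable_fun setT (f n)) -> (forall n x, 0 <= f n x) ->
  0 <= c -> 0 <= q < 1 ->
  (forall n, (\int[m]_x (f n x)%:E <= (c * q ^+ n)%:E)%E) ->
  {ae m, forall x, (\sum_(n <oo) (f n x)%:E < +oo)%E}.
Proof.
move=> mf f0 c0 q01 fc.
have mS : measurable_fun setT (fun x => \sum_(n <oo) (f n x)%:E)%E.
  apply: ge0_emeasurable_sum; first by move=> n x _ _; rewrite lee_fin.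
  by move=> n _; apply/measurable_EFinP.
have : m.-integrable setT (fun x => \sum_(n <oo) (f n x)%:E)%E.
  apply/integrableP; split => //.
  rewrite (eq_integral (fun x => \sum_(n <oo) (f n x)%:E)%E); last first.
    by move=> x _; rewrite gee0_abs// nneseries_ge0// => n _ _; rewrite lee_fin.
  rewrite integral_nneseries//; last 2 first.
  - by move=> n; apply/measurable_EFinP.
  - by move=> n x _; rewrite lee_fin.
  apply: le_lt_trans (ltry (c / (1 - q))); apply: le_trans (geometric_eseries_le c0 q01).
  apply: lee_nneseries => [n _ _|n _]; last exact: fc.
  by apply: integral_ge0 => x _; rewrite lee_fin.
move=> /(integrable_ae measurableT); apply: filterS => x /(_ I).
by rewrite ge0_fin_numE// nneseries_ge0// => n _ _; rewrite lee_fin.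
Qed.

End limits_of_integrals.

Lemma summable_cvg (R : realType) (u : nat -> R) :
  (\sum_(n <oo) (`|u n.+1 - u n|)%:E < +oo)%E -> cvgn u.
Proof.
move=> Soo.
have S0 n : (0 <= (`|u n.+1 - u n|)%:E)%E by rewrite lee_fin.
have Sfin : (\sum_(n <oo) (`|u n.+1 - u n|)%:E)%E \is a fin_num.
  by rewrite ge0_fin_numE// nneseries_ge0.
have : cvgn (series (fun n => u n.+1 - u n)).
  apply: normed_cvg; apply: nondecreasing_is_cvgn.
    by apply: nondecreasing_series => *; exact: normr_ge0.
  exists (fine (\sum_(n <oo) (`|u n.+1 - u n|)%:E)%E) => _ [n _ <-].
  rewrite -lee_fin fineK// /series /= -sumEFin.
  exact: nneseries_lim_ge.
have -> : series (fun n => u n.+1 - u n) = (fun n => u n - u 0%N).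
  by apply/funext => n; rewrite /series /= telescope_sumr.
move=> /cvg_ex[l ul]; apply/cvg_ex; exists (l + u 0%N).
have : (fun n => (u n - u 0%N) + u 0%N) @ \oo --> l + u 0%N.
  by apply: (cvgD ul); exact: cvg_cst.
by under eq_fun do rewrite subrK.
Qed.

Lemma geometric_vanish (R : realType) (q : R) (a b C : R) : 0 <= q < 1 -> 0 <= C ->
  (forall n, a <= b + C * q ^+ n) -> a <= b.
Proof.
move=> /andP[q0 q1] C0 H.
have : (fun n => b + C * q ^+ n) @ \oo --> b + C * 0.
  apply: cvgD; first exact: cvg_cst.
  apply: cvgM; first exact: cvg_cst.
  by apply: cvg_expr; rewrite ger0_norm.
rewrite mulr0 addr0 => cb; rewrite -(cvg_lim _ cb)//.
by apply: limr_ge; [apply/cvg_ex; exists b|exact: nearW].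
Qed.

Section existence.
Context d (T : measurableType d) (R : realType).
Variables (mu : {sigma_finite_measure set T -> \bar R}) (k : T -> T -> R).
Hypothesis mk : measurable_fun setT (fun z : T * T => k z.1 z.2).
Hypothesis k0 : forall x y, 0 <= k x y.
Variables (Om A : set T) (c alpha : R).
Hypothesis mOm : measurable Om.
Hypothesis Omoo : (mu Om < +oo)%E.
Hypothesis mA : measurable A.
Hypothesis c0 : 0 < c.
Hypothesis alpha0 : 0 <= alpha.
Hypothesis fc : fine_cells mu k Om.
Hypothesis nontrivial : exists psi, adm mu k Om psi /\ 0 < ip mu setT psi psi.
Implicit Types (u v w : T -> R).

Definition Qform u : R := c * energy mu k u + alpha * ip mu A u u.

Lemma Qform_ge0 u : 0 <= Qform u.
Proof. by rewrite addr_ge0// mulr_ge0 ?ip_ge0// ltW. Qed.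

Let unit_adm := [set u | adm mu k Om u /\ ip mu setT u u = 1].
Let lam := inf [set Qform u | u in unit_adm].

Let unit_exists : unit_adm !=set0.
Proof.
have [psi [apsi psi0]] := nontrivial.
pose t := (Num.sqrt (ip mu setT psi psi))^-1.
exists (fun x => t * psi x); split; first exact: admZ.
have [_ l2psi _ _] := apsi.
have -> : ip mu setT (fun x => t * psi x) (fun x => t * psi x) = t ^+ 2 * ip mu setT psi psi.
  rewrite /ip -RintegralZl//; last exact: l2_integrable.
  by apply: eq_Rintegral => x _; ring.
by rewrite /t exprVn sqr_sqrtr ?mulVf ?gt_eqF// ltW.
Qed.

Let has_inf_Q : has_inf [set Qform u | u in unit_adm].
Proof.
split; first by have [u uu] := unit_exists; exists (Qform u), u.
by exists 0 => _ [u _ <-]; exact: Qform_ge0.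
Qed.

Let lam_le u : unit_adm u -> lam <= Qform u.
Proof. by move=> uu; apply: ge_inf; [case: has_inf_Q|exists u]. Qed.

Let lam0 : 0 <= lam.
Proof.
by apply: lb_le_inf; [case: has_inf_Q|move=> _ [u _ <-]; exact: Qform_ge0].
Qed.

Let S n := [set u | unit_adm u /\ Qform u < lam + 4^-1 ^+ n].

Let S_ge n p : (n <= p)%N -> S p `<=` S n.
Proof.
move=> np u [uu Qu]; split => //; apply: lt_le_trans Qu _; rewrite lerD2l.
by rewrite ler_wiXn2l// invf_le1// ler1n.
Qed.

(** An ultrafilter containing all the sets [S n] contains exactly one of the finitely
many classes at each scale.  Finitely many sets of an ultrafilter always meet,
which replaces the extraction of a diagonal subsequence. *)
Lemma minimizing_classes : exists C : nat -> set (T -> R),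
  (forall n u v, C n u -> C n v -> S 0 u -> S 0 v ->
     ip mu setT (fun x => u x - v x) (fun x => u x - v x) <= 16^-1 ^+ n) /\
  (forall n, exists u, S n u /\ forall p, (p <= n)%N -> C p u).
Proof.
pose F := filter_from [set: nat] S.
have FF : ProperFilter F.
  apply: filter_from_proper; last first.
    move=> n _; have [|_ [u uu <-] ult] := @inf_adherent _ _ (4^-1 ^+ n) _ has_inf_Q.
      by rewrite exprn_gt0.
    by exists u.
  apply: filter_fromT_filter; first by exists 0%N.
  by move=> i j; exists (maxn i j) => u Su; split; apply: S_ge Su; rewrite ?leq_maxl ?leq_maxr.
have [G [UG FG]] := ultraFilterLemma FF.
have GS n : G (S n) by apply: FG; exists n.
have ex n : exists C : set (T -> R), G C /\ forall u v, C u -> C v -> S 0 u -> S 0 v ->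
     ip mu setT (fun x => u x - v x) (fun x => u x - v x) <= 16^-1 ^+ n.
  have [||J [cls clsP]] := @finite_classes _ _ _ mu k mk k0 Om ((lam + 1) / c) (16^-1 ^+ n) fc.
  - by rewrite divr_ge0 ?addr_ge0// ltW.
  - by rewrite exprn_gt0.
  have [j Gj] : exists j, G [set u | cls u = j].
    apply: contrapT => nG.
    have nGj j : G (~` [set u | cls u = j]).
      have [Gj|//] := in_ultra_setVsetC [set u | cls u = j] UG.
      by exfalso; apply: nG; exists j.
    have GF : ProperFilter G by case: UG.
    have H : \forall u \near G, forall j, (~` [set u | cls u = j]) u by exact: filter_forall.
    by have [u /(_ (cls u))] := filter_ex H; exact.
  exists [set u | cls u = j]; split => // u v /= cu cv [[au u1] Qu] [[av v1] Qv].
  have Ebound w : Qform w < lam + 4^-1 ^+ 0 -> energy mu k w <= (lam + 1) / c.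
    rewrite expr0 ler_pdivlMr// mulrC => /ltW; apply: le_trans.
    by rewrite lerDl mulr_ge0// ip_ge0.
  by apply: clsP; rewrite ?u1 ?v1 ?cu ?cv//; exact: Ebound.
have [C CP] := choice ex.
exists C; split; first by move=> n; have [] := CP n.
move=> n.
have GF : ProperFilter G by case: UG.
have GC : \forall u \near G, forall i : 'I_n.+1, C i u.
  by apply: filter_forall => i; have [] := CP i.
have [u [Su Cu]] := filter_ex (filterI (GS n) GC); exists u; split => // p pn.
exact: (Cu (Ordinal (pn : (p < n.+1)%N))).
Qed.

Lemma adm_ae u v : adm mu k Om u -> measurable_fun setT v ->
  (forall x, ~ Om x -> v x = 0) -> {ae mu, forall x, u x = v x} ->
  [/\ adm mu k Om v, energy mu k v = energy mu k u &
    forall D, measurable D -> ip mu D v v = ip mu D u u].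
Proof.
move=> [m_u l2u gu u0] m_v v0 uv.
have l2v : l2 mu setT v.
  by split => //; rewrite -(sqr_ae measurableT m_u m_v uv); case: l2u.
have gv : l2 (mu2 mu) setT (grad k v).
  split; first exact: measurable_grad.
  by rewrite -(grad_ae mk m_u m_v uv); case: gu.
split => //.
  by apply: EFin_inj; rewrite /energy !ipE// (grad_ae mk m_u m_v uv).
move=> D mD; apply: EFin_inj; rewrite !ipE//.
- by rewrite (sqr_ae mD m_u m_v uv).
- by have [] := l2S measurableT mD (@subsetT _ _) l2u.
- by have [] := l2S measurableT mD (@subsetT _ _) l2v.
Qed.

(** Successive terms are at distance at most [4 ^ - n] in [L^2], so that the sequence
converges almost everywhere.  It converges everywhere once its terms are set
to 0 on the null set where the sum of the successive differences is infinite. *)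
Lemma minimizing_sequence : exists v_ : nat -> T -> R,
  [/\ forall n, S n (v_ n),
     forall p n, (p <= n)%N -> ip mu setT (fun x => v_ p x - v_ n x) (fun x => v_ p x - v_ n x) <= 16^-1 ^+ p &
     forall x, cvgn (v_ ^~ x)].
Proof.
have [C [C1 /choice[u_ uP]]] := minimizing_classes.
have close p n : (p <= n)%N ->
    ip mu setT (fun x => u_ p x - u_ n x) (fun x => u_ p x - u_ n x) <= 16^-1 ^+ p.
  move=> pn; apply: C1.
  - by have [_] := uP p; apply.
  - by have [_] := uP n; apply.
  - by have [+ _] := uP p; exact: S_ge.
  - by have [+ _] := uP n; exact: S_ge.
have au n : adm mu k Om (u_ n) by have [[[]]] := uP n.
have m_u n : measurable_fun setT (u_ n) by have [] := au n.
pose f n x := `|u_ n.+1 x - u_ n x|.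
have mf n : measurable_fun setT (f n).
  by apply: measurableT_comp => //; exact: measurable_funB.
have Omfin : mu Om \is a fin_num by rewrite ge0_fin_numE.
(* On Om, f n is at most 4 ^- n + 4 ^ n * f n ^ 2, and the integral of f n ^ 2 is at most 16 ^- n. *)
have fle n : (\int[mu]_x (f n x)%:E <= ((fine (mu Om) + 1) * 4^-1 ^+ n)%:E)%E.
  have ad := admB (au n) (au n.+1).
  have [md l2d _ d0] := ad.
  have mi : measurable_fun setT (fun x => 4^-1 ^+ n * (\1_Om x : R)).
    by apply: measurable_funM => //; exact: measurable_indic.
  have md2 : measurable_fun setT (fun x => 4 ^+ n * (u_ n x - u_ n.+1 x) ^+ 2).
    by apply: measurable_funM => //; exact: measurable_funX.
  apply: (@le_trans _ _ (\int[mu]_x ((4^-1 ^+ n * (\1_Om x : R))%:E + (4 ^+ n * (u_ n x - u_ n.+1 x) ^+ 2)%:E))%E).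
    apply: ge0_le_integral => //.
    - by move=> x _; rewrite lee_fin /f.
    - exact/measurable_EFinP.
    - by apply: emeasurable_funD; apply/measurable_EFinP.
    - move=> x _; rewrite -EFinD lee_fin /f distrC.
      have [Omx|Omx] := pselect (Om x); last first.
        by rewrite d0// normr0 expr0n/= mulr0 addr0 mulr_ge0// exprn_ge0.
      rewrite indicE mem_set// mulr1 -[in leRHS](real_normK (num_real (_ - _))).
      rewrite exprVn; set b := 4 ^+ n; set a := `|_|.
      have b0 : 0 < b :> R by rewrite exprn_gt0.
      have a0 : 0 <= a by rewrite normr_ge0.
      rewrite -(ler_pM2l b0) mulrDr mulfV ?gt_eqF//.
      have := sqr_ge0 (b * a); have := sqr_ge0 (b * a - 1); lra.
  rewrite ge0_integralD//;
    try (by move=> x _; rewrite lee_fin mulr_ge0 ?sqr_ge0 ?exprn_ge0);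
    try exact/measurable_EFinP.
  under eq_integral do rewrite EFinM.
  rewrite ge0_integralZl_EFin ?exprn_ge0//;
    try (by move=> x _; rewrite lee_fin);
    try (by apply/measurable_EFinP; exact: measurable_indic).
  rewrite integral_indic// setIT.
  under [X in (_ + X)%E]eq_integral do rewrite EFinM.
  rewrite ge0_integralZl_EFin ?exprn_ge0//;
    try (by move=> x _; rewrite lee_fin sqr_ge0);
    try (by apply/measurable_EFinP; exact: measurable_funX).
  rewrite -ipE//.
  have OmE : mu Om = (fine (mu Om))%:E by rewrite fineK.
  rewrite [X in ((_ * X) + _)%E]OmE.
  rewrite -!EFinM -EFinD lee_fin mulrDl mul1r mulrC lerD2l.
  have := close n n.+1 (leqnSn n).
  rewrite -(ler_pM2l (_ : 0 < 4 ^+ n)) ?exprn_gt0// => /le_trans; apply.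
  by rewrite le_eqVlt -exprMn (_ : 4 * 16^-1 = 4^-1) ?eqxx//; field.
have Omr0 : 0 <= fine (mu Om) + 1 by rewrite addr_ge0// fine_ge0.
have f0 n x : 0 <= f n x by rewrite /f.
have := ae_summable mf f0 Omr0 (_ : 0 <= 4^-1 < 1) fle.
rewrite invr_ge0 ler0n invf_lt1// ltr1n => /(_ isT) ae_sum.
pose Cs := [set x | (\sum_(n <oo) (f n x)%:E < +oo)%E].
have mCs : measurable Cs.
  have mS : measurable_fun setT (fun x => \sum_(n <oo) (f n x)%:E)%E.
    apply: ge0_emeasurable_sum; first by move=> n x _ _; rewrite lee_fin.
    by move=> n _; apply/measurable_EFinP.
  by have := emeasurable_fun_infty_o measurableT mS +oo%E; rewrite setTI.
pose v_ n x := u_ n x * \1_Cs x.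
have m_v n : measurable_fun setT (v_ n).
  by apply: measurable_funM => //; exact: measurable_indic.
have uv n : {ae mu, forall x, u_ n x = v_ n x}.
  by apply: filterS ae_sum => x Cx; rewrite /v_ indicE mem_set// mulr1.
have v0 n x : ~ Om x -> v_ n x = 0.
  by move=> Omx; rewrite /v_; have [_ _ _ ->//] := au n; rewrite mul0r.
exists v_; split.
- move=> n; have [av Ev iv] := adm_ae (au n) (m_v n) (@v0 n) (uv n).
  have [[[_ u1] Qu] _] := uP n.
  by split; [split => //; rewrite iv|rewrite /Qform Ev iv].
- move=> p n pn.
  have md : measurable_fun setT (fun x => v_ p x - v_ n x) by exact: measurable_funB.
  have d0 x : ~ Om x -> v_ p x - v_ n x = 0 by move=> Omx; rewrite !v0// subr0.
  have dae : {ae mu, forall x, u_ p x - u_ n x = v_ p x - v_ n x}.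
    by apply: filterS2 (uv p) (uv n) => x -> ->.
  have [_ _ ->//] := adm_ae (admB (au p) (au n)) md d0 dae.
  exact: close.
- move=> x; have [Cx|Cx] := pselect (Cs x).
    suff : cvgn (u_ ^~ x) by congr (cvgn _); apply/funext => n; rewrite /v_ indicE mem_set// mulr1.
    exact: summable_cvg.
  rewrite (_ : v_ ^~ x = cst 0); first exact: is_cvg_cst.
  by apply/funext => n; rewrite /v_ indicE memNset// mulr0.
Qed.

(** The direct method: norms pass to the limit by [L^2] convergence, and the energy
is lower semicontinuous by Fatou's lemma.  Both sides of the conclusion are
homogeneous of degree 2 in [psi], which reduces it to functions of norm 1. *)
Theorem minimizer_exists : exists u, [/\ adm mu k Om u, ip mu setT u u = 1 &
  forall psi, adm mu k Om psi -> Qform u * ip mu setT psi psi <= Qform psi].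
Proof.
have [v_ [vS vclose vcvg]] := minimizing_sequence.
have av n : adm mu k Om (v_ n) by have [[]] := vS n.
have m_v n : measurable_fun setT (v_ n) by have [] := av n.
have v1 n : ip mu setT (v_ n) (v_ n) = 1 by have [[]] := vS n.
pose u x := lim (v_ ^~ x @ \oo).
have uv x : v_ ^~ x @ \oo --> u x by exact: vcvg.
have m_u : measurable_fun setT u.
  by apply: (measurable_fun_cvg m_v) => x _; exact: uv.
have u0 x : ~ Om x -> u x = 0.
  move=> Omx; rewrite /u (_ : v_ ^~ x = cst 0) ?lim_cst//.
  by apply/funext => n; have [_ _ _ ->] := av n.
have shift n x : (fun p => v_ (p + n)%N x) @ \oo --> u x.
  by rewrite (cvg_shiftn n (v_ ^~ x)); exact: uv.
have udiff n : (\int[mu]_x ((v_ n x - u x) ^+ 2)%:E <= (16^-1 ^+ n)%:E)%E.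
  apply: (@fatou_le _ _ _ _ (fun p x => (v_ n x - v_ (p + n)%N x) ^+ 2)).
  - by move=> p; apply: measurable_funX; exact: measurable_funB.
  - by move=> p x; rewrite sqr_ge0.
  - move=> x; under eq_fun do rewrite expr2; rewrite expr2.
    by apply: cvgM; apply: cvgB; [exact: cvg_cst|exact: shift|exact: cvg_cst|exact: shift].
  - move=> p; have [_ l2d _ _] := admB (av n) (av (p + n)%N).
    by rewrite -ipE// lee_fin vclose// leq_addl.
have l2d : l2 mu setT (fun x => v_ 0 x - u x).
  by have [] := ipP measurableT (measurable_funB (m_v 0%N) m_u) (udiff 0%N).
have l2u : l2 mu setT u.
  have [_ l2v _ _] := av 0%N.
  by have := l2B measurableT l2v l2d; congr l2; apply/funext => x; ring.
have udiff' n (D : set T) : measurable D -> ip mu D (fun x => v_ n x - u x) (fun x => v_ n x - u x) <= 16^-1 ^+ n.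
  move=> mD; have [l2n ipn] := ipP measurableT (measurable_funB (m_v n) m_u) (udiff n).
  by have [_ /le_trans] := l2S measurableT mD (@subsetT _ _) l2n; apply.
have q4 n : 0 < 4^-1 ^+ n :> R by rewrite exprn_gt0.
have young n : (1 + (4^-1 ^+ n)^-1) * 16^-1 ^+ n <= 2 * 4^-1 ^+ n :> R.
  have -> : (16^-1 : R) = 4^-1 * 4^-1 by field.
  rewrite exprMn mulrDl mul1r mulrA mulVf ?gt_eqF// mul1r.
  have : (4^-1 : R) ^+ n <= 1 by rewrite exprn_ile1 ?invr_ge0// invf_le1// ler1n.
  have := q4 n; set q := 4^-1 ^+ n; nra.
have l2vD n (D : set T) : measurable D -> l2 mu D (v_ n) /\ ip mu D (v_ n) (v_ n) <= 1.
  by move=> mD; have [_ l2v _ _] := av n; have := l2S measurableT mD (@subsetT _ _) l2v; rewrite v1.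
have l2uD (D : set T) : measurable D -> l2 mu D u /\ ip mu D u u <= ip mu setT u u.
  by move=> mD; exact: l2S.
have upper n (D : set T) : measurable D -> ip mu D u u <= ip mu D (v_ n) (v_ n) + 3 * 4^-1 ^+ n.
  move=> mD; have [l2v vle] := l2vD n D mD; have [l2u' _] := l2uD D mD.
  have := ip_young mD (q4 n) l2u' l2v => /le_trans; apply.
  have -> : ip mu D (fun x => u x - v_ n x) (fun x => u x - v_ n x) =
            ip mu D (fun x => v_ n x - u x) (fun x => v_ n x - u x).
    by apply: eq_Rintegral => x _; ring.
  have := udiff' n D mD => /(ler_wpM2l (_ : 0 <= 1 + (4^-1 ^+ n)^-1)).
  move=> /(_ _)/le_trans/(_ (young n)) H.
  have {}H := H (addr_ge0 ler01 (_ : 0 <= _)).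
  have := H; rewrite invr_ge0 ltW// => /(_ isT).
  have := q4 n; have : 4^-1 ^+ n * ip mu D (v_ n) (v_ n) <= 4^-1 ^+ n.
    by rewrite ler_piMr// ltW.
  set q := 4^-1 ^+ n; set a := ip _ _ (v_ n) _; set b := ((1 + q^-1) * ip _ _ _ _); lra.
have lower n : 1 <= ip mu setT u u + 4^-1 ^+ n * ip mu setT u u + 2 * 4^-1 ^+ n.
  have [l2v _] := l2vD n setT measurableT.
  have := ip_young measurableT (q4 n) l2v l2u; rewrite v1.
  have := udiff' n setT measurableT => /(ler_wpM2l (_ : 0 <= 1 + (4^-1 ^+ n)^-1)).
  move=> H; have := H (addr_ge0 ler01 _).
  rewrite invr_ge0 ltW// => /(_ isT) /le_trans/(_ (young n)).
  set q := 4^-1 ^+ n; set a := ip _ _ u u; set b := ((1 + q^-1) * ip _ _ _ _); lra.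
have q01 : 0 <= (4^-1 : R) < 1 by rewrite invr_ge0 ler0n invf_lt1// ltr1n.
have u1 : ip mu setT u u = 1.
  apply/le_anti/andP; split.
    by apply: (geometric_vanish q01 (_ : 0 <= 3)) => // n; have := upper n setT measurableT; rewrite v1.
  apply: (geometric_vanish q01 (_ : 0 <= ip mu setT u u + 2)) => [|n].
    by rewrite addr_ge0// ip_ge0.
  by have := lower n; lra.
have Eu n : (\int[mu2 mu]_z (grad k u z ^+ 2)%:E <=
    ((lam - alpha * ip mu A u u + (1 + 3 * alpha) * 4^-1 ^+ n) / c)%:E)%E.
  apply: (@fatou_le _ _ _ _ (fun p z => grad k (v_ (p + n)%N) z ^+ 2)).
  - by move=> p; apply: measurable_funX; exact: measurable_grad.
  - by move=> p x; rewrite sqr_ge0.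
  - move=> z; under eq_fun do rewrite expr2; rewrite expr2.
    have cz : (fun p => grad k (v_ (p + n)%N) z) @ \oo --> grad k u z.
      apply: cvgM; last exact: cvg_cst.
      by apply: cvgB; exact: shift.
    by apply: cvgM; exact: cz.
  - move=> p; have [_ _ gv _] := av (p + n)%N.
    rewrite -ipE// lee_fin ler_pdivlMr// mulrC.
    have [_ Qv] := vS (p + n)%N.
    have up := ler_wpM2l alpha0 (upper (p + n)%N A mA).
    move: Qv up; rewrite /Qform /energy.
    have qq : (4^-1 : R) ^+ (p + n) <= 4^-1 ^+ n by rewrite ler_wiXn2l ?leq_addl// invf_le1// ler1n.
    have := ler_wpM2l alpha0 qq; have := q4 (p + n)%N; move: qq.
    move: (4^-1 ^+ (p + n)) (4^-1 ^+ n) (ip mu A u u) (ip mu A (v_ (p + n)%N) _) (ip _ _ _ _) => q q' a b e.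
    lra.
have [gu _] := ipP measurableT (measurable_grad mk m_u) (Eu 0%N).
have au : adm mu k Om u by [].
have Qu : Qform u <= lam.
  suff : c * energy mu k u <= lam - alpha * ip mu A u u by rewrite /Qform; lra.
  apply: (geometric_vanish q01 (_ : 0 <= 1 + 3 * alpha)) => [|n].
    by rewrite addr_ge0// mulr_ge0.
  by have := Eu n; rewrite -ipE// lee_fin ler_pdivlMr// mulrC.
exists u; split => // psi apsi.
have := ip_ge0 mu setT psi; rewrite le_eqVlt => /orP[/eqP <-|psi0].
  by rewrite mulr0 Qform_ge0.
have [_ l2psi _ _] := apsi.
pose t := (Num.sqrt (ip mu setT psi psi))^-1.
have t2 : t ^+ 2 = (ip mu setT psi psi)^-1 by rewrite /t exprVn sqr_sqrtr// ltW.
have scale d' (U : measurableType d') (m : {measure set U -> \bar R}) (D : set U) (h : U -> R) :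
    measurable D -> l2 m D h -> ip m D (fun x => t * h x) (fun x => t * h x) = t ^+ 2 * ip m D h h.
  move=> mD l2h; rewrite /ip -RintegralZl//; last exact: l2_integrable.
  by apply: eq_Rintegral => x _; ring.
have ut : unit_adm (fun x => t * psi x).
  split; first exact: admZ.
  by rewrite scale// t2 mulVf// gt_eqF.
have := le_trans Qu (lam_le ut).
have -> : Qform (fun x => t * psi x) = t ^+ 2 * Qform psi.
  rewrite /Qform /energy scale//; last by have [] := l2S measurableT mA (@subsetT _ _) l2psi.
  have -> : grad k (fun x => t * psi x) = (fun z => t * grad k psi z).
    by apply/funext => z; rewrite /grad; ring.
  by have [_ _ gpsi _] := apsi; rewrite scale//; ring.
by rewrite t2 mulrC ler_pdivlMr.
Qed.

End existence.

(** * Almost everywhere convergence of averages *)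

Lemma summable_cvg0 (R : realType) (f : nat -> R) : (forall n, 0 <= f n) ->
  (\sum_(n <oo) (f n)%:E < +oo)%E -> f @ \oo --> 0.
Proof.
move=> f0 Soo.
have Sfin : (\sum_(n <oo) (f n)%:E)%E \is a fin_num.
  by rewrite ge0_fin_numE// nneseries_ge0// => n _ _; rewrite lee_fin.
apply: cvg_series_cvg_0; apply: nondecreasing_is_cvgn.
  by apply: nondecreasing_series => *; exact: f0.
exists (fine (\sum_(n <oo) (f n)%:E)%E) => _ [n _ <-].
rewrite -lee_fin fineK// /series /= -sumEFin.
by apply: nneseries_lim_ge => i _ _; rewrite lee_fin.
Qed.

Section differentiation.
Context d (T : measurableType d) (R : realType).
Variables (mu : {sigma_finite_measure set T -> \bar R}) (k : T -> T -> R).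
Hypothesis mk : measurable_fun setT (fun z : T * T => k z.1 z.2).
Hypothesis k0 : forall x y, 0 <= k x y.
Variable u : T -> R.
Hypothesis m_u : measurable_fun setT u.
Hypothesis u0 : forall x, 0 <= u x.
Hypothesis l2u : l2 mu setT u.
Hypothesis gu : l2 (mu2 mu) setT (grad k u).

Lemma measurable_mean (B : set (T * T)) : measurable B ->
  measurable_fun setT (fun x => mean mu (xsection B x) u).
Proof.
move=> mB; apply: measurable_funM.
  have -> : (fun x => (fine (mu (xsection B x)))^-1) = (fun x => (fine (mu (xsection B x))) `^ (-1)).
    by apply/funext => x; rewrite powR_inv1// fine_ge0.
  apply: (measurableT_comp (measurable_powR _)); apply: measurableT_comp => //.
  exact: measurable_fun_xsection.
have mf : measurable_fun setT (fun z : T * T => (u z.2 * \1_B z)%:E).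
  apply/measurable_EFinP; apply: measurable_funM; first exact: measurableT_comp.
  exact: measurable_indic.
have f0 z : (0 <= (u z.2 * \1_B z)%:E)%E by rewrite lee_fin mulr_ge0.
have := measurable_fun_fubini_tonelli_F (m2 := mu) _ mf f0.
have mfine : measurable_fun [set: \bar R] fine by [].
move=> /(measurableT_comp mfine).
congr measurable_fun; apply/funext => x; rewrite /= /fubini_F /Rintegral; congr fine.
rewrite [RHS]integral_mkcond; apply: eq_integral => y _.
by rewrite patchE mem_xsection indicE; case: ifP; rewrite ?mulr1 ?mulr0.
Qed.

Variables (B : nat -> set (T * T)) (m kap : nat -> R) (C q : R).
Hypothesis mB : forall n, measurable (B n).
Hypothesis m0 : forall n, 0 < m n.
Hypothesis kap0 : forall n, 0 < kap n.
Hypothesis mBx : forall n x, ((m n)%:E <= mu (xsection (B n) x))%E.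
Hypothesis Bxoo : forall n x, (mu (xsection (B n) x) < +oo)%E.
Hypothesis Bk : forall n x y, B n (x, y) -> x <> y -> kap n <= k x y.
Hypothesis C0 : 0 <= C.
Hypothesis q01 : 0 <= q < 1.
Hypothesis mkC : forall n, (m n * kap n)^-1 <= C * q ^+ n.

(** By [averaging], the squared distance in [L^2] from [u] to its means over [B n]
decays geometrically, so it is summable almost everywhere. *)
Lemma means_cvg_ae :
  {ae mu, forall x, mean mu (xsection (B n) x) u @[n --> \oo] --> u x}.
Proof.
pose f n x := (u x - mean mu (xsection (B n) x) u) ^+ 2.
have mf n : measurable_fun setT (f n).
  by apply: measurable_funX; apply: measurable_funB => //; exact: measurable_mean.
have f0 n x : 0 <= f n x by exact: sqr_ge0.
have E0 : 0 <= energy mu k u by exact: ip_ge0.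
have fle n : (\int[mu]_x (f n x)%:E <= (energy mu k u * C * q ^+ n)%:E)%E.
  have mk0 : 0 < m n * kap n by rewrite mulr_gt0.
  have := @averaging _ _ _ mu k mk k0 (B n) setT (m n) (kap n) u (mB n) measurableT (m0 n) (ltW (kap0 n)).
  move=> H; have {H} : ((m n * kap n)%:E * \int[mu]_x (f n x)%:E <= \int[mu2 mu]_z (grad k u z ^+ 2)%:E)%E.
    apply: H => //; last exact: measurable_mean.
    move=> x y Bxy; have [->|xy] := eqVneq (u x) (u y).
      by rewrite subrr expr0n/= mul0r mulr0.
    rewrite mulrC ler_wpM2l ?sqr_ge0//; apply: (Bk Bxy).
    by move=> xy'; move: xy; rewrite xy' eqxx.
  rewrite -(ipE measurableT gu) -/(energy mu k u).
  have Mi : (0 <= (m n * kap n)^-1%:E)%E by rewrite lee_fin invr_ge0 ltW.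
  have MM : ((m n * kap n)^-1%:E * (m n * kap n)%:E = 1)%E.
    by rewrite -EFinM mulVf// gt_eqF.
  move=> /(lee_wpmul2l Mi); rewrite muleA MM mul1e -EFinM.
  move=> /le_trans; apply; rewrite lee_fin mulrC -mulrA; exact: ler_wpM2l.
have := ae_summable mf f0 (mulr_ge0 E0 C0) q01 fle.
apply: filterS => x /(summable_cvg0 (f0 ^~ x)) fx.
have : (fun n => Num.sqrt (f n x)) @ \oo --> Num.sqrt (0 : R).
  by apply: cvg_comp fx _; exact: sqrt_continuous.
rewrite sqrtr0; under eq_fun do rewrite sqrtr_sqr.
move=> /norm_cvg0 H.
have : (fun n => u x - (u x - mean mu (xsection (B n) x) u)) @ \oo --> u x - 0.
  by apply: cvgB; [exact: cvg_cst|exact: H].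
by rewrite subr0; under eq_fun do rewrite subKr.
Qed.

End differentiation.

(** * Euler-Lagrange equation and positivity *)

(** The polynomial is minimal at 0. *)
Lemma quadratic_slope0 (R : realFieldType) (a b e : R) :
  (forall t, 0 <= a + 2 * t * b + t ^+ 2 * e) -> a <= 0 -> b = 0.
Proof.
move=> H a0; apply/eqP; rewrite -sqrf_eq0; apply/negPn/negP => b0.
have b2 : 0 < b ^+ 2 by rewrite lt_neqAle eq_sym b0 sqr_ge0.
pose E := `|e| + 1.
have E0 : 0 < E by rewrite ltr_wpDl.
have eE : e < E by rewrite /E; have := ler_norm e; lra.
have := H (- b / E); have -> : a + 2 * (- b / E) * b + (- b / E) ^+ 2 * e =
  a - (b ^+ 2 / E) * (2 - e / E) by field; rewrite gt_eqF.
have q0 : 0 < b ^+ 2 / E by rewrite divr_gt0.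
have r0 : 0 < 2 - e / E by rewrite subr_gt0 ltr_pdivrMr//; lra.
by have := mulr_gt0 q0 r0; lra.
Qed.

Lemma max0_lip (R : realDomainType) (a b : R) : `|Num.max 0 a - Num.max 0 b| <= `|a - b|.
Proof.
wlog ab : a b / b <= a.
  by move=> H; have [/H//|/ltW/H] := leP b a; rewrite distrC (distrC a).
rewrite [leRHS]ger0_norm ?subr_ge0//.
by case: (leP 0 a) => a0; case: (leP 0 b) => b0; rewrite ger0_norm; lra.
Qed.

Section optimality.
Context d (T : measurableType d) (R : realType).
Variables (mu : {sigma_finite_measure set T -> \bar R}) (k : T -> T -> R).
Hypothesis mk : measurable_fun setT (fun z : T * T => k z.1 z.2).
Hypothesis k0 : forall x y, 0 <= k x y.
Hypothesis kpos : forall x y, x <> y -> 0 < k x y.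
Variables (Om : set T) (c alpha lam : R).
Hypothesis mOm : measurable Om.
Hypothesis c0 : 0 < c.
Hypothesis alpha0 : 0 < alpha.
Hypothesis lam0 : 0 <= lam.
Implicit Types (u v w phi psi : T -> R) (A B W : set T).

Local Notation Q A := (Qform mu k A c alpha).
Local Notation adm := (adm mu k Om).

Let ipexp d' (U : measurableType d') (m : {measure set U -> \bar R}) (D : set U) f g t :
  measurable D -> l2 m D f -> l2 m D g ->
  ip m D (fun x => f x + t * g x) (fun x => f x + t * g x) =
  ip m D f f + 2 * t * ip m D f g + t ^+ 2 * ip m D g g.
Proof. by move=> mD; exact: ip_expand. Qed.

(** [Q W - lam * ip mu setT] along the line [u + t * phi] is a nonnegative polynomial
of degree 2 in [t] whose value at 0 is at most 0. *)
Lemma euler_lagrange W u : measurable W ->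
  (forall psi, adm psi -> lam * ip mu setT psi psi <= Q W psi) ->
  adm u -> Q W u <= lam * ip mu setT u u ->
  forall phi, adm phi ->
  c * ip (mu2 mu) setT (grad k u) (grad k phi) + alpha * ip mu W u phi =
  lam * ip mu setT u phi.
Proof.
move=> mW minW au Qu phi aphi.
have [_ l2u gu _] := au; have [_ l2p gp _] := aphi.
have [l2uW _] := l2S measurableT mW (@subsetT _ _) l2u.
have [l2pW _] := l2S measurableT mW (@subsetT _ _) l2p.
apply/eqP; rewrite -subr_eq0; apply/eqP.
apply: (@quadratic_slope0 _ (Q W u - lam * ip mu setT u u) _ (Q W phi - lam * ip mu setT phi phi)) => [t|].
- have := minW _ (admD t au aphi); rewrite /Qform /energy gradD !ipexp//; lra.
- by rewrite subr_le0.
Qed.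

Lemma adm_truncation u phi (M : R) : adm u -> adm phi ->
  adm (fun x => Num.max 0 (phi x - M * u x)).
Proof.
move=> au aphi; have aw := admD (- M) aphi au.
have E : (fun x => phi x + - M * u x) = (fun x => phi x - M * u x) by apply/funext => x; ring.
rewrite E in aw; have [mw _ _ w0] := aw.
have [] // := adm_contraction mk aw (v := fun x => Num.max 0 (phi x - M * u x)).
- exact: measurable_maxr.
- by move=> x Omx; rewrite w0// maxxx.
- by move=> x; have := max0_lip (phi x - M * u x) 0; rewrite maxxx !subr0.
- by move=> x y; exact: max0_lip.
Qed.

(** A strong maximum principle by a nonlocal argument.  Let [Z] be the set of
zeros of [u] in [Om].  The equation tested with the positive part [v] of
[phi - M * u] bounds [M] times the energy product of [u] and [v] from below,
uniformly in [M].  For [x] in [Z] and [y] where [u y] is not small, the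
integrand of this product contains the negative term [- u y * phi x * k x y],
whereas the rest is bounded by the energy of [phi].  Dividing by [M] and letting
it tend to infinity, the integral of [u y * phi x * k x y] over such pairs is 0,
so that either [Z] is null or [u] vanishes almost everywhere. *)
Lemma ae_pos_minimizer u phi W (b : R) : measurable W ->
  (forall psi, adm psi -> lam * ip mu setT psi psi <= Q W psi) ->
  adm u -> (forall x, 0 <= u x) -> 0 < ip mu setT u u ->
  Q W u <= lam * ip mu setT u u ->
  adm phi -> (forall x, 0 <= phi x <= b) -> (forall x, Om x -> 0 < phi x) ->
  {ae mu, forall x, Om x -> 0 < u x}.
Proof.
move=> mW minW au u0 upos Qu aphi phib phipos.
have [m_u l2u gu uOm] := au; have [mphi l2p gp _] := aphi.
pose Z := Om `&` [set x | u x <= 0].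
have mZ : measurable Z by apply: measurableI => //; exact: measurable_le_cst.
suff Z0 : mu Z = 0%E.
  exists Z; split => // x /= /not_implyP[Omx /negP ux]; split => //=.
  by rewrite leNgt.
(* Where phi - M * u is nonpositive as soon as n <= M. *)
pose P n := [set x | b <= n%:R * u x].
have mP n : measurable (P n).
  rewrite (_ : P n = [set x | - (n%:R * u x) <= - b]); last first.
    by apply/seteqP; split => x /=; rewrite lerN2.
  by apply: measurable_le_cst; apply: measurable_funN; exact: measurable_funM.
pose v (M : R) x := Num.max 0 (phi x - M * u x).
have av M : adm (v M) by exact: adm_truncation.
pose C1 := alpha * ip mu W phi phi / c.
have [l2uW _] := l2S measurableT mW (@subsetT _ _) l2u.
have [l2pW _] := l2S measurableT mW (@subsetT _ _) l2p.
(* The equation tested with v M; the terms lam * ip u v are nonnegative, and M * u * v <= phi ^ 2 pointwise. *)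
have lower (M : R) : 0 < M -> - C1 <= M * ip (mu2 mu) setT (grad k u) (grad k (v M)).
  move=> M0; have [mv l2v gv _] := av M.
  have EL := euler_lagrange mW minW au Qu (av M).
  have v0 x : 0 <= v M x by rewrite /v le_max lexx.
  have uv0 : 0 <= ip mu setT u (v M) by apply: Rintegral_ge0 => x _; rewrite mulr_ge0.
  have [l2vW _] := l2S measurableT mW (@subsetT _ _) l2v.
  have uvW : M * ip mu W u (v M) <= ip mu W phi phi.
    rewrite /ip -RintegralZl//; last exact: l2_integrable.
    apply: le_Rintegral => //.
    - exact: (integrableZl mW M (l2_integrable mW l2uW l2vW)).
    - exact: l2_integrable.
    - move=> x _; rewrite /v; case: (leP 0 (phi x - M * u x)) => h.
        have := u0 x; have /andP[p0 _] := phib x; nra.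
      by rewrite !mulr0 -expr2 sqr_ge0.
  rewrite /C1 -mulNr ler_pdivrMr//.
  have : M * (lam * ip mu setT u (v M)) >= 0 by rewrite !mulr_ge0// ltW.
  rewrite -EL; move: uvW; have := ltW alpha0.
  move: (ip _ W u _) (ip _ W phi _) (ip _ _ (grad k u) _) => x y z a0 xy.
  have := ler_wpM2l a0 xy; nra.
pose h n (z : T * T) := (\1_Z z.1 : R) * (\1_(P n) z.2 : R) * (u z.2 * phi z.1 * k z.1 z.2).
have mh n : measurable_fun setT (h n).
  apply: measurable_funM.
    by apply: measurable_funM; apply: measurableT_comp => //; exact: measurable_indic.
  by apply: measurable_funM => //; apply: measurable_funM; exact: measurableT_comp.
have h0 n z : 0 <= h n z.
  rewrite mulr_ge0// !mulr_ge0//.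
  by have /andP[] := phib z.1.
have hle n (M : R) z : (0 < n)%N -> n%:R <= M ->
    M * h n z <= grad k phi z * grad k phi z - M * (grad k u z * grad k (v M) z).
  move=> n0 nM; have n0' : 0 < n%:R :> R by rewrite ltr0n.
  have M0 : 0 < M by apply: lt_le_trans nM.
  have sk : Num.sqrt (k z.1 z.2) * Num.sqrt (k z.1 z.2) = k z.1 z.2.
    by rewrite -expr2 sqr_sqrtr.
  rewrite /grad [leRHS](_ : _ =
    ((phi z.1 - phi z.2) ^+ 2 - M * (u z.1 - u z.2) * (v M z.1 - v M z.2)) * k z.1 z.2); last first.
    by move: sk; set q := Num.sqrt _ => <-; ring.
  rewrite /h mulrA mulrA ler_wpM2r//.
  (* Let a = M (u x - u y) and b = phi x - phi y. If phi - M u is positive at both points, this is a (b - a) <= b ^ 2. If it is positive at one of them only, the bound is kept because its two values have a nonpositive product. *)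
  have key : M * (u z.1 - u z.2) * (v M z.1 - v M z.2) <= (phi z.1 - phi z.2) ^+ 2.
    rewrite /v; move: (phi z.1) (phi z.2) (u z.1) (u z.2) => p q a e.
    case: (leP 0 (p - M * a)) => h1; case: (leP 0 (q - M * e)) => h2.
    - have := sqr_ge0 (M * (a - e)); have := sqr_ge0 (p - q - M * (a - e)).
      by have := sqr_ge0 (p - q); lra.
    - have VV : (p - M * a) * (q - M * e) <= 0 by rewrite mulr_ge0_le0// ltW.
      have := sqr_ge0 (p - M * a); have := sqr_ge0 (p - q - (p - M * a)).
      by have := sqr_ge0 (p - q); lra.
    - have VV : (p - M * a) * (q - M * e) <= 0 by rewrite mulr_le0_ge0// ltW.
      have := sqr_ge0 (q - M * e); have := sqr_ge0 (p - q + (q - M * e)).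
      by have := sqr_ge0 (p - q); lra.
    - by rewrite subrr mulr0 sqr_ge0.
  rewrite !indicE; case: (boolP (z.1 \in Z)) => [/set_mem[Z1 Z2]|_]; last first.
    by rewrite !(mulr0, mul0r) subr_ge0.
  case: (boolP (z.2 \in P n)) => [/set_mem Pz|_]; last first.
    by rewrite !(mulr0, mul0r) subr_ge0.
  have uz1 : u z.1 = 0 by apply/le_anti; rewrite Z2 u0.
  have /andP[p1 p1b] := phib z.1; have /andP[p2 p2b] := phib z.2.
  have vz1 : v M z.1 = phi z.1 by rewrite /v uz1 mulr0 subr0 max_r.
  have vz2 : v M z.2 = 0.
    apply/max_l; rewrite subr_le0; apply: le_trans p2b _; apply: le_trans Pz _.
    by rewrite ler_wpM2r.
  rewrite uz1 vz1 vz2 /= !mulr1.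
  by rewrite sub0r subr0 mulrN mulNr opprK -mulrA lerDr sqr_ge0.
have hint n : (0 < n)%N -> (\int[mu2 mu]_z (h n z)%:E = 0)%E.
  move=> n0; have n0' : 0 < n%:R :> R by rewrite ltr0n.
  pose C2 := ip (mu2 mu) setT (grad k phi) (grad k phi) + C1.
  have C20 : 0 <= C2.
    by rewrite addr_ge0 ?ip_ge0// /C1 divr_ge0 ?mulr_ge0 ?ip_ge0// ltW.
  have up (M : R) : n%:R <= M -> (\int[mu2 mu]_z (h n z)%:E <= (C2 / M)%:E)%E.
    move=> nM; have M0 : 0 < M by apply: lt_le_trans nM.
    have [_ _ gv _] := av M.
    have i1 := l2_integrable measurableT gp gp.
    have i2 := integrableZl measurableT M (l2_integrable measurableT gu gv).
    have i3 := integrableB measurableT i1 i2.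
    have H : (M%:E * \int[mu2 mu]_z (h n z)%:E <= C2%:E)%E.
      rewrite -ge0_integralZl_EFin ?(ltW M0)//;
        try (by move=> z _; rewrite lee_fin); try exact/measurable_EFinP.
      apply: (@le_trans _ _ (\int[mu2 mu]_z ((grad k phi z * grad k phi z - M * (grad k u z * grad k (v M) z))%:E))%E).
        apply: ge0_le_integral => //.
        - by move=> z _; rewrite -EFinM lee_fin mulr_ge0// ltW.
        - by apply: emeasurable_funM => //; exact/measurable_EFinP.
        - exact: (measurable_int _ i3).
        - by move=> z _; rewrite -EFinM lee_fin hle.
      have -> : (\int[mu2 mu]_z ((grad k phi z * grad k phi z - M * (grad k u z * grad k (v M) z))%:E) =
         (ip (mu2 mu) setT (grad k phi) (grad k phi) - M * ip (mu2 mu) setT (grad k u) (grad k (v M)))%:E)%E.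
        rewrite /ip -RintegralZl//; last exact: l2_integrable.
        rewrite -RintegralB// fineK//.
        exact: (integrable_fin_num measurableT i3).
      by rewrite lee_fin /C2 lerD2l lerNl lower.
    have Mi : (0 <= M^-1%:E)%E by rewrite lee_fin invr_ge0 ltW.
    have := lee_wpmul2l Mi H; rewrite muleA -EFinM mulVf ?gt_eqF// mul1e -EFinM.
    by rewrite mulrC.
  apply/le_anti/andP; split; last by apply: integral_ge0 => z _; rewrite lee_fin.
  apply/lee_addgt0Pr => e e0; rewrite add0e.
  apply: le_trans (up (n%:R + C2 / e) _) _; first by rewrite lerDl divr_ge0// ltW.
  have Ce : 0 <= C2 / e by rewrite divr_ge0// ltW.
  rewrite lee_fin ler_pdivrMr; last by rewrite ltr_wpDr.
  by rewrite mulrDr (mulrC e (C2 / e)) divfK ?gt_eqF// lerDr mulr_ge0// ltW.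
have ZP n : (0 < n)%N -> 0 < b -> (mu Z * mu (P n) = 0)%E.
  move=> n0 b0; rewrite -(product_measure1E mu mu mZ (mP n)).
  have : ae_eq (mu2 mu) setT (EFin \o h n) (cst 0%E).
    have mhE : measurable_fun setT (EFin \o h n) by exact/measurable_EFinP.
    apply/(ae_eq_integral_abs (mu2 mu) measurableT mhE); rewrite -(hint n n0).
    by apply: eq_integral => z _; rewrite /= ger0_norm.
  move=> [N [mN N0 HN]]; apply/eqP; rewrite -measure_le0 -[leRHS]N0.
  apply: le_measure; rewrite ?inE//; first exact: measurableX.
  move=> z [[Z1 Z2] Pz]; apply: HN => /= /(_ I) [] /eqP.
  rewrite /h !indicE !mem_set// !mul1r; apply/negP.
  have uz2 : 0 < u z.2.
    rewrite ltNge; apply/negP => u2; have uz : u z.2 = 0 by apply/le_anti; rewrite u2 u0.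
    by move: Pz; rewrite /P /= uz mulr0 leNgt b0.
  rewrite gt_eqF// !mulr_gt0//; first exact: phipos.
  by apply: kpos => zz; move: Z2; rewrite /= zz leNgt uz2.
have [b0|b0] := ltP 0 b; last first.
  rewrite (_ : Z = set0) ?measure0//; apply/seteqP; split => x //= [Omx _].
  by have := phipos x Omx; have /andP[_ pb] := phib x; lra.
apply/eqP/negPn/negP => Zn0.
have P0 n : mu (P n.+1) = 0%E.
  by have /eqP := ZP n.+1 isT b0; rewrite mule_eq0 (negbTE Zn0)/= => /eqP.
have : {ae mu, forall x, u x = 0}.
  have : {ae mu, forall x, forall n, ~ P n.+1 x}.
    by apply: ae_foralln => n; exists (P n.+1); split; [exact: mP|exact: P0|by move=> x /= /contrapT].
  apply: filterS => x Hx; apply/le_anti; rewrite u0 andbT leNgt; apply/negP => ux.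
  apply: (Hx (Num.truncn (b / u x))); rewrite /P /=.
  by rewrite -ler_pdivrMr// ltW// truncnS_gt.
have mc : measurable_fun setT (fun _ : T => 0 : R) by exact: measurable_cst.
move=> /(sqr_ae measurableT m_u mc).
rewrite -ipE//; under eq_integral do rewrite expr0n/=.
by rewrite integral0 => -[uu]; move: upos; rewrite uu ltxx.
Qed.

End optimality.

(** * Optimal sets are sublevel sets *)

Section bang_bang.
Context d (T : measurableType d) (R : realType).
Variables (mu : {sigma_finite_measure set T -> \bar R}) (k : T -> T -> R).
Variables (Om A : set T) (c alpha lam : R).
Hypothesis mOm : measurable Om.
Hypothesis Omoo : (mu Om < +oo)%E.
Hypothesis mA : measurable A.
Hypothesis AOm : A `<=` Om.
Hypothesis alpha0 : 0 < alpha.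

Local Notation Q W := (Qform mu k W c alpha).
Local Notation adm := (adm mu k Om).

Hypothesis minA : forall W, measurable W -> W `<=` Om -> mu W = mu A ->
  forall psi, adm psi -> lam * ip mu setT psi psi <= Q W psi.
Variable u : T -> R.
Hypothesis au : adm u.
Hypothesis u0 : forall x, 0 <= u x.
Hypothesis Qu : Q A u <= lam * ip mu setT u u.
Hypothesis upos : {ae mu, forall x, Om x -> 0 < u x}.

Lemma ip_setU (D E : set T) (f g : T -> R) : measurable D -> measurable E ->
  D `&` E = set0 -> l2 mu setT f -> l2 mu setT g ->
  ip mu (D `|` E) f g = ip mu D f g + ip mu E f g.
Proof.
move=> mD mE DE l2f l2g; apply: Rintegral_setU => //.
  apply: (@integrableS _ _ _ mu setT) => //; first exact: measurableU.
  exact: l2_integrable.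
by apply/eqP.
Qed.

(** Replacing [B1] by [A1] in [A] does not increase [Q] at [u], so [u] is also a
minimizer for the new set.  The two Euler-Lagrange equations differ only by the
integrals over [A1] and [B1]. *)
Lemma exchange (A1 B1 : set T) (t : R) : measurable A1 -> measurable B1 ->
  A1 `<=` Om `\` A -> B1 `<=` A -> mu A1 = mu B1 ->
  (forall x, A1 x -> u x <= t) -> (forall x, B1 x -> t <= u x) ->
  forall phi, adm phi -> ip mu A1 u phi = ip mu B1 u phi.
Proof.
move=> mA1 mB1 A1O B1A AB uA uB phi aphi.
pose D := A `\` B1; pose W := D `|` A1.
have mD : measurable D by exact: measurableD.
have mW : measurable W by exact: measurableU.
have DA1 : D `&` A1 = set0.
  by apply/seteqP; split => x //= [[Ax _] /A1O[]].
have DB1 : D `&` B1 = set0 by apply/seteqP; split => x //= [[_ ?]].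
have AE : A = D `|` B1.
  apply/seteqP; split => x; last by case => [[]//|/B1A].
  by move=> Ax; have [|nB] := pselect (B1 x); [right|left].
have muW : mu W = mu A.
  rewrite AE measureU// measureU//; congr (_ + _)%E; exact: AB.
have WOm : W `<=` Om by move=> x [[/AOm//]|/A1O[]].
have [_ l2u _ _] := au; have [_ l2p _ _] := aphi.
have ipW v w : l2 mu setT v -> l2 mu setT w -> ip mu W v w = ip mu D v w + ip mu A1 v w.
  by move=> *; exact: ip_setU.
have ipA v w : l2 mu setT v -> l2 mu setT w -> ip mu A v w = ip mu D v w + ip mu B1 v w.
  by move=> *; rewrite {1}AE; exact: ip_setU.
have Boo : (mu B1 < +oo)%E.
  by apply: le_lt_trans Omoo; apply: le_measure; rewrite ?inE// => x /B1A/AOm.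
have Aoo : (mu A1 < +oo)%E by rewrite AB.
have le1 : ip mu A1 u u <= ip mu B1 u u.
  have iA : mu.-integrable A1 (EFin \o (fun x => u x * u x)).
    by have [l2' _] := l2S measurableT mA1 (@subsetT _ _) l2u; exact: l2_integrable.
  have iB : mu.-integrable B1 (EFin \o (fun x => u x * u x)).
    by have [l2' _] := l2S measurableT mB1 (@subsetT _ _) l2u; exact: l2_integrable.
  have icA : mu.-integrable A1 (EFin \o (fun=> t * t)).
    exact: (l2_integrable mA1 (l2_cst t mA1 Aoo) (l2_cst t mA1 Aoo)).
  have icB : mu.-integrable B1 (EFin \o (fun=> t * t)).
    exact: (l2_integrable mB1 (l2_cst t mB1 Boo) (l2_cst t mB1 Boo)).
  have [t0|t0] := leP 0 t.
    apply: (@le_trans _ _ (t * t * fine (mu A1))).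
      rewrite -Rintegral_cst//; apply: le_Rintegral => // x /uA ux.
      by have := u0 x; nra.
    rewrite AB -Rintegral_cst//; apply: le_Rintegral => // x /uB ux; nra.
  have A10 : A1 = set0.
    by apply/seteqP; split => x //= /uA; have := u0 x; lra.
  by rewrite A10 /ip Rintegral_set0 ip_ge0.
have QW : Q W u <= lam * ip mu setT u u.
  apply: le_trans Qu; rewrite /Qform lerD2l ler_pM2l// ipW// ipA//.
  by rewrite lerD2l.
have E1 := euler_lagrange mW (minA mW WOm muW) au QW aphi.
have E2 := euler_lagrange mA (minA mA AOm erefl) au Qu aphi.
have : alpha * ip mu W u phi = alpha * ip mu A u phi.
  by apply/(addrI (c * ip (mu2 mu) setT (grad k u) (grad k phi))); rewrite E1.
by move/(mulfI (lt0r_neq0 alpha0)); rewrite ipW// ipA// => /addrI.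
Qed.

Hypothesis separate : forall S1 S2 : set T, measurable S1 -> measurable S2 ->
  S1 `<=` Om -> S2 `<=` Om -> mu S1 != 0%E -> mu S2 != 0%E ->
  exists A1 B1 phi, [/\ measurable A1, measurable B1, A1 `<=` S1, B1 `<=` S2 &
    [/\ mu A1 = mu B1, mu A1 != 0%E, adm phi, forall x, 0 <= phi x &
      ((forall x, A1 x -> phi x = 0) /\ (forall x, B1 x -> 0 < phi x)) \/
      ((forall x, B1 x -> phi x = 0) /\ (forall x, A1 x -> 0 < phi x))]].

Let ip_pos (B : set T) (phi : T -> R) : measurable B -> B `<=` Om ->
  adm phi -> (forall x, B x -> 0 < phi x) -> ip mu B u phi = 0 -> mu B = 0%E.
Proof.
move=> mB BOm aphi phi0 ip0.
have [m_u l2u _ _] := au; have [mphi l2p _ _] := aphi.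
have [l2uB _] := l2S measurableT mB (@subsetT _ _) l2u.
have [l2pB _] := l2S measurableT mB (@subsetT _ _) l2p.
have iB := l2_integrable mB l2uB l2pB.
have : (\int[mu]_(x in B) `|(u x * phi x)%:E| = 0)%E.
  have <- : (ip mu B u phi)%:E = 0%E by rewrite ip0.
  rewrite fineK; last exact: (integrable_fin_num mB iB).
  apply: eq_integral => x /set_mem Bx; rewrite /= ger0_norm// mulr_ge0//.
  by rewrite ltW// phi0.
move=> /(ae_eq_integral_abs _ mB (measurable_int _ iB)) ae0.
have : {ae mu, forall x, ~ B x}.
  apply: filterS2 ae0 upos => x H1 H2 Bx.
  have [] := H1 Bx; apply/eqP; rewrite gt_eqF// mulr_gt0//; last exact: phi0.
  by apply: H2; exact: BOm.
move=> [N [mN N0 BN]]; apply/eqP; rewrite -measure_le0 -[leRHS]N0.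
by apply: le_measure; rewrite ?inE// => x Bx; apply: BN => /=; exact.
Qed.

(** If both sets had positive measure, [exchange] would apply to two subsets that a
test function tells apart, although [u] is positive. *)
Lemma level_dichotomy (t : R) :
  mu ((Om `&` [set x | u x <= t]) `\` A) = 0%E \/ mu (A `&` [set x | t <= u x]) = 0%E.
Proof.
have [m_u _ _ _] := au.
have mle : measurable [set x | u x <= t] by exact: measurable_le_cst.
have mge : measurable [set x | t <= u x].
  rewrite (_ : [set x | t <= u x] = [set x | - u x <= - t]); last first.
    by apply/seteqP; split => x /=; rewrite lerN2.
  by apply: measurable_le_cst; exact: measurable_funN.
set S1 := (_ `\` A); set S2 := A `&` _.
have mS1 : measurable S1 by apply: measurableD => //; exact: measurableI.
have mS2 : measurable S2 by exact: measurableI.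
have S1O : S1 `<=` Om by move=> x [[]].
have S2O : S2 `<=` Om by move=> x [/AOm].
have [->|S10] := eqVneq (mu S1) 0%E; first by left.
have [->|S20] := eqVneq (mu S2) 0%E; first by right.
have [A1 [B1 [phi [mA1 mB1 A1S B1S [AB A10 aphi phi0 H]]]]] := separate mS1 mS2 S1O S2O S10 S20.
have ex := exchange mA1 mB1 (t := t) _ _ AB _ _ aphi.
have {ex} ex : ip mu A1 u phi = ip mu B1 u phi.
  apply: ex.
  - by move=> x /A1S[[]].
  - by move=> x /B1S[].
  - by move=> x /A1S[[_]].
  - by move=> x /B1S[].
have zero B : (forall x, B x -> phi x = 0) -> ip mu B u phi = 0.
  move=> B0; rewrite /ip -[RHS](mul0r (fine (mu set0))) -Rintegral_cst//.
  rewrite Rintegral_set0 (_ : 0 = \int[mu]_(x in B) 0); last by rewrite /Rintegral integral0.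
  by apply: eq_Rintegral => x /set_mem Bx; rewrite B0// mulr0.
exfalso; case: H => -[z p].
- have B0 : mu B1 = 0%E by apply: (ip_pos mB1 (subset_trans B1S S2O) aphi p); rewrite -ex zero.
  by move: A10; rewrite AB B0 eqxx.
- have A0 : mu A1 = 0%E by apply: (ip_pos mA1 (subset_trans A1S S1O) aphi p); rewrite ex zero.
  by move: A10; rewrite A0 eqxx.
Qed.

(** For each [t], one of the two sets of [level_dichotomy] is null; [J] collects the
[t] for which the first one is.  Almost everywhere, this holds simultaneously
for countably many [t], and those suffice by monotonicity. *)
Theorem minimizing_set_is_sublevel : exists J : set R,
  (forall s t, s <= t -> J t -> J s) /\
  {ae mu, forall x, A x <-> Om x /\ J (u x)}.
Proof.
have [m_u _ _ _] := au.
pose J := [set t | mu ((Om `&` [set x | u x <= t]) `\` A) = 0%E].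
have mle t : measurable ((Om `&` [set x | u x <= t]) `\` A).
  by apply: measurableD => //; apply: measurableI => //; exact: measurable_le_cst.
have mge t : measurable (A `&` [set x | t <= u x]).
  apply: measurableI => //; rewrite (_ : [set x | t <= u x] = [set x | - u x <= - t]); last first.
    by apply/seteqP; split => x /=; rewrite lerN2.
  by apply: measurable_le_cst; exact: measurable_funN.
have Jdown s t : s <= t -> J t -> J s.
  move=> st Jt; apply/eqP; rewrite -measure_le0 -[leRHS]Jt.
  apply: le_measure; rewrite ?inE// => x [[Omx xs] nA]; split => //; split => //.
  exact: le_trans st.
have inJ t : J t -> {ae mu, forall x, Om x -> u x <= t -> A x}.
  move=> Jt; exists ((Om `&` [set x | u x <= t]) `\` A); split => //.
  by move=> x /= /not_implyP[Omx /not_implyP[ut nA]].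
have notJ t : ~ J t -> {ae mu, forall x, A x -> t <= u x -> False}.
  move=> nJt; exists (A `&` [set x | t <= u x]); split => //.
    by case: (level_dichotomy t) => // /nJt.
  by move=> x /= /not_implyP[Ax /not_implyP[ut _]].
(* The thresholds used are the rationals, and the maximum of J or the minimum of its complement, which may fail to be rational. *)
pose q n : R := if unpickle n is Some r then ratr r else 0.
have qP (r : rat) : exists n, q n = ratr r by exists (pickle r); rewrite /q pickleK.
have ae1 : {ae mu, forall x, forall n, J (q n) -> Om x -> u x <= q n -> A x}.
  apply: ae_foralln => n; have [Jn|nJn] := pselect (J (q n)).
    by apply: filterS (inJ _ Jn) => x.
  by apply: nearW.
have ae2 : {ae mu, forall x, forall n, ~ J (q n) -> A x -> q n <= u x -> False}.
  apply: ae_foralln => n; have [Jn|nJn] := pselect (J (q n)).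
    by apply: nearW.
  by apply: filterS (notJ _ nJn) => x.
have ae3 : {ae mu, forall x, J (u x) -> (forall t, J t -> t <= u x) -> Om x -> A x}.
  have [[m [Jm Hm]]|nm] := pselect (exists m, J m /\ forall t, J t -> t <= m).
    by apply: filterS (inJ _ Jm) => x H Jx _ Omx; apply: H => //; exact: Hm.
  by apply: nearW => x Jx Hx; exfalso; apply: nm; exists (u x).
have ae4 : {ae mu, forall x, ~ J (u x) -> (forall t, ~ J t -> u x <= t) -> A x -> False}.
  have [[m [Jm Hm]]|nm] := pselect (exists m, ~ J m /\ forall t, ~ J t -> m <= t).
    by apply: filterS (notJ _ Jm) => x H Jx _ Ax; apply: H => //; exact: Hm.
  by apply: nearW => x Jx Hx; exfalso; apply: nm; exists (u x).
exists J; split; first exact: Jdown.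
apply: filterS2 (filterI ae1 ae2) (filterI ae3 ae4) => x [H1 H2] [H3 H4]; split.
- move=> Ax; split; first exact: AOm.
  apply: contrapT => nJ; apply: (H4 nJ _ Ax) => t nJt; rewrite leNgt; apply/negP => tu.
  have [r] := rat_in_itvoo tu; rewrite in_itv/= => /andP[tr ru]; have [n qn] := qP r.
  apply: (H2 n _ Ax); last by rewrite qn; exact: ltW.
  by rewrite qn => Jr; apply: nJt; apply: Jdown Jr; exact: ltW.
- move=> [Omx Jx]; apply: contrapT => nA; apply: (nA); apply: (H3 Jx) => // t Jt.
  rewrite leNgt; apply/negP => ut; apply: nA.
  have [r] := rat_in_itvoo ut; rewrite in_itv/= => /andP[ur rt]; have [n qn] := qP r.
  apply: (H1 n) => //; rewrite qn; last exact: ltW.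
  by apply: Jdown Jt; exact: ltW.
Qed.

End bang_bang.

(** * Polarization *)

Section invariance.
Context d (T : measurableType d) (R : realType) (mu : {measure set T -> \bar R}).
Variable sg : T -> T.
Hypothesis msg : measurable_fun setT sg.
Hypothesis sg_mu : forall A, measurable A -> mu (sg @^-1` A) = mu A.

Lemma ge0_integral_invariant (f : T -> \bar R) : measurable_fun setT f ->
  (forall x, 0 <= f x)%E -> (\int[mu]_x f (sg x) = \int[mu]_x f x)%E.
Proof.
move=> mf f0.
rewrite -[LHS](@ge0_integral_pushforward _ _ _ _ _ _ msg _ setT f) //.
by apply: eq_measure_integral => //= A mA _; rewrite /pushforward sg_mu.
Qed.

Lemma integral_invariant (f : T -> \bar R) : mu.-integrable setT f ->
  (\int[mu]_x f (sg x) = \int[mu]_x f x)%E.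
Proof.
move=> intf; have mf := measurable_int _ intf.
rewrite integralE [RHS]integralE; congr (_ - _)%E.
  rewrite -[RHS]ge0_integral_invariant//; last exact: measurable_funepos.
  by apply: eq_integral => x _; rewrite -[LHS]/((f \o sg)^\+ x)%E funepos_comp.
rewrite -[RHS]ge0_integral_invariant//; last exact: measurable_funeneg.
by apply: eq_integral => x _; rewrite -[LHS]/((f \o sg)^\- x)%E funeneg_comp.
Qed.

End invariance.

Section polarization.
Context d (T : measurableType d) (R : realType).
Variables (mu : {sigma_finite_measure set T -> \bar R}) (k : T -> T -> R).
Hypothesis mk : measurable_fun setT (fun z : T * T => k z.1 z.2).
Hypothesis k0 : forall x y, 0 <= k x y.
Variables (sg : T -> T) (e : T -> R).
Hypothesis msg : measurable_fun setT sg.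
Hypothesis sgK : involutive sg.
Hypothesis sg_mu : forall A, measurable A -> mu (sg @^-1` A) = mu A.
Hypothesis m_e : measurable_fun setT e.
Hypothesis e_sg : forall x, e (sg x) = - e x.
Hypothesis e_fix : forall x, e x = 0 -> sg x = x.
Hypothesis k_sg : forall x y, k (sg x) (sg y) = k x y.
Hypothesis k_strict : forall x y, x <> y -> 0 < e x * e y -> k (sg x) y < k x y.
Implicit Types u : T -> R.

(** The two-point rearrangement of [u]. *)
Definition polarize u x :=
  if 0 < e x then Num.max (u x) (u (sg x)) else Num.min (u x) (u (sg x)).

Lemma measurable_polarize u : measurable_fun setT u -> measurable_fun setT (polarize u).
Proof.
move=> m_u; apply: measurable_fun_ifT.
- by apply: measurable_fun_ltr.
- by apply: measurable_maxr => //; exact: measurableT_comp.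
- by apply: measurable_minr => //; exact: measurableT_comp.
Qed.

(** Integrals of functions of [u] over symmetric sets do not change, because only
the order of the two values does. *)
Lemma polarize_pair u x :
  (polarize u x = u x /\ polarize u (sg x) = u (sg x)) \/
  (polarize u x = u (sg x) /\ polarize u (sg x) = u x).
Proof.
rewrite /polarize e_sg sgK oppr_gt0.
case: (ltgtP 0 (e x)) => [ex|ex|/esym/e_fix ->]; last by left; rewrite minxx.
- by case: (leP (u x) (u (sg x))) => h; [right|left]; rewrite ?min_l ?min_r ?(ltW h).
- by case: (leP (u x) (u (sg x))) => h; [left|right]; rewrite ?max_l ?max_r ?(ltW h).
Qed.

Lemma polarize_diff u x :
  polarize u x - polarize u (sg x) = Num.sg (e x) * `|u x - u (sg x)|.
Proof.
rewrite /polarize e_sg sgK oppr_gt0.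
case: (ltgtP 0 (e x)) => [ex|ex|ex].
- rewrite gtr0_sg// mul1r; case: (leP (u x) (u (sg x))) => h.
    by rewrite ler0_norm ?subr_le0// opprB.
  by rewrite ger0_norm// subr_ge0 ltW.
- rewrite ltr0_sg// mulN1r; case: (leP (u x) (u (sg x))) => h.
    by rewrite ler0_norm ?subr_le0// opprK.
  by rewrite ger0_norm ?opprB// subr_ge0 ltW.
- by rewrite (e_fix (esym ex)) minxx -ex sgr0 mul0r subrr.
Qed.

Let F u (z : T * T) := (u z.1 - u z.2) ^+ 2 * k z.1 z.2.
Let G u (z : T * T) := F u z + F u (sg z.1, z.2) + F u (z.1, sg z.2) + F u (sg z.1, sg z.2).

(** Summed over the four pairs made from the mirror images of [x] and [y], the
integrand of the energy involves the kernel only through [k x y] and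
[k (sg x) y], and the sum of their two coefficients is the same before and after
polarization. *)
Lemma four_point u z : G u z - G (polarize u) z =
  (k z.1 z.2 - k (sg z.1) z.2) *
  ((polarize u z.1 - polarize u (sg z.1)) * (polarize u z.2 - polarize u (sg z.2)) -
   (u z.1 - u (sg z.1)) * (u z.2 - u (sg z.2))).
Proof.
rewrite /G /F /= k_sg -[k z.1 (sg z.2)]k_sg sgK.
by case: (polarize_pair u z.1) => -[-> ->]; case: (polarize_pair u z.2) => -[-> ->]; ring.
Qed.

Let w u x := (u x - u (sg x)) * e x.

(** On the same side of the mirror the kernel is larger than after reflection, and
polarization replaces the product of the two differences by its absolute value;
on opposite sides both signs are reversed.  Equality therefore determines the
sign of that product. *)
Lemma four_point_ge0 u z : 0 <= G u z - G (polarize u) z /\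
  (G u z - G (polarize u) z = 0 -> 0 <= w u z.1 * w u z.2).
Proof.
rewrite four_point !polarize_diff /w.
set a := u z.1 - u (sg z.1); set b := u z.2 - u (sg z.2).
have eab : a * e z.1 * (b * e z.2) = (e z.1 * e z.2) * (a * b) by ring.
rewrite eab; have -> : Num.sg (e z.1) * `|a| * (Num.sg (e z.2) * `|b|) =
  Num.sg (e z.1 * e z.2) * `|a * b| by rewrite sgrM normrM; ring.
have abn := ler_norm (a * b); have abn' := ler_norm (- (a * b)); rewrite normrN in abn'.
case: (ltgtP 0 (e z.1 * e z.2)) => [ee|ee|/esym/eqP].
- rewrite gtr0_sg// mul1r; have [zz|zz] := pselect (z.1 = z.2).
    have ab0 : 0 <= a * b by rewrite /a /b zz -expr2 sqr_ge0.
    by rewrite ger0_norm// subrr mulr0; split => // _; rewrite mulr_ge0// ltW.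
  have kk : 0 < k z.1 z.2 - k (sg z.1) z.2 by rewrite subr_gt0 k_strict.
  split; first by apply: mulr_ge0; [exact: ltW|rewrite subr_ge0].
  move/eqP; rewrite mulf_eq0 gt_eqF//= subr_eq0 => /eqP <-.
  by rewrite mulr_ge0// ltW.
- rewrite ltr0_sg// mulN1r; have [zz|zz] := pselect (sg z.1 = z.2).
    have ab0 : a * b <= 0.
      have -> : a * b = - (a ^+ 2) by rewrite /b -zz sgK /a; ring.
      by rewrite oppr_le0 sqr_ge0.
    by rewrite ler0_norm// opprK subrr mulr0; split => // _; rewrite mulr_le0// ltW.
  have kk : k z.1 z.2 - k (sg z.1) z.2 < 0.
    rewrite subr_lt0 -[X in k X _ < _]sgK; apply: k_strict => //.
    by rewrite e_sg mulNr oppr_gt0.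
  split; first by apply: mulr_le0; [exact: ltW|lra].
  move/eqP; rewrite mulf_eq0 lt_eqF//= subr_eq0 => /eqP H.
  by rewrite mulr_le0 ?(ltW ee)//; rewrite -H oppr_le0.
- rewrite mulf_eq0 => ee; have -> : a * b = 0.
    by move: ee => /orP[]/eqP e00; rewrite /a /b (e_fix e00) subrr ?mul0r ?mulr0.
  by rewrite normr0 !mulr0 subrr mulr0.
Qed.

Let mF u : measurable_fun setT u -> measurable_fun setT (F u).
Proof.
by move=> m_u; apply: measurable_funM => //; apply: measurable_funX; exact: measurable_diff.
Qed.

Let F0 u z : 0 <= F u z. Proof. by rewrite mulr_ge0 ?sqr_ge0. Qed.

Let ms1 : measurable_fun setT (fun z : T * T => (sg z.1, z.2)).
Proof. by apply: measurable_fun_pair => //; exact: measurableT_comp. Qed.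

Let ms2 : measurable_fun setT (fun z : T * T => (z.1, sg z.2)).
Proof. by apply: measurable_fun_pair => //; exact: measurableT_comp. Qed.

Lemma integral_sg1 (f : T * T -> \bar R) : measurable_fun setT f -> (forall z, 0 <= f z)%E ->
  (\int[mu2 mu]_z f (sg z.1, z.2) = \int[mu2 mu]_z f z)%E.
Proof.
move=> mf f0.
have mfs : measurable_fun setT (fun z : T * T => f (sg z.1, z.2)) by exact: (measurableT_comp mf ms1).
have f0s z : (0 <= f (sg z.1, z.2))%E by exact: f0.
rewrite /mu2 (fubini_tonelli2 _ mfs f0s) (fubini_tonelli2 _ mf f0).
apply: eq_integral => y _; rewrite /fubini_G /=.
apply: (ge0_integral_invariant msg sg_mu (f := fun x => f (x, y))) => //.
exact: (measurableT_comp mf (measurable_pair2 y)).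
Qed.

Lemma integral_sg2 (f : T * T -> \bar R) : measurable_fun setT f -> (forall z, 0 <= f z)%E ->
  (\int[mu2 mu]_z f (z.1, sg z.2) = \int[mu2 mu]_z f z)%E.
Proof.
move=> mf f0.
have mfs : measurable_fun setT (fun z : T * T => f (z.1, sg z.2)) by exact: (measurableT_comp mf ms2).
have f0s z : (0 <= f (z.1, sg z.2))%E by exact: f0.
rewrite /mu2 (fubini_tonelli1 _ mfs f0s) (fubini_tonelli1 _ mf f0).
apply: eq_integral => x _; rewrite /fubini_F /=.
apply: (ge0_integral_invariant msg sg_mu (f := fun y => f (x, y))) => //.
exact: (measurableT_comp mf (measurable_pair1 x)).
Qed.

Let G0 u z : 0 <= G u z. Proof. by rewrite !addr_ge0. Qed.

Let mG u : measurable_fun setT u -> measurable_fun setT (G u).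
Proof.
move=> /mF mFu; apply: measurable_funD.
  apply: measurable_funD; last exact: (measurableT_comp mFu ms2).
  by apply: measurable_funD => //; exact: (measurableT_comp mFu ms1).
exact: (measurableT_comp mFu (measurableT_comp ms1 ms2)).
Qed.

Lemma integral_four u : measurable_fun setT u ->
  (\int[mu2 mu]_z (G u z)%:E = 4%:E * \int[mu2 mu]_z (F u z)%:E)%E.
Proof.
move=> m_u; have mFu := mF m_u.
have mFE : measurable_fun setT (fun z => (F u z)%:E) by exact/measurable_EFinP.
have FE0 z : (0 <= (F u z)%:E)%E by rewrite lee_fin.
have m1 : measurable_fun setT (fun z : T * T => (F u (sg z.1, z.2))%:E) by exact: (measurableT_comp mFE ms1).
have m2 : measurable_fun setT (fun z : T * T => (F u (z.1, sg z.2))%:E) by exact: (measurableT_comp mFE ms2).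
have m3 : measurable_fun setT (fun z : T * T => (F u (sg z.1, sg z.2))%:E) by exact: (measurableT_comp m1 ms2).
have I1 := integral_sg1 mFE FE0.
have I2 := integral_sg2 mFE FE0.
have I3 : (\int[mu2 mu]_z (F u (sg z.1, sg z.2))%:E = \int[mu2 mu]_z (F u z)%:E)%E.
  by rewrite -I1; apply: (integral_sg2 m1) => z; rewrite lee_fin.
under eq_integral => z _ do rewrite /G !EFinD.
do 3 (rewrite ge0_integralD//;
  try (by move=> z _; rewrite -?EFinD lee_fin ?addr_ge0);
  try (by repeat apply: emeasurable_funD)).
rewrite I3 I2 I1; set I := (\int[_]_z _)%E.
have I0 : (0 <= I)%E by apply: integral_ge0 => z _; rewrite lee_fin.
rewrite (_ : 4%:E = (1 + 1 + 1 + 1)%:E)%E; last by congr EFin; ring.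
by rewrite !EFinD !ge0_muleDl ?mul1e// ?lee_fin//.
Qed.

Lemma integral_gradE u : (\int[mu2 mu]_z (grad k u z ^+ 2)%:E = \int[mu2 mu]_z (F u z)%:E)%E.
Proof. by apply: eq_integral => z _; rewrite sqr_grad. Qed.

Lemma energy_polarize u : measurable_fun setT u -> l2 (mu2 mu) setT (grad k u) ->
  l2 (mu2 mu) setT (grad k (polarize u)) /\ energy mu k (polarize u) <= energy mu k u.
Proof.
move=> m_u gu; have mp := measurable_polarize m_u.
apply: ipP => //; first exact: measurable_grad.
rewrite ipE// !integral_gradE -(@lee_pmul2l _ 4%:E)//.
rewrite -!integral_four//; apply: ge0_le_integral => //.
- by move=> z _; rewrite lee_fin.
- by apply/measurable_EFinP; exact: mG.
- by apply/measurable_EFinP; exact: mG.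
- by move=> z _; rewrite lee_fin -subr_ge0; have [] := four_point_ge0 u z.
Qed.

(** The integrand of [E u - E (polarize u)], symmetrized as in [four_point], is
nonnegative, so it vanishes for almost all pairs.  Hence the set where [w u] is
negative and the set where it is positive cannot both have positive measure. *)
Lemma polarize_rigid u : measurable_fun setT u -> l2 (mu2 mu) setT (grad k u) ->
  energy mu k u <= energy mu k (polarize u) ->
  {ae mu, forall x, 0 <= w u x} \/ {ae mu, forall x, w u x <= 0}.
Proof.
move=> m_u gu Eu; have mp := measurable_polarize m_u.
have [gp Ep] := energy_polarize m_u gu.
have int v : measurable_fun setT v -> l2 (mu2 mu) setT (grad k v) ->
    (mu2 mu).-integrable setT (fun z => (G v z)%:E) /\
    (\int[mu2 mu]_z (G v z)%:E = (4 * energy mu k v)%:E)%E.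
  move=> mv gv.
  have E : (\int[mu2 mu]_z (G v z)%:E = (4 * energy mu k v)%:E)%E.
    by rewrite integral_four// -integral_gradE -ipE// EFinM.
  split => //; apply/integrableP; split; first by apply/measurable_EFinP; exact: mG.
  under eq_integral do rewrite gee0_abs ?lee_fin//.
  by rewrite E ltry.
have [iu Iu] := int u m_u gu; have [ip Ip] := int _ mp gp.
have iD := integrableB measurableT iu ip.
have D0 : (\int[mu2 mu]_z `|(G u z)%:E - (G (polarize u) z)%:E| = 0)%E.
  transitivity (\int[mu2 mu]_z ((G u z)%:E - (G (polarize u) z)%:E))%E.
    apply: eq_integral => z _; rewrite gee0_abs// -EFinB lee_fin.
    by have [] := four_point_ge0 u z.
  have -> : (\int[mu2 mu]_z ((G u z)%:E - (G (polarize u) z)%:E) =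
    \int[mu2 mu]_z (G u z)%:E - \int[mu2 mu]_z (G (polarize u) z)%:E)%E by exact: integralB.
  rewrite Iu Ip -EFinB; congr EFin; apply/eqP; rewrite subr_eq0; apply/eqP; congr (_ * _).
  by apply/le_anti; rewrite Eu Ep.
have [N [mN N0 HN]] := (ae_eq_integral_abs _ measurableT (measurable_int _ iD)).1 D0.
have mw : measurable_fun setT (w u).
  by apply: measurable_funM => //; apply: measurable_funB => //; exact: measurableT_comp.
pose P1 := [set x | w u x < 0]; pose P2 := [set x | - w u x < 0].
have mP1 : measurable P1 by exact: measurable_lt_cst.
have mP2 : measurable P2 by apply: measurable_lt_cst; exact: measurable_funN.
have : (mu P1 * mu P2 = 0)%E.
  rewrite -(product_measure1E mu mu mP1 mP2); apply/eqP; rewrite -measure_le0 -[leRHS]N0.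
  apply: le_measure; rewrite ?inE//; first exact: measurableX.
  move=> z [/= z1 z2]; apply: HN => /= /(_ I); rewrite -EFinB => -[].
  have [_ H] := four_point_ge0 u z; move/H; apply/negP; rewrite -ltNge.
  by rewrite nmulr_rlt0//; move: z2; rewrite /P2 /= oppr_lt0.
move=> /eqP; rewrite mule_eq0 => /orP[]/eqP P0; [left|right].
- by exists P1; split => // x /= /negP; rewrite -ltNge.
- by exists P2; split => // x /= /negP; rewrite -ltNge /P2 /= oppr_lt0.
Qed.

Section moment.
Variables (Om : set T).
Hypothesis mOm : measurable Om.
Hypothesis sgOm : forall x, Om x -> Om (sg x).

Lemma integral_polarize (Phi : R -> R) u : measurable_fun setT u ->
  measurable_fun setT (Phi \o u) -> measurable_fun setT (Phi \o polarize u) ->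
  (forall t, 0 <= Phi t) ->
  (\int[mu]_(x in Om) (Phi (polarize u x))%:E = \int[mu]_(x in Om) (Phi (u x))%:E)%E.
Proof.
move=> m_u mPu mPp Phi0.
have OmE x : (sg x \in Om) = (x \in Om).
  by apply/idP/idP => /set_mem/sgOm; rewrite ?sgK => /mem_set.
pose f v x := (Phi (v x) * (\1_Om x : R)).
have fE v : (\int[mu]_(x in Om) (Phi (v x))%:E = \int[mu]_x (f v x)%:E)%E.
  rewrite integral_mkcond; apply: eq_integral => x _.
  by rewrite patchE /f indicE; case: ifP; rewrite ?mulr1 ?mulr0.
rewrite !fE.
have key v : measurable_fun setT (Phi \o v) ->
    (2%:E * \int[mu]_x (f v x)%:E = \int[mu]_x (f v x + f v (sg x))%:E)%E.
  move=> mv.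
  have mfv : measurable_fun setT (fun x => (f v x)%:E).
    by apply/measurable_EFinP; apply: measurable_funM => //; exact: measurable_indic.
  have fv0 x : (0 <= (f v x)%:E)%E by rewrite lee_fin mulr_ge0.
  under [RHS]eq_integral do rewrite EFinD.
  rewrite ge0_integralD//; last exact: (measurableT_comp mfv msg).
  rewrite (ge0_integral_invariant msg sg_mu mfv fv0).
  have I0 : (0 <= \int[mu]_x (f v x)%:E)%E by apply: integral_ge0.
  rewrite (_ : 2%:E = (1 + 1)%:E)%E; last by congr EFin; ring.
  by rewrite EFinD ge0_muleDl ?mul1e// lee_fin.
have E : (2%:E * \int[mu]_x (f (polarize u) x)%:E = 2%:E * \int[mu]_x (f u x)%:E)%E.
  rewrite !key//; apply: eq_integral => x _; congr EFin.
  rewrite /f !indicE OmE.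
  by case: (polarize_pair u x) => -[-> ->]; ring.
have := congr1 (fun x => (2^-1)%:E * x)%E E.
by rewrite !muleA -EFinM mulVf// !mul1e.
Qed.

(** By symmetry, the integral of [w u x * (u x + u (sg x))] is twice that of
[e x * u x ^ 2], hence 0; its integrand has a constant sign. *)
Lemma moment_rigid u : measurable_fun setT u -> (forall x, 0 <= u x) ->
  mu.-integrable setT (fun x => (e x * u x ^+ 2)%:E) ->
  (\int[mu]_x (e x * u x ^+ 2)%:E = 0)%E ->
  {ae mu, forall x, 0 <= w u x} \/ {ae mu, forall x, w u x <= 0} ->
  {ae mu, forall x, u (sg x) = u x}.
Proof.
move=> m_u u0 iu Iu Hw.
have mu_ : measurable_fun setT (fun x => (e x * u x ^+ 2)%:E) by exact: measurable_int iu.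
have isg : mu.-integrable setT (fun x => (e (sg x) * u (sg x) ^+ 2)%:E).
  apply/integrableP; split; first exact: (measurableT_comp mu_ msg).
  have ma : measurable_fun setT (fun x => `|(e x * u x ^+ 2)%:E|)%E by exact: measurableT_comp.
  rewrite (ge0_integral_invariant msg sg_mu (f := fun x => `|(e x * u x ^+ 2)%:E|%E) ma)//.
  by have /integrableP[] := iu.
pose h x := e x * u x ^+ 2 + e (sg x) * u (sg x) ^+ 2.
have ih : mu.-integrable setT (fun x => (h x)%:E).
  by have := integrableD measurableT iu isg.
have Ih : (\int[mu]_x (h x)%:E = 0)%E.
  transitivity (\int[mu]_x ((e x * u x ^+ 2)%:E + (e (sg x) * u (sg x) ^+ 2)%:E))%E; first by [].
  rewrite integralD// (integral_invariant msg sg_mu (f := fun x => (e x * u x ^+ 2)%:E))//.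
  by rewrite Iu adde0.
have hE x : h x = w u x * (u x + u (sg x)) by rewrite /h /w e_sg; ring.
have ae0 : {ae mu, forall x, h x = 0}.
  have abs0 : (\int[mu]_x `|(h x)%:E| = 0)%E -> {ae mu, forall x, h x = 0}.
    move=> /(ae_eq_integral_abs _ measurableT (measurable_int _ ih)).
    by apply: filterS => x /(_ I) [].
  have mh : measurable_fun setT (fun x => (h x)%:E) by exact: measurable_int ih.
  have ma : measurable_fun setT (fun x => `|(h x)%:E|)%E by exact: measurableT_comp.
  case: Hw => Hw; apply: abs0.
  - rewrite -Ih; apply: ae_eq_integral => //; apply: filterS Hw => x wx _.
    by rewrite gee0_abs// lee_fin hE mulr_ge0// addr_ge0.
  - have -> : (\int[mu]_x `|(h x)%:E| = \int[mu]_x (- (h x)%:E))%E.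
      apply: ae_eq_integral => //; first exact: measurableT_comp.
      apply: filterS Hw => x wx _.
      by rewrite lee0_abs// lee_fin hE mulr_le0_ge0// addr_ge0.
    under eq_integral do rewrite -mulN1e.
    by rewrite (integralZl measurableT ih (-1)) Ih mule0.
apply: filterS ae0 => x /eqP; rewrite hE !mulf_eq0 -orbA => /or3P[|/eqP ex|/eqP uu].
- by rewrite subr_eq0 => /eqP.
- by rewrite (e_fix ex).
- by have := u0 x; have := u0 (sg x); lra.
Qed.

End moment.

End polarization.

Section minimizer_polarization.
Context d (T : measurableType d) (R : realType).
Variables (mu : {sigma_finite_measure set T -> \bar R}) (k : T -> T -> R).
Hypothesis mk : measurable_fun setT (fun z : T * T => k z.1 z.2).
Hypothesis k0 : forall x y, 0 <= k x y.
Variables (Om A : set T) (c alpha lam : R) (J : set R) (u : T -> R).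
Hypothesis mOm : measurable Om.
Hypothesis mA : measurable A.
Hypothesis c0 : 0 < c.
Hypothesis minA : forall W, measurable W -> W `<=` Om -> mu W = mu A ->
  forall psi, adm mu k Om psi -> lam * ip mu setT psi psi <= Qform mu k W c alpha psi.
Hypothesis au : adm mu k Om u.
Hypothesis Qu : Qform mu k A c alpha u <= lam * ip mu setT u u.
Hypothesis Jdown : forall s t, s <= t -> J t -> J s.
Hypothesis AJ : {ae mu, forall x, A x <-> Om x /\ J (u x)}.
Variables (sg : T -> T) (e : T -> R).
Hypothesis msg : measurable_fun setT sg.
Hypothesis sgK : involutive sg.
Hypothesis sg_mu : forall B, measurable B -> mu (sg @^-1` B) = mu B.
Hypothesis m_e : measurable_fun setT e.
Hypothesis e_sg : forall x, e (sg x) = - e x.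
Hypothesis e_fix : forall x, e x = 0 -> sg x = x.
Hypothesis k_sg : forall x y, k (sg x) (sg y) = k x y.
Hypothesis k_strict : forall x y, x <> y -> 0 < e x * e y -> k (sg x) y < k x y.
Hypothesis sgOm : forall x, Om x -> Om (sg x).

Lemma measurable_down_set : measurable J.
Proof.
apply: is_interval_measurable => x y Jx Jy z /andP[_ zy]; exact: Jdown Jy.
Qed.

(** Polarization turns the sublevel set of [u] into the one of [polarize u] for the
same [J], preserving its measure and the integral of the square over it.
Optimality of [A] then forbids the energy to decrease. *)
Lemma minimizer_rigid :
  {ae mu, forall x, 0 <= (u x - u (sg x)) * e x} \/
  {ae mu, forall x, (u x - u (sg x)) * e x <= 0}.
Proof.
have [m_u l2u gu u0] := au.
pose p := polarize sg e u.
have mp : measurable_fun setT p by exact: measurable_polarize.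
have [gp _] := energy_polarize mk k0 msg sgK sg_mu m_e e_sg e_fix k_sg k_strict m_u gu.
have mJ := measurable_down_set.
have pOm x : ~ Om x -> p x = 0.
  move=> Omx; have Omsx : ~ Om (sg x) by move=> /sgOm; rewrite sgK.
  by case: (polarize_pair sgK e_sg e_fix u x) => -[+ _]; rewrite -/p => ->; rewrite u0.
have sqrE (D : set T) : measurable D -> (forall x, D x -> D (sg x)) ->
    (\int[mu]_(x in D) (p x ^+ 2)%:E = \int[mu]_(x in D) (u x ^+ 2)%:E)%E.
  move=> mD sgD; apply: (integral_polarize msg sgK sg_mu e_sg e_fix mD sgD (Phi := fun t => t ^+ 2)) => //.
  - exact: measurable_funX.
  - exact: measurable_funX.
  - by move=> t; exact: sqr_ge0.
have l2p : l2 mu setT p by split => //; rewrite sqrE//; case: l2u.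
have ap : adm mu k Om p by [].
have ipp : ip mu setT p p = ip mu setT u u.
  by apply: EFin_inj; rewrite !ipE// sqrE.
pose lev (v : T -> R) := Om `&` [set x | J (v x)].
have mlev (v : T -> R) : measurable_fun setT v -> measurable (lev v).
  by move=> mv; apply: measurableI => //; exact: preimage_measurable mv mJ.
have indE v x : Om x -> \1_(lev v) x = \1_J (v x) :> R.
  move=> Omx; rewrite !indicE; congr (nat_of_bool _)%:R.
  by apply/idP/idP => /set_mem; [case=> _ Jx|move=> Jx]; apply/mem_set.
have levOm v : lev v `<=` Om by move=> x [].
have m1J (v : T -> R) : measurable_fun setT v -> measurable_fun setT (fun x => \1_J (v x) : R).
  have m1 : measurable_fun [set: R] (\1_J : R -> R) by exact: measurable_indic.
  by move=> mv; exact: (measurableT_comp m1 mv).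
have mulev (v : T -> R) : measurable_fun setT v ->
    mu (lev v) = (\int[mu]_(x in Om) (\1_J (v x))%:E)%E.
  move=> mv; rewrite -(setIidr (@levOm v)) setIC -integral_indic//; last exact: mlev.
  by apply: eq_integral => x /set_mem Omx; rewrite indE.
have levA : mu (lev u) = mu A.
  have -> : mu (lev u) = (\int[mu]_x (\1_(lev u) x)%:E)%E by rewrite integral_indic ?setIT//; exact: mlev.
  have -> : mu A = (\int[mu]_x (\1_A x)%:E)%E by rewrite integral_indic ?setIT.
  apply: ge0_ae_eq_integral => //; try (by move=> x _; rewrite lee_fin);
    try (by apply/measurable_EFinP; apply: measurable_indic => //; exact: mlev).
  apply: filterS AJ => x H _; rewrite !indicE; congr (_%:R%:E); congr nat_of_bool.
  by apply/idP/idP => /set_mem h; apply/mem_set; apply/H.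
have muW : mu (lev p) = mu A.
  rewrite -levA !mulev//.
  by apply: (integral_polarize msg sgK sg_mu e_sg e_fix mOm sgOm (Phi := fun t => \1_J t)) => //; exact: m1J.
have ipW : ip mu (lev p) p p = ip mu A u u.
  have [l2plev _] := l2S measurableT (mlev p mp) (@subsetT _ _) l2p.
  have [l2uA _] := l2S measurableT mA (@subsetT _ _) l2u.
  have lev_int (v : T -> R) : measurable_fun setT v ->
     (\int[mu]_(x in lev v) (v x ^+ 2)%:E = \int[mu]_(x in Om) (\1_J (v x) * v x ^+ 2)%:E)%E.
    move=> mv; rewrite integral_mkcond [RHS]integral_mkcond; apply: eq_integral => x _.
    rewrite !patchE; case: (boolP (x \in lev v)) => [/set_mem [Omx Jx]|nl].
      by rewrite mem_set// indicE mem_set// mul1r.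
    case: (boolP (x \in Om)) => // /set_mem Omx.
    by rewrite indicE memNset ?mul0r// => Jx; move/negP: nl; apply; apply/mem_set.
  apply: EFin_inj; rewrite !ipE//; last exact: mlev.
  rewrite lev_int//.
  have -> : (\int[mu]_(x in Om) (\1_J (p x) * p x ^+ 2)%:E =
             \int[mu]_(x in Om) (\1_J (u x) * u x ^+ 2)%:E)%E.
    apply: (integral_polarize msg sgK sg_mu e_sg e_fix mOm sgOm (Phi := fun t => \1_J t * t ^+ 2)) => //.
    - by apply: measurable_funM; [exact: m1J|exact: measurable_funX].
    - by apply: measurable_funM; [exact: m1J|exact: measurable_funX].
    - by move=> t; rewrite mulr_ge0 ?sqr_ge0.
  rewrite -(lev_int u m_u) [LHS]integral_mkcond [RHS]integral_mkcond.
  apply: ge0_ae_eq_integral => //;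
    try (by move=> x _; rewrite patchE; case: ifP => // _; rewrite lee_fin sqr_ge0).
  - by apply/(measurable_restrictT _ (mlev u m_u)).1; apply/measurable_EFinP; apply: measurable_funTS; exact: measurable_funX.
  - by apply/(measurable_restrictT _ mA).1; apply/measurable_EFinP; apply: measurable_funTS; exact: measurable_funX.
  - apply: filterS AJ => x H _; rewrite !patchE.
    suff -> : (x \in lev u) = (x \in A) by [].
    by apply/idP/idP => /set_mem h; apply/mem_set; apply/H.
have := minA (mlev p mp) (@levOm p) muW ap; rewrite ipp => minp.
have := le_trans Qu minp; rewrite /Qform ipW lerD2r ler_pM2l// => Eup.
exact: (polarize_rigid mk k0 msg sgK sg_mu m_e e_sg e_fix k_sg k_strict m_u gu Eup).
Qed.

End minimizer_polarization.

(** * Test functions and partitions *)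

Section lipschitz_functions.
Context d (T : measurableType d) (R : realType).
Variables (mu : {sigma_finite_measure set T -> \bar R}) (k dist : T -> T -> R).
Hypothesis mk : measurable_fun setT (fun z : T * T => k z.1 z.2).
Hypothesis k0 : forall x y, 0 <= k x y.
Hypothesis kC : forall x y, k x y = k y x.
Hypothesis mdist : measurable_fun setT (fun z : T * T => dist z.1 z.2).
Hypothesis distC : forall x y, dist x y = dist y x.
Variable KB : R.
Hypothesis KB0 : 0 <= KB.
Hypothesis kernel_mass : forall y,
  (\int[mu]_x (Num.min 1 (dist x y ^+ 2) * k x y)%:E <= KB%:E)%E.

(** The square of [psi x - psi y] is at most a constant times
[min (1, dist x y ^ 2)], and it vanishes unless [x] or [y] lies in [Om]. *)
Lemma lipschitz_adm (Om : set T) (psi : T -> R) (M L : R) :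
  measurable Om -> (mu Om < +oo)%E -> measurable_fun setT psi ->
  (forall x, `|psi x| <= M) -> (forall x, ~ Om x -> psi x = 0) ->
  (forall x y, `|psi x - psi y| <= L * dist x y) -> adm mu k Om psi.
Proof.
move=> mOm Omoo mpsi psiM psi0 psiL.
pose K := 4 * M ^+ 2 + L ^+ 2.
have K0 : 0 <= K by rewrite /K addr_ge0 ?sqr_ge0 // mulr_ge0 // sqr_ge0.
pose g (z : T * T) := Num.min 1 (dist z.1 z.2 ^+ 2) * k z.1 z.2.
have mg : measurable_fun setT g.
  by apply: measurable_funM => //; apply: measurable_minr => //; exact: measurable_funX.
have g0 z : 0 <= g z by rewrite mulr_ge0// le_min ler01 sqr_ge0.
have gC x y : g (x, y) = g (y, x) by rewrite /g /= (distC x y) (kC x y).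
pose h1 (z : T * T) := (\1_Om z.2 : R) * g z.
pose h2 (z : T * T) := (\1_Om z.1 : R) * g z.
have m1 : measurable_fun setT (fun z => (h1 z)%:E).
  apply/measurable_EFinP; apply: measurable_funM => //.
  by apply: measurableT_comp => //; exact: measurable_indic.
have m2 : measurable_fun setT (fun z => (h2 z)%:E).
  apply/measurable_EFinP; apply: measurable_funM => //.
  by apply: measurableT_comp => //; exact: measurable_indic.
have h10 z : (0 <= (h1 z)%:E)%E by rewrite lee_fin mulr_ge0.
have h20 z : (0 <= (h2 z)%:E)%E by rewrite lee_fin mulr_ge0.
have Omfin : mu Om \is a fin_num by rewrite ge0_fin_numE.
have bound : (\int[mu]_y ((\1_Om y : R)%:E * KB%:E) <= (fine (mu Om) * KB)%:E)%E.
  under eq_integral do rewrite muleC.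
  rewrite ge0_integralZl_EFin//; try (by apply/measurable_EFinP; exact: measurable_indic);
    try (by move=> x _; rewrite lee_fin).
  by rewrite integral_indic// setIT -[X in (_ * X <= _)%E]fineK// -EFinM mulrC.
have I1 : (\int[mu2 mu]_z (h1 z)%:E <= (fine (mu Om) * KB)%:E)%E.
  rewrite /mu2 (fubini_tonelli2 _ m1 h10); apply: le_trans bound.
  apply: ge0_le_integral => //.
  - by move=> y _; apply: integral_ge0 => x _; exact: h10.
  - exact: measurable_fun_fubini_tonelli_G.
  - by apply: emeasurable_funM => //; apply/measurable_EFinP; exact: measurable_indic.
  - move=> y _; rewrite /fubini_G /h1 /=.
    under eq_integral do rewrite EFinM.
    rewrite ge0_integralZl_EFin//.
    + by apply: lee_wpmul2l; rewrite ?lee_fin//; exact: (kernel_mass y).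
    + by move=> x _; rewrite lee_fin.
    + by apply/measurable_EFinP; exact: (measurableT_comp mg (measurable_pair2 y)).
have I2 : (\int[mu2 mu]_z (h2 z)%:E <= (fine (mu Om) * KB)%:E)%E.
  rewrite /mu2 (fubini_tonelli1 _ m2 h20); apply: le_trans bound.
  apply: ge0_le_integral => //.
  - by move=> y _; apply: integral_ge0 => x _; exact: h20.
  - exact: measurable_fun_fubini_tonelli_F.
  - by apply: emeasurable_funM => //; apply/measurable_EFinP; exact: measurable_indic.
  - move=> y _; rewrite /fubini_F /h2 /=.
    under eq_integral do rewrite EFinM gC.
    rewrite ge0_integralZl_EFin//.
    + by apply: lee_wpmul2l; rewrite ?lee_fin//; exact: (kernel_mass y).
    + by move=> x _; rewrite lee_fin.
    + by apply/measurable_EFinP; exact: (measurableT_comp mg (measurable_pair2 y)).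
have gl2 : l2 (mu2 mu) setT (grad k psi).
  split; first exact: measurable_grad.
  apply: (@le_lt_trans _ _ (K%:E * (\int[mu2 mu]_z (h1 z)%:E + \int[mu2 mu]_z (h2 z)%:E))%E); last first.
    rewrite lte_mul_pinfty ?lee_fin//.
    by apply: le_lt_trans (leeD I1 I2) _; rewrite -EFinD ltry.
  rewrite -ge0_integralD// -ge0_integralZl_EFin//; last 2 first.
  - by move=> z _; rewrite adde_ge0.
  - exact: emeasurable_funD.
  apply: ge0_le_integral => //.
  - by move=> z _; rewrite lee_fin sqr_ge0.
  - by apply/measurable_EFinP; apply: measurable_funX; exact: measurable_grad.
  - by apply: emeasurable_funM => //; exact: emeasurable_funD.
  move=> [x y] _; rewrite -EFinD -EFinM lee_fin sqr_grad//= /h1 /h2 /g /=.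
  rewrite -mulrDl mulrA mulrA ler_wpM2r//.
  have sq : (psi x - psi y) ^+ 2 <= K * Num.min 1 (dist x y ^+ 2).
    rewrite minEle; case: ifP => [|_].
      rewrite mulr1 => _; apply: (@le_trans _ _ (4 * M ^+ 2)); last by rewrite /K lerDl sqr_ge0.
      have := psiM x; have := psiM y; rewrite !ler_norml => /andP[a1 a2] /andP[b1 b2]; nra.
    apply: (@le_trans _ _ (L ^+ 2 * dist x y ^+ 2)); last first.
      by rewrite ler_wpM2r ?sqr_ge0// /K lerDr mulr_ge0// sqr_ge0.
    rewrite -exprMn -(real_normK (num_real (psi x - psi y))).
    rewrite -(real_normK (num_real (L * dist x y))) ler_sqr ?nnegrE//.
    exact: le_trans (psiL x y) (ler_norm _).
  have m01 : 0 <= Num.min 1 (dist x y ^+ 2) by rewrite le_min ler01 sqr_ge0.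
  rewrite !indicE; case: (boolP (y \in Om)) => [_|/negP yO]; case: (boolP (x \in Om)) => [_|/negP xO].
  - by rewrite (_ : true%:R + true%:R = 2 :> R)//; have := mulr_ge0 K0 m01; nra.
  - by rewrite addr0 mulr1.
  - by rewrite add0r mulr1.
  - rewrite !psi0; first by rewrite subrr expr0n/= addr0 mulr0 mul0r.
      by move=> h; apply: yO; exact: mem_set.
    by move=> h; apply: xO; exact: mem_set.
split => //; split => //.
apply: (@le_lt_trans _ _ (\int[mu]_x ((M ^+ 2)%:E * (\1_Om x : R)%:E))%E).
  apply: ge0_le_integral => //.
  - by move=> x _; rewrite lee_fin sqr_ge0.
  - by apply/measurable_EFinP; exact: measurable_funX.
  - by apply: emeasurable_funM => //; apply/measurable_EFinP; exact: measurable_indic.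
  move=> x _; rewrite -EFinM lee_fin indicE; case: (boolP (x \in Om)) => [_|/negP xO].
    rewrite mulr1 -(real_normK (num_real (psi x))) ler_sqr ?nnegrE//.
    exact: le_trans (normr_ge0 _) (psiM x).
  by rewrite psi0 ?expr0n/= ?mulr0// => h; apply: xO; exact: mem_set.
rewrite ge0_integralZl_EFin ?sqr_ge0//; try (by move=> x _; rewrite lee_fin);
  try (by apply/measurable_EFinP; exact: measurable_indic).
by rewrite integral_indic// setIT lte_mul_pinfty// lee_fin sqr_ge0.
Qed.

End lipschitz_functions.

Section euclid_instance.
Context (R : realType) (n : nat) (s : R).
Local Notation N := n.+1.
Local Notation T := (euclid R N).
Local Notation mu := (@lebesgueN R N).
Local Notation k := (@kern R N s).
Hypothesis s01 : 0 < s < 1.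
Let p : R := N%:R + 2 * s.
Let p0 : 0 < p.
Proof. by case/andP: s01 => s0 _; rewrite /p ltr_wpDl// mulr_gt0. Qed.

Lemma measurable_kern2 : measurable_fun setT (fun z : T * T => k z.1 z.2).
Proof. apply: measurable_kern; [exact: measurable_fst|exact: measurable_snd]. Qed.

Lemma measurable_edist2 : measurable_fun setT (fun z : T * T => edist z.1 z.2).
Proof. apply: measurable_edist; [exact: measurable_fst|exact: measurable_snd]. Qed.

Lemma kern_anti (x y x' y' : T) : x <> y -> edist x y < edist x' y' -> k x' y' < k x y.
Proof.
move=> xy d; have d0 : 0 < edist x y.
  by rewrite lt_neqAle edist_ge0 andbT; apply/eqP => /esym/edist_eq0.
rewrite /kern -/p ltf_pV2 ?posrE ?powR_gt0//; last exact: lt_trans d.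
by rewrite gt0_ltr_powR ?nnegrE ?edist_ge0.
Qed.

Lemma kern_ge_of_edist (x y : T) h : x <> y -> edist x y <= h -> (h `^ p)^-1 <= k x y.
Proof.
move=> xy d; have d0 : 0 < edist x y.
  by rewrite lt_neqAle edist_ge0 andbT; apply/eqP => /esym/edist_eq0.
have h0 : 0 < h by apply: lt_le_trans d.
rewrite /kern -/p lef_pV2 ?posrE ?powR_gt0//.
by rewrite ge0_ler_powR ?nnegrE ?edist_ge0 ?(ltW h0) ?(ltW p0).
Qed.

Lemma kern_reflection (e x y : T) : edot e e = 1 ->
  k (reflection e x) (reflection e y) = k x y.
Proof. by move=> e1; rewrite /kern edist_reflection. Qed.

Lemma kern_reflection_lt (e x y : T) : edot e e = 1 -> x <> y ->
  0 < edot x e * edot y e -> k (reflection e x) y < k x y.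
Proof.
move=> e1 xy xe; apply: kern_anti => //.
rewrite -ltr_sqr ?nnegrE ?edist_ge0// edist_reflection_sqr// ltrDl -mulrA.
by rewrite mulr_gt0.
Qed.

Section bounded_set.
Variables (Om : set T) (rho : R).
Hypothesis rho0 : 0 < rho.
Hypothesis Om_ball : forall x, Om x -> edist x origin < rho.

(** For cubes of side [h], [m * kap = h ^ N / (N h) ^ p] is
[N ^ - p * h ^ (- 2 s)], since [p = N + 2 s]. *)
Lemma fine_cells_bounded : fine_cells mu k Om.
Proof.
move=> eta eta0; case/andP: s01 => s0 _.
have N0 : 0 < N%:R :> R by rewrite ltr0n.
(* The largest side for which the required inequality holds. *)
pose h0 : R := (eta / N%:R `^ p) `^ (2 * s)^-1.
have h00 : 0 < h0 by rewrite powR_gt0// divr_gt0// powR_gt0.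
pose K := (Num.truncn (2 * rho / h0)).+1.
have K0 : 0 < K%:R :> R by rewrite ltr0n.
pose h := 2 * rho / K%:R.
have hpos : 0 < h by rewrite divr_gt0// mulr_gt0.
have hh0 : h <= h0.
  have : 2 * rho / h0 < K%:R by exact: truncnS_gt.
  by rewrite ltr_pdivrMr// => lt_K; rewrite /h ler_pdivrMr// (mulrC h0); exact: ltW.
have Kh : K%:R * h = 2 * rho by rewrite /h mulrC divfK// gt_eqF.
pose a (i : {ffun 'I_N -> 'I_K}) : T := [tuple - rho + (i j)%:R * h | j < N].
have idx i x : tbox (a i) h x -> forall j, Num.truncn ((tnth x j + rho) / h) = i j.
  move=> ix j; have := ix j; rewrite tnth_mktuple => /andP[x1 x2].
  apply/truncn_def; rewrite ler_pdivlMr// ltr_pdivrMr// -natr1 mulrDl mul1r.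
  by apply/andP; split; lra.
exists {ffun 'I_N -> 'I_K}, (fun i => tbox (a i) h : set T), (h ^+ N), ((N%:R * h) `^ p)^-1.
split; first split.
- by move=> i; exact: measurable_tboxN.
- move=> i j x /idx ix /idx jx; apply/ffunP => l; apply/val_inj => /=.
  by rewrite -ix -jx.
- by move=> i; apply: lebesgueN_tbox; exact: ltW.
- by rewrite exprn_gt0.
- by rewrite invr_ge0 powR_ge0.
- by move=> i x y ix iy xy; apply: kern_ge_of_edist => //; exact: tbox_edist ix iy.
- move=> x Omx.
  have bnd j : - rho < tnth x j < rho.
    rewrite -ltr_norml; apply: le_lt_trans (Om_ball Omx).
    by have := coord_le_edist x origin j; rewrite tnth_mktuple subr0.
  have pos j : 0 <= (tnth x j + rho) / h.
    by rewrite divr_ge0 ?(ltW hpos)//; have /andP[] := bnd j; lra.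
  have ltK j : (Num.truncn ((tnth x j + rho) / h) < K)%N.
    rewrite -(ltr_nat R); have /andP[l1 _] := truncn_itv (pos j).
    apply: le_lt_trans l1 _; rewrite ltr_pdivrMr// Kh.
    by have /andP[] := bnd j; lra.
  exists [ffun j => Ordinal (ltK j)] => j; rewrite tnth_mktuple ffunE /=.
  move: (truncn_itv (pos j)); set q := Num.truncn _.
  rewrite ler_pdivlMr// ltr_pdivrMr// -natr1 mulrDl mul1r => /andP[q1 q2].
  by apply/andP; split; lra.
rewrite powRM ?(ltW hpos)//.
have -> : h `^ p = h ^+ N * h `^ (2 * s).
  by rewrite /p powRD ?powR_mulrn ?(ltW hpos)//; apply/implyP => _; rewrite gt_eqF.
have hs : h `^ (2 * s) <= eta / N%:R `^ p.
  have -> : eta / N%:R `^ p = h0 `^ (2 * s).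
    rewrite /h0 -powRrM mulVf ?powRr1 ?gt_eqF ?mulr_gt0// ltW// divr_gt0// powR_gt0//.
  by rewrite ge0_ler_powR ?nnegrE ?(ltW hpos) ?(ltW h00)// mulr_ge0// ltW.
have Np : 0 < N%:R `^ p :> R by rewrite powR_gt0.
have hsp : 0 < h `^ (2 * s) by rewrite powR_gt0.
rewrite (_ : eta * _ = eta / N%:R `^ p / h `^ (2 * s)); last first.
  by field; rewrite !gt_eqF// exprn_gt0.
by rewrite ler_pdivlMr// mul1r.
Qed.

Hypothesis mOm : measurable Om.

Lemma bounded_lty : (mu Om < +oo)%E.
Proof. by apply: (mu_bounded_lty (y := origin) (h := rho)) => //. Qed.

Lemma bounded_lipschitz_adm (psi : T -> R) (M L : R) :
  measurable_fun setT psi ->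
  (forall x, `|psi x| <= M) -> (forall x, ~ Om x -> psi x = 0) ->
  (forall x y, `|psi x - psi y| <= L * edist x y) -> adm mu k Om psi.
Proof.
have KB0 : 0 <= kernel_bound N s.
  rewrite -lee_fin; apply: le_trans (integral_min_kern origin s01).
  by apply: integral_ge0 => x _; rewrite lee_fin mulr_ge0 ?kern_ge0// le_min ler01 sqr_ge0.
have H := lipschitz_adm measurable_kern2 (@kern_ge0 R N s) (@kernC R N s) measurable_edist2
  (@edistC R N) KB0 _ mOm bounded_lty.
by apply: H => y; exact: integral_min_kern.
Qed.

End bounded_set.

Definition tent (r rho : R) (x : T) : R :=
  Num.max 0 (Num.min (enorm x - r) (rho - enorm x)).

Lemma min_lip (a b c d : R) (e : R) : `|a - c| <= e -> `|b - d| <= e ->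
  `|Num.min a b - Num.min c d| <= e.
Proof.
rewrite !ler_norml => /andP[? ?] /andP[? ?].
by case: (leP a b) => ?; case: (leP c d) => ?; apply/andP; split; lra.
Qed.

Lemma measurable_enorm : measurable_fun setT (@enorm R N).
Proof.
have -> : @enorm R N = (fun x => edist x origin) by apply/funext => x; rewrite enorm_edist.
exact: measurable_edistl.
Qed.

Lemma measurable_tent r rho : measurable_fun setT (tent r rho).
Proof.
apply: measurable_maxr; first exact: measurable_cst.
apply: measurable_minr; apply: measurable_funB;
  [exact: measurable_enorm|exact: measurable_cst|exact: measurable_cst|exact: measurable_enorm].
Qed.

Lemma tent_lip r rho x y : `|tent r rho x - tent r rho y| <= edist x y.
Proof.
apply: le_trans (max0_lip _ _) _; apply: min_lip.
  by rewrite (_ : _ - _ = enorm x - enorm y) ?enorm_lip//; ring.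
by rewrite (_ : _ - _ = enorm y - enorm x) ?(edistC x y) ?enorm_lip//; ring.
Qed.

Lemma enorm_ge0 (x : T) : 0 <= enorm x. Proof. exact: sqrtr_ge0. Qed.

Lemma tent_ge0 r rho x : 0 <= tent r rho x.
Proof. by rewrite le_max lexx. Qed.

Lemma tent_le r rho x : 0 < rho -> tent r rho x <= rho.
Proof.
move=> rho0; rewrite ge_max (ltW rho0)/= ge_min; apply/orP; right.
by rewrite gerBl enorm_ge0.
Qed.

Lemma annulusE r rho (x : T) : annulus r rho x <-> r < enorm x < rho.
Proof.
rewrite enorm_edist; split.
  by move=> [x1 /negP]; rewrite -ltNge => x2; apply/andP; split.
by move=> /andP[x1 x2]; split => //; apply/negP; rewrite -ltNge.
Qed.

Lemma tent_pos r rho x : annulus r rho x -> 0 < tent r rho x.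
Proof.
by move=> /annulusE/andP[x1 x2]; rewrite lt_max lt_min !subr_gt0 x1 x2 orbT.
Qed.

Lemma tent_out r rho x : ~ annulus r rho x -> tent r rho x = 0.
Proof.
move=> nx; apply/max_l; rewrite leNgt; apply/negP; rewrite lt_min !subr_gt0 => h.
by apply: nx; apply/annulusE.
Qed.

Lemma measurable_annulus r rho : measurable (annulus r rho : set T).
Proof.
apply: measurableD; first exact: measurable_ball_edist.
exact: measurable_le_cst (measurable_edistl origin) r.
Qed.

Definition ramp (t : R) (x : T) : R := Num.min 1 (Num.max 0 (thead x - t)).

Lemma measurable_ramp t : measurable_fun setT (ramp t).
Proof.
apply: measurable_minr; first exact: measurable_cst.
apply: measurable_maxr; first exact: measurable_cst.
apply: measurable_funB; [exact: measurable_coord|exact: measurable_cst].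
Qed.

Lemma ramp_lip t x y : `|ramp t x - ramp t y| <= edist x y.
Proof.
apply: min_lip; first by rewrite subrr normr0 edist_ge0.
apply: le_trans (max0_lip _ _) _.
by rewrite (_ : _ - _ = tnth x ord0 - tnth y ord0) ?coord_le_edist// /thead; ring.
Qed.

Lemma ramp01 t x : 0 <= ramp t x <= 1.
Proof. by rewrite /ramp le_min ler01 le_max lexx ge_min lexx. Qed.

Lemma ramp_pos t x : t < thead x -> 0 < ramp t x.
Proof. by move=> tx; rewrite /ramp lt_min ltr01 lt_max subr_gt0 tx orbT. Qed.

Lemma ramp_zero t x : thead x <= t -> ramp t x = 0.
Proof. by move=> tx; rewrite /ramp (max_l (y := thead x - t)) ?subr_le0// min_r. Qed.

Section annulus_functions.
Variables (r rho : R).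
Hypothesis r0 : 0 < r.
Hypothesis rrho : r < rho.
Local Notation Om := (annulus r rho : set T).
Let rho0 : 0 < rho. Proof. exact: lt_trans rrho. Qed.

Lemma annulus_ball x : Om x -> edist x origin < rho.
Proof. by move=> []. Qed.

Lemma annulus_lty : (mu Om < +oo)%E.
Proof. exact: bounded_lty annulus_ball (measurable_annulus r rho). Qed.

Lemma tent_ramp_adm t : adm mu k Om (fun x => tent r rho x * ramp t x).
Proof.
apply: (bounded_lipschitz_adm annulus_ball (measurable_annulus r rho) (M := rho) (L := 1 + rho)).
- apply: measurable_funM; [exact: measurable_tent|exact: measurable_ramp].
- move=> x; have := tent_ge0 r rho x; have := tent_le r x rho0; have /andP[] := ramp01 t x.
  by move=> a1 a2 a3 a4; rewrite ger0_norm ?mulr_ge0//; nra.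
- by move=> x nx; rewrite tent_out// mul0r.
- move=> x y; have T1 := tent_lip r rho x y; have T2 := ramp_lip t x y.
  have := tent_ge0 r rho x; have := tent_le r x rho0; have /andP[] := ramp01 t y.
  move: T1 T2; rewrite !ler_norml => /andP[a1 a2] /andP[b1 b2] c1 c2 c3 c4.
  have d0 := edist_ge0 x y.
  have -> : tent r rho x * ramp t x - tent r rho y * ramp t y =
    tent r rho x * (ramp t x - ramp t y) + ramp t y * (tent r rho x - tent r rho y) by ring.
  move: (tent r rho x) (tent r rho y) (ramp t x) (ramp t y) (edist x y) a1 a2 b1 b2 c1 c2 c3 c4 d0.
  by move=> tx ty rx ry d *; apply/andP; split; nra.
Qed.

Lemma tent_adm : adm mu k Om (tent r rho).
Proof.
apply: (bounded_lipschitz_adm annulus_ball (measurable_annulus r rho) (M := rho) (L := 1)).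
- exact: measurable_tent.
- by move=> x; rewrite ger0_norm ?tent_ge0// tent_le.
- by move=> x; exact: tent_out.
- by move=> x y; rewrite mul1r tent_lip.
Qed.

End annulus_functions.
End euclid_instance.

(** * Separating two sets by a hyperplane *)

Section separation.
Context (R : realType) (n : nat) (s : R).
Local Notation N := n.+1.
Local Notation T := (euclid R N).
Local Notation mu := (@lebesgueN R N).
Local Notation k := (@kern R N s).
Hypothesis s01 : 0 < s < 1.

Lemma subset_of_measure (E : set T) (m : R) : measurable E -> (mu E < +oo)%E ->
  0 < m -> (m%:E < mu E)%E -> exists F, [/\ measurable F, F `<=` E & mu F = m%:E].
Proof.
move=> mE Eoo m0 mEm; have [t tE] := measure_slice mE Eoo m0 mEm.
exists (E `&` [set x | thead x <= t]); split; [|by move=> x []|exact: tE].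
by apply: measurableI => //; exact: measurable_thead_le.
Qed.

Lemma subsets_of_equal_measure (X Y : set T) : measurable X -> measurable Y ->
  (mu X < +oo)%E -> (mu Y < +oo)%E -> mu X != 0%E -> mu Y != 0%E ->
  exists A B, [/\ measurable A, measurable B, A `<=` X, B `<=` Y &
    mu A = mu B /\ mu A != 0%E].
Proof.
move=> mX mY Xoo Yoo X0 Y0.
have pos (Z : set T) : (mu Z < +oo)%E -> mu Z != 0%E -> 0 < fine (mu Z).
  by move=> Zoo Z0; apply: fine_gt0; rewrite Zoo lt0e Z0 measure_ge0.
have x0 := pos _ Xoo X0; have y0 := pos _ Yoo Y0.
pose m := Num.min (fine (mu X)) (fine (mu Y)) / 2.
have m0 : 0 < m by rewrite divr_gt0// lt_min x0 y0.
have mX' : (m%:E < mu X)%E.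
  rewrite -[ltRHS]fineK ?ge0_fin_numE// lte_fin.
  have : Num.min (fine (mu X)) (fine (mu Y)) <= fine (mu X) by rewrite ge_min lexx.
  by rewrite /m; move: x0; lra.
have mY' : (m%:E < mu Y)%E.
  rewrite -[ltRHS]fineK ?ge0_fin_numE// lte_fin.
  have : Num.min (fine (mu X)) (fine (mu Y)) <= fine (mu Y) by rewrite ge_min lexx orbT.
  by rewrite /m; move: y0; lra.
have [A [mA AX Am]] := subset_of_measure mX Xoo m0 mX'.
have [B [mB BY Bm]] := subset_of_measure mY Yoo m0 mY'.
by exists A, B; split => //; rewrite Am Bm; split => //; rewrite eqe gt_eqF.
Qed.

(** Cut along the hyperplane of the first coordinate that halves [S1]: some side
contains a part of [S2] of positive measure, and the other side half of [S1]. *)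
Lemma annulus_separate (r rho : R) (S1 S2 : set T) : 0 < r -> r < rho ->
  let Om := annulus r rho in
  measurable S1 -> measurable S2 -> S1 `<=` Om -> S2 `<=` Om ->
  mu S1 != 0%E -> mu S2 != 0%E ->
  exists A1 B1 phi, [/\ measurable A1, measurable B1, A1 `<=` S1, B1 `<=` S2 &
    [/\ mu A1 = mu B1, mu A1 != 0%E, adm mu k Om phi, forall x, 0 <= phi x &
      ((forall x, A1 x -> phi x = 0) /\ (forall x, B1 x -> 0 < phi x)) \/
      ((forall x, B1 x -> phi x = 0) /\ (forall x, A1 x -> 0 < phi x))]].
Proof.
move=> r0 rrho Om m1 m2 S1O S2O S10 S20.
have mOm : measurable Om := measurable_annulus r rho.
have fin (Z : set T) : measurable Z -> Z `<=` Om -> (mu Z < +oo)%E.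
  move=> mZ ZO; apply: (le_lt_trans _ (annulus_lty n r rho)).
  by apply: le_measure; rewrite ?inE.
have S1fin := fin _ m1 S1O.
have s10 : 0 < fine (mu S1) by apply: fine_gt0; rewrite S1fin lt0e S10 measure_ge0.
have h0 : 0 < fine (mu S1) / 2 by rewrite divr_gt0.
have hS : ((fine (mu S1) / 2)%:E < mu S1)%E.
  by rewrite -[ltRHS]fineK ?ge0_fin_numE// lte_fin; move: s10; lra.
have [t tS] := measure_slice m1 S1fin h0 hS.
pose L := [set x : T | thead x <= t]; have mL : measurable L := measurable_thead_le t.
pose phi (x : T) := tent r rho x * ramp t x.
have aphi : adm mu k Om phi by exact: tent_ramp_adm.
have phi0 x : 0 <= phi x.
  by rewrite mulr_ge0 ?tent_ge0//; have /andP[] := ramp01 t x.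
have phiL x : L x -> phi x = 0 by move=> Lx; rewrite /phi ramp_zero ?mulr0.
have phiR x : Om x -> ~ L x -> 0 < phi x.
  move=> Omx /negP; rewrite -ltNge => tx; apply: mulr_gt0; first exact: tent_pos.
  exact: ramp_pos.
have mI (Z : set T) : measurable Z -> measurable (Z `&` L) by move=> mZ; exact: measurableI.
have mDf (Z : set T) : measurable Z -> measurable (Z `\` L) by move=> mZ; exact: measurableD.
have S1L : mu (S1 `&` L) != 0%E by rewrite tS eqe gt_eqF.
have split (Z : set T) : measurable Z -> mu Z = (mu (Z `\` L) + mu (Z `&` L))%E.
  by move=> mZ; rewrite -(measureDI mu mZ mL).
have S1R : mu (S1 `\` L) != 0%E.
  apply/eqP => z; have := split _ m1; rewrite z add0e tS => e.
  by move: hS; rewrite -e ltxx.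
have [S2R|S2R] := eqVneq (mu (S2 `\` L)) 0%E.
- have S2L : mu (S2 `&` L) != 0%E by move: S20; rewrite split// S2R add0e.
  have [A [B [mA mB AS BS [AB A0]]]] := subsets_of_equal_measure (mDf _ m1) (mI _ m2)
    (fin _ (mDf _ m1) (fun x h => S1O x h.1)) (fin _ (mI _ m2) (fun x h => S2O x h.1)) S1R S2L.
  exists A, B, phi; split => //; first by move=> x /AS[].
    by move=> x /BS[].
  split => //; right; split=> x; first by move=> /BS[_ /phiL].
  by move=> /AS[/S1O xO]; exact: phiR.
- have [A [B [mA mB AS BS [AB A0]]]] := subsets_of_equal_measure (mI _ m1) (mDf _ m2)
    (fin _ (mI _ m1) (fun x h => S1O x h.1)) (fin _ (mDf _ m2) (fun x h => S2O x h.1)) S1L S2R.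
  exists A, B, phi; split => //; first by move=> x /AS[].
    by move=> x /BS[].
  split => //; left; split=> x; first by move=> /AS[_ /phiL].
  by move=> /BS[/S2O xO]; exact: phiR.
Qed.
End separation.

(** * Two-valued weights and Rayleigh quotients *)

Section two_valued_weights.
Context d (T : measurableType d) (R : realType).
Variables (mu : {measure set T -> \bar R}) (Om : set T).
Hypothesis mOm : measurable Om.
Hypothesis Omoo : (mu Om < +oo)%E.
Implicit Types (V : T -> R) (E D : set T) (a b t alpha : R).

Lemma level_indic alpha E t : 0 < alpha -> E `<=` Om ->
  mu (Om `&` [set x | t < alpha * \1_E x]) =
  if t < 0 then mu Om else if t < alpha then mu E else 0%E.
Proof.
move=> alpha0 EO; case: ltP => t0.
  congr (mu _); apply/seteqP; split => x /=; [by case|move=> Omx; split => //].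
  by apply: (lt_le_trans t0); rewrite mulr_ge0 ?(ltW alpha0)// indicE.
case: ltP => ta.
  congr (mu _); apply/seteqP; split => x /=; rewrite indicE.
    move=> [_]; case: (boolP (x \in E)) => [/set_mem//|_].
    by rewrite mulr0 ltNge t0.
  by move=> Ex; split; [exact: EO|rewrite mem_set// mulr1].
rewrite -(measure0 mu); congr (mu _); apply/seteqP; split => x //= [_].
rewrite indicE; case: (x \in E); rewrite ?mulr1 ?mulr0 => h.
  by have := le_lt_trans ta h; rewrite ltxx.
by have := le_lt_trans t0 h; rewrite ltxx.
Qed.

(** The sets where [V] exceeds [a] and [t] are nested and have the same finite
measure for [t] between [a] and [b]; let [t] tend to [b]. *)
Lemma level_gap V a b (m : \bar R) : measurable_fun Om V ->
  (forall t, a <= t < b -> mu (Om `&` [set x | t < V x]) = m) ->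
  {ae mu, forall x, Om x -> ~ a < V x < b}.
Proof.
move=> mV level.
pose E t := Om `&` [set x | t < V x].
have mE t : measurable (E t).
  rewrite (_ : E t = Om `&` V @^-1` `]t, +oo[); first exact: mV.
  by apply/seteqP; split => x [Omx] /=; rewrite in_itv/= andbT.
pose t_ n := b - (b - a) / n.+1%:R.
have [ab|ba] := ltP a b; last first.
  by apply: aeW => x _ /andP[h1 h2]; have := lt_trans h1 h2; rewrite ltNge ba.
have t_ab n : a <= t_ n < b.
  have n0 : 0 < n.+1%:R :> R by [].
  have n1 : 1 <= n.+1%:R :> R by rewrite ler1n.
  rewrite /t_ ltrBlDr ltrDl divr_gt0 ?subr_gt0// andbT lerBrDr -lerBrDl ler_pdivrMr//.
  by rewrite ler_peMr// subr_ge0 ltW.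
have null n : mu.-negligible (E a `\` E (t_ n)).
  have mD : measurable (E a `\` E (t_ n)) by exact: measurableD.
  exists (E a `\` E (t_ n)); split => //.
  have Em t : a <= t < b -> mu (E t) = m by exact: level.
  have fin : mu (E a) \is a fin_num.
    rewrite ge0_fin_numE//; apply: le_lt_trans Omoo.
    by apply: le_measure; rewrite ?inE// => x [].
  have sub : E (t_ n) `<=` E a.
    move=> x [Omx tx]; split => //; apply: le_lt_trans tx.
    by have /andP[] := t_ab n.
  have -> : mu (E a `\` E (t_ n)) = (mu (E a) - mu (E a `&` E (t_ n)))%E.
    by apply: measureD => //; rewrite -ge0_fin_numE.
  rewrite (setIidr sub) (_ : mu (E (t_ n)) = mu (E a)) ?subee//.
  by rewrite !Em// lexx.
rewrite /almost_everywhere.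
apply: negligibleS (negligible_bigcup null) => x /= /not_implyP[Omx /notP /andP[aV Vb]].
have Vb0 : 0 < b - V x by rewrite subr_gt0.
exists (Num.truncn ((b - a) / (b - V x))) => //.
split; first by split.
move=> [_]; apply/negP; rewrite -leNgt /t_.
set n := Num.truncn _.
have h : (b - a) / (b - V x) < n.+1%:R by exact: truncnS_gt.
have n0 : 0 < n.+1%:R :> R by [].
have : (b - a) / n.+1%:R < b - V x.
  by rewrite ltr_pdivrMr// mulrC -ltr_pdivrMr.
rewrite -/n; move: (_ / _) => w; lra.
Qed.

(** The distribution function of the weight is locally constant outside of 0 and
[alpha], so these are the only values of [V] up to a null set. *)
Lemma rearrangement_indic V alpha D : 0 < alpha -> D `<=` Om ->
  measurable_fun Om V ->
  (forall t, mu (Om `&` [set x | t < V x]) = mu (Om `&` [set x | t < alpha * \1_D x])) ->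
  exists A, [/\ measurable A, A `<=` Om, mu A = mu D &
    {ae mu, forall x, Om x -> V x = alpha * \1_A x}].
Proof.
move=> alpha0 DO mV VD.
have lev t : mu (Om `&` [set x | t < V x]) =
    if t < 0 then mu Om else if t < alpha then mu D else 0%E.
  by rewrite VD level_indic.
have mE t : measurable (Om `&` [set x | t < V x]).
  rewrite (_ : _ `&` _ = Om `&` V @^-1` `]t, +oo[); first exact: mV.
  by apply/seteqP; split => x [Omx] /=; rewrite in_itv/= andbT.
pose A := Om `&` [set x | 0 < V x].
exists A; split; [exact: mE|by move=> x []|by rewrite /A lev ltxx alpha0|].
(* The value -1 only serves to have a bounded gap below 0; V exceeds it almost everywhere by g4. *)
have g1 : {ae mu, forall x, Om x -> ~ -1 < V x < 0}.
  by apply: (@level_gap V (-1) 0 (mu Om)) => // t /andP[_ t0]; rewrite lev t0.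
have g2 : {ae mu, forall x, Om x -> ~ 0 < V x < alpha}.
  by apply: (@level_gap V 0 alpha (mu D)) => // t /andP[t0 ta]; rewrite lev ltNge t0 ta.
have g3 : {ae mu, forall x, Om x -> V x <= alpha}.
  exists (Om `&` [set x | alpha < V x]); split => //.
    by rewrite lev ltxx ltNge (ltW alpha0).
  by move=> x /= /not_implyP[Omx /negP]; rewrite -ltNge.
have g4 : {ae mu, forall x, Om x -> -1 < V x}.
  exists (Om `\` (Om `&` [set x | -1 < V x])); split.
  - exact: measurableD.
  - have -> : mu (Om `\` (Om `&` [set x | -1 < V x])) =
        (mu Om - mu (Om `&` (Om `&` [set x | (-1 < V x)%R])))%E.
      by apply: measureD => //; exact: mE.
    by rewrite setIA setIid lev ltrN10 subee// ge0_fin_numE.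
  - by move=> x /= /not_implyP[Omx nV]; split => // -[].
apply: filterS2 (filterI g1 g2) (filterI g3 g4) => x [h1 h2] [h3 h4] Omx.
have {h1} h1 := h1 Omx; have {h2} h2 := h2 Omx; have {h3} h3 := h3 Omx; have {h4} h4 := h4 Omx.
rewrite indicE; case: (boolP (x \in A)) => [/set_mem [_ /= V0]|/negP xA].
  rewrite mulr1; apply/eqP; rewrite eq_le h3/= leNgt; apply/negP => Va.
  by apply: h2; rewrite V0.
rewrite mulr0; apply/eqP; rewrite eq_le; apply/andP; split.
  by rewrite leNgt; apply/negP => V0; apply: xA; apply/mem_set.
by rewrite leNgt; apply/negP => V0; apply: h1; rewrite h4.
Qed.

End two_valued_weights.

Section square_integrable_classes.
Context d (T : measurableType d) (R : realType).
Variables (mu : {sigma_finite_measure set T -> \bar R}) (k : T -> T -> R).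
Hypothesis mk : measurable_fun setT (fun z : T * T => k z.1 z.2).
Hypothesis k0 : forall x y, 0 <= k x y.
Variable Om : set T.
Hypothesis mOm : measurable Om.
Implicit Types f v : T -> R.

Lemma sqr_poweR_half (x : \bar R) : (0 <= x)%E -> ((x `^ 2^-1) ^+ 2)%E = x.
Proof.
case: x => [x| |]//.
  by rewrite lee_fin => x0; rewrite poweR_EFin -EFin_expe powR12_sqrt// sqr_sqrtr.
by move=> _; rewrite poweRyr// invr_neq0.
Qed.

Lemma Lfun2P f : f \in Lfun mu 2%:E <-> measurable_fun setT f /\ l2 mu setT f.
Proof.
have NE : (\int[mu]_x `|(EFin \o f) x| `^ 2 = \int[mu]_x (f x ^+ 2)%:E)%E.
  apply: eq_integral => x _; rewrite [`|(EFin \o f) x|%E](_ : _ = `|f x|%:E)//.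
  by rewrite poweR_EFin powR_mulrn// real_normK ?num_real.
split=> [l2f|[mf [_ f2]]].
  have mf : measurable_fun setT f.
    by move: l2f; rewrite inE => /andP[+ _]; rewrite inE.
  split => //; split => //.
  have /integrableP[_] := Lfun2_integrable_sqr l2f.
  by under eq_integral do rewrite gee0_abs ?lee_fin ?sqr_ge0//.
rewrite inE; apply/andP; split; rewrite inE//.
by rewrite /finite_norm unlock; apply: poweR_lty; move: f2; rewrite -NE.
Qed.

Let seminorm f : \bar R :=
  ((\int[mu]_y \int[mu]_x (`|f x - f y| ^+ 2 * k x y)%:E) `^ 2^-1)%E.

Let doubleE f : (\int[mu]_y \int[mu]_x (`|f x - f y| ^+ 2 * k x y)%:E =
  \int[mu]_y \int[mu]_x ((f x - f y) ^+ 2 * k x y)%:E)%E.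
Proof.
apply: eq_integral => y _; apply: eq_integral => x _.
by rewrite real_normK ?num_real.
Qed.

Let seminormE f : measurable_fun setT f ->
  (seminorm f ^+ 2)%E = (\int[mu2 mu]_z (grad k f z ^+ 2)%:E)%E.
Proof.
move=> mf; rewrite sqr_poweR_half; last first.
  apply: integral_ge0 => y _; apply: integral_ge0 => x _.
  by rewrite lee_fin mulr_ge0 ?sqr_ge0.
by rewrite (energyE mu mk k0 mf) doubleE.
Qed.

(** Set [f] to 0 outside [Om]. *)
Lemma adm_representative f : f \in Lfun mu 2%:E -> (seminorm f < +oo)%E ->
  {ae mu, forall x, ~ Om x -> f x = 0} ->
  exists v, [/\ adm mu k Om v, {ae mu, forall x, f x = v x} &
    (seminorm f ^+ 2)%E = (energy mu k v)%:E].
Proof.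
move=> /Lfun2P[mf [_ f2]] foo f0.
pose v x := f x * \1_Om x.
have mv : measurable_fun setT v.
  by apply: measurable_funM => //; exact: measurable_indic.
have fv : {ae mu, forall x, f x = v x}.
  apply: filterS f0 => x fx; rewrite /v indicE.
  by case: (boolP (x \in Om)) => [_|/negP xO]; rewrite ?mulr1// fx ?mulr0// => /mem_set.
have gv : l2 (mu2 mu) setT (grad k v).
  split; first exact: (measurable_grad mk mv).
  rewrite -(grad_ae mk mf mv fv) -(seminormE mf).
  move: foo; have : (0 <= seminorm f)%E by exact: poweR_ge0.
  by case: (seminorm f) => // x _ _; rewrite -EFin_expe ltry.
exists v; split => //.
  split => //; last by move=> x xO; rewrite /v indicE memNset// mulr0.
  by split => //; rewrite -(sqr_ae measurableT mf mv fv).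
by rewrite (seminormE mf) (grad_ae mk mf mv fv) /energy (ipE measurableT gv).
Qed.

Lemma adm_seminorm v : adm mu k Om v ->
  [/\ v \in Lfun mu 2%:E, (seminorm v < +oo)%E,
    {ae mu, forall x, ~ Om x -> v x = 0} & (seminorm v ^+ 2)%E = (energy mu k v)%:E].
Proof.
move=> [mv l2v gv v0]; split.
- by apply/Lfun2P.
- apply: poweR_lty; move: gv => [_]; rewrite (energyE mu mk k0 mv).
  by rewrite doubleE.
- by apply: aeW => x; exact: v0.
- by rewrite (seminormE mv) /energy (ipE measurableT gv).
Qed.

Lemma weighted_sqnorm_ip (V f v : T -> R) alpha (A : set T) : measurable A -> A `<=` Om ->
  measurable_fun Om V -> {ae mu, forall x, Om x -> V x = alpha * \1_A x} ->
  measurable_fun setT f -> l2 mu setT v -> {ae mu, forall x, f x = v x} ->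
  (\int[mu]_(x in Om) (V x * `|f x| ^+ 2)%:E)%E = (alpha * ip mu A v v)%:E.
Proof.
move=> mA AO mV VA mf l2v fv; have [mv _] := l2v.
have l2A : l2 mu A v by have [] := l2S measurableT mA (@subsetT _ _) l2v.
transitivity (\int[mu]_(x in Om) (alpha%:E * (\1_A x * v x ^+ 2)%:E))%E.
  apply: ae_eq_integral => //.
  - apply/measurable_EFinP; apply: measurable_funM => //.
    by apply: measurable_funX; apply: measurableT_comp => //; exact: measurable_funTS.
  - apply: measurable_funeM; apply/measurable_EFinP; apply: measurable_funM.
      exact: measurable_indic.
    by apply: measurable_funX; exact: measurable_funTS.
  - apply: filterS2 VA fv => x Vx fx Omx; rewrite Vx// fx real_normK ?num_real//.
    by rewrite -EFinM -mulrA.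
have mg : measurable_fun Om (fun x => (\1_A x * v x ^+ 2)%:E).
  apply/measurable_EFinP; apply: measurable_funM; first exact: measurable_indic.
  by apply: measurable_funX; exact: measurable_funTS.
have E : (\int[mu]_(x in Om) (\1_A x * v x ^+ 2)%:E = (ip mu A v v)%:E)%E.
  rewrite (ipE mA l2A).
  have -> : (\int[mu]_(x in A) (v x ^+ 2)%:E = \int[mu]_(x in Om `&` A) (v x ^+ 2)%:E)%E.
    by rewrite setIidr.
  rewrite integral_mkcondr.
  apply: eq_integral => x _; rewrite patchE indicE.
  by case: (x \in A); rewrite ?mul1r ?mul0r.
rewrite integralZl//; first by rewrite E EFinM.
apply/integrableP; split => //.
have g0 x : 0 <= \1_A x * v x ^+ 2 by rewrite mulr_ge0 ?sqr_ge0// indicE ler0n.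
under eq_integral do rewrite gee0_abs ?lee_fin ?g0//.
by rewrite E ltry.
Qed.

Lemma ip_full (v : T -> R) : l2 mu setT v -> (forall x, ~ Om x -> v x = 0) ->
  ip mu Om v v = ip mu setT v v.
Proof.
move=> l2v v0; apply: EFin_inj; rewrite (ipE measurableT l2v) ipE//; last first.
  by have [] := l2S measurableT mOm (@subsetT _ _) l2v.
rewrite integral_mkcond; apply: eq_integral => x _; rewrite patchE.
by case: (boolP (x \in Om)) => // /negP xO; rewrite v0 ?expr0n// => /mem_set.
Qed.

End square_integrable_classes.

Section rayleigh_quotient.
Context (R : realType) (n : nat) (s : R).
Local Notation N := n.+1.
Local Notation T := (euclid R N).
Local Notation mu := (@lebesgueN R N).
Local Notation k := (@kern R N s).
Variable Om : set T.
Hypothesis mOm : measurable Om.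
Let c : R := fraclap_const N s / 2.
Local Notation Q A alpha := (Qform mu k A c alpha).
Let mk := @measurable_kern2 R n s.
Let k0 := @kern_ge0 R N s.

Lemma rayleighE (V f v : T -> R) (A : set T) alpha : measurable A -> A `<=` Om ->
  measurable_fun Om V -> {ae mu, forall x, Om x -> V x = alpha * \1_A x} ->
  measurable_fun setT f -> adm mu k Om v -> {ae mu, forall x, f x = v x} ->
  (gagliardo s f ^+ 2 = (energy mu k v)%:E)%E ->
  weighted_sqnorm Om (cst 1) f = (ip mu setT v v)%:E /\
  (0 < ip mu setT v v ->
    rayleigh s Om (cst 1) V f = (Q A alpha v / ip mu setT v v)%:E).
Proof.
move=> mA AO mV VA mf [mv l2v gv v0] fv Ef.
have W1 : weighted_sqnorm Om (cst 1) f = (ip mu setT v v)%:E.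
  have one : {ae mu, forall x, Om x -> cst (1 : R) x = 1 * \1_Om x}.
    by apply: aeW => x Omx; rewrite indicE mem_set// mulr1.
  have := weighted_sqnorm_ip mOm mOm (@subset_refl _ Om)
    (measurable_cst (1 : R)) one mf l2v fv.
  by rewrite mul1r (ip_full mOm l2v v0).
have WV : weighted_sqnorm Om V f = (alpha * ip mu A v v)%:E.
  exact: (weighted_sqnorm_ip mOm mA AO mV VA mf l2v fv).
split=> // i0.
by rewrite /rayleigh W1 WV Ef inver gt_eqF// -!EFinM -EFinD.
Qed.

Lemma lambda1_le (V v : T -> R) (A : set T) alpha : measurable A -> A `<=` Om ->
  measurable_fun Om V -> {ae mu, forall x, Om x -> V x = alpha * \1_A x} ->
  adm mu k Om v -> 0 < ip mu setT v v ->
  (lambda1 s Om (cst 1%R) V <= (Q A alpha v / ip mu setT v v)%:E)%E.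
Proof.
move=> mA AO mV VA av i0; have [mv _ _ _] := av.
have [Lv gv v0 Ev] := adm_seminorm mk k0 av.
have vv : {ae mu, forall x, v x = v x} by exact: aeW.
have [W1 RE] := rayleighE mA AO mV VA mv av vv Ev.
rewrite -(RE i0); apply: ereal_inf_lbound; exists v => //; split.
  by split.
by rewrite W1 lte_fin.
Qed.

Lemma le_lambda1 (V : T -> R) (A : set T) alpha lam : measurable A -> A `<=` Om ->
  measurable_fun Om V -> {ae mu, forall x, Om x -> V x = alpha * \1_A x} ->
  (forall v, adm mu k Om v -> lam * ip mu setT v v <= Q A alpha v) ->
  (lam%:E <= lambda1 s Om (cst 1%R) V)%E.
Proof.
move=> mA AO mV VA H; apply: le_ereal_inf_tmp => _ [f [[Lf gf f0] W0] <-].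
have [v [av fv Ef]] := adm_representative mk k0 mOm Lf gf f0.
have [mf _] := (Lfun2P _ _).1 Lf.
have [W1 RE] := rayleighE mA AO mV VA mf av fv Ef.
move: W0; rewrite W1 lte_fin => i0; rewrite (RE i0) lee_fin ler_pdivlMr//.
exact: H.
Qed.

End rayleigh_quotient.

(** * A representative with exact symmetries *)

Section canonical_representative.
Context (R : realType) (n : nat) (s : R).
Local Notation N := n.+1.
Local Notation T := (euclid R N).
Local Notation mu := (@lebesgueN R N).
Local Notation k := (@kern R N s).
Hypothesis s01 : 0 < s < 1.
Implicit Types (u : T -> R) (S : set T).

Definition near_pairs (h : R) : set (T * T) := [set z | edist z.1 z.2 < h].

(** This depends on [u] only up to a null set, and commutes with isometries at every
point: also where the averages diverge, as [lim] is a function of the sequence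
of averages, which is the same at a point and at its image. *)
Definition representative u x : R :=
  lim (mean mu (xsection (near_pairs (2^-1 ^+ j)) x) u @[j --> \oo]).

Let xsection_ball h (x : T) : xsection (near_pairs h) x = [set y | edist y x < h].
Proof. by rewrite xsectionE; apply/seteqP; split => y /=; rewrite /near_pairs /= edistC. Qed.

Lemma representative_ae Om u : adm mu k Om u -> (forall x, 0 <= u x) ->
  {ae mu, forall x, representative u x = u x}.
Proof.
move=> [m_u l2u gu _] u0; have /andP[s0 _] := s01.
pose h j : R := 2^-1 ^+ j.
have h0 j : 0 < h j by rewrite exprn_gt0// invr_gt0.
have N0 : 0 < N%:R :> R by rewrite ltr0n.
pose p : R := N%:R + 2 * s.
pose q : R := 2^-1 `^ (2 * s).
have q0 : 0 < q by rewrite powR_gt0// invr_gt0.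
have q1 : q < 1.
  have s20 : 0 < 2 * s by rewrite mulr_gt0.
  have <- : 1 `^ (2 * s) = 1 :> R by rewrite powR1.
  apply: gt0_ltr_powR => //.
  - by rewrite nnegrE invr_ge0.
  - by rewrite nnegrE.
  - by rewrite invf_lt1// ltr1n.
have H := @means_cvg_ae _ T R mu k (@measurable_kern2 R n s) (@kern_ge0 R N s)
  u m_u u0 l2u gu (fun j => near_pairs (h j)) (fun j => (h j / (2 * N%:R)) ^+ N)
  (fun j => ((h j) `^ p)^-1) ((2 * N%:R) ^+ N) q.
have {}H : {ae mu, forall x, mean mu (xsection (near_pairs (h j)) x) u @[j --> \oo] --> u x}.
  apply: H.
  - by move=> j; exact: measurable_lt_cst (@measurable_edist2 R n) (h j).
  - by move=> j; rewrite exprn_gt0// divr_gt0// mulr_gt0.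
  - by move=> j; rewrite invr_gt0 powR_gt0.
  - by move=> j x; rewrite xsection_ball; exact: ball_edist_ge.
  - move=> j x; rewrite xsection_ball; apply: (mu_bounded_lty (y := x) (h := h j)) => //.
    exact: measurable_ball_edist.
  - by move=> j x y xy nxy; apply: kern_ge_of_edist => //; exact: ltW.
  - by rewrite exprn_ge0// mulr_ge0.
  - by rewrite (ltW q0) q1.
  - move=> j; rewrite le_eqVlt; apply/orP; left; apply/eqP.
    (* The ratio of volume to kernel: h ^ p / h ^ N = h ^ (2 s) is geometric in j. *)
    have hN : h j `^ p = h j ^+ N * q ^+ j.
      rewrite /p powRD; last by apply/implyP => _; rewrite gt_eqF.
      rewrite powR_mulrn ?(ltW (h0 j))//; congr (_ * _).
      have -> : q ^+ j = 2^-1 `^ (j%:R * (2 * s)).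
        by rewrite mulrC (powRrM _ (2 * s)) powR_mulrn// ltW.
      by rewrite (powRrM _ j%:R) powR_mulrn// invr_ge0.
    rewrite hN expr_div_n.
    have a0 : h j ^+ N != 0 by rewrite gt_eqF// exprn_gt0.
    have b0 : q ^+ j != 0 by rewrite gt_eqF// exprn_gt0.
    have c0 : (2 * N%:R) ^+ N != 0 :> R by rewrite gt_eqF// exprn_gt0// mulr_gt0.
    move: (h j ^+ N) (q ^+ j) ((2 * N%:R) ^+ N) a0 b0 c0 => a b c a0 b0 c0.
    by field; rewrite a0 b0 c0.
by apply: filterS H => x; exact: cvg_lim.
Qed.

Lemma mean_preserving (f g : T -> T) u S : preserving f g ->
  measurable_fun setT u -> (forall x, 0 <= u x) -> measurable S ->
  {ae mu, forall x, u (f x) = u x} ->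
  mean mu (f @^-1` S) u = mean mu S u.
Proof.
move=> pfg m_u u0 mS uf; rewrite /mean [X in (fine X)^-1](lebesgueN_preserved S pfg).
congr (_ * _); rewrite /Rintegral; congr fine.
have mf := measurable_preserving pfg.
have mfS : measurable (f @^-1` S) by exact: preimage_measurable mf mS.
pose w x : \bar R := (u x * \1_S x)%:E.
have m_w : measurable_fun setT w.
  by apply/measurable_EFinP; apply: measurable_funM => //; exact: measurable_indic.
have w0 x : (0 <= w x)%E by rewrite lee_fin mulr_ge0// indicE ler0n.
transitivity (\int[mu]_x w x)%E; last first.
  rewrite [RHS]integral_mkcond; apply: eq_integral => x _; rewrite patchE /w indicE.
  by case: (x \in S); rewrite ?mulr1 ?mulr0.
rewrite -(ge0_integral_invariant mf (fun X _ => lebesgueN_preserved X pfg) m_w w0) integral_mkcond.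
have m1 : measurable_fun setT (fun x => (u x * \1_(f @^-1` S) x)%:E).
  by apply/measurable_EFinP; apply: measurable_funM => //; exact: measurable_indic.
transitivity (\int[mu]_x (u x * \1_(f @^-1` S) x)%:E)%E.
  apply: eq_integral => x _; rewrite patchE indicE.
  by case: (x \in _); rewrite ?mulr1 ?mulr0.
apply: ge0_ae_eq_integral.
- exact: measurableT.
- exact: m1.
- exact: measurableT_comp m_w mf.
- by move=> x _; rewrite lee_fin mulr_ge0// indicE ler0n.
- by move=> x _; exact: w0.
- by apply: filterS uf => x ux _; rewrite /w ux.
Qed.

Lemma representative_reflection u (e : T) : edot e e = 1 ->
  measurable_fun setT u -> (forall x, 0 <= u x) ->
  {ae mu, forall x, u (reflection e x) = u x} ->
  forall x, representative u (reflection e x) = representative u x.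
Proof.
move=> e1 m_u u0 ue x.
have E h : mean mu (xsection (near_pairs h) (reflection e x)) u =
    mean mu (xsection (near_pairs h) x) u.
  rewrite !xsection_ball.
  have <- := mean_preserving (preserving_reflection e1) m_u u0 (measurable_ball_edist x h) ue.
  congr mean; apply/seteqP; split => y /=.
    by rewrite -(edist_reflection y _ e1) reflectionK.
  by rewrite -(edist_reflection _ x e1) reflectionK.
have EE : (fun j => mean mu (xsection (near_pairs (2^-1 ^+ j)) (reflection e x)) u) =
    (fun j => mean mu (xsection (near_pairs (2^-1 ^+ j)) x) u).
  by apply/funext => j; exact: E.
exact: (congr1 (fun f : nat -> R => lim (f @ \oo)) EE).
Qed.

End canonical_representative.

(** * Reflections and axial symmetry *)

Section axial_symmetry.
Context (R : realType) (n : nat).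
Local Notation N := n.+1.
Local Notation T := (euclid R N).
Implicit Types (x y e gamma m : T).

(** The mirror is orthogonal to [x - y]. *)
Lemma mirror x y : enorm x = enorm y -> x <> y ->
  exists e, [/\ edot e e = 1, forall z, edot x z = edot y z -> edot e z = 0 &
    reflection e x = y].
Proof.
move=> nxy xy; have nxy2 : edot x x = edot y y by rewrite -!sqr_enorm nxy.
have l0 : 0 < edist x y.
  by rewrite lt_neqAle edist_ge0 andbT; apply/eqP => /esym/edist_eq0.
pose l := edist x y; have ln0 : l != 0 by rewrite gt_eqF.
pose e : T := [tuple (tnth x i - tnth y i) / l | i < N].
have eE z : edot e z = (edot x z - edot y z) / l.
  rewrite /edot -sumrB mulr_suml; apply: eq_bigr => i _; rewrite tnth_mktuple; ring.
have l2 : l ^+ 2 = 2 * (edot x x - edot x y).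
  by rewrite /l edist_sqrE -nxy2; ring.
have xe : edot x e = l / 2.
  rewrite edotC eE (edotC y x); apply: (mulIf ln0).
  by rewrite divfK// mulrAC -expr2 l2; field.
exists e; split.
- have ye : edot y e = - (l / 2).
    rewrite edotC eE -nxy2; apply: (mulIf ln0).
    by rewrite divfK// mulNr mulrAC -expr2 l2; field.
  by rewrite eE xe ye; field.
- by move=> z xz; rewrite eE xz subrr mul0r.
- apply/eq_from_tnth => i; rewrite !tnth_mktuple xe.
  by field.
Qed.

(** Two points with the same norm and the same angle to the axis are mirror images
in a hyperplane that contains the axis.  The norm has to be positive, as the
angle of the origin is meaningless. *)
Lemma axially_symmetric_of_reflections gamma (A : set T) : enorm gamma = 1 ->
  (forall x, A x -> 0 < enorm x) ->
  (forall e, edot e e = 1 -> edot e gamma = 0 -> forall x, A x -> A (reflection e x)) ->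
  axially_symmetric gamma A.
Proof.
move=> g1 Apos Arefl.
pose angle x := acos (edot x gamma / enorm x).
exists (fun a b => (`[< exists2 x, A x & enorm x = a /\ angle x = b >])%:R) => x.
rewrite indicE; congr (_%:R); congr nat_of_bool.
apply/idP/idP => [/set_mem Ax|/asboolP[y Ay [nyx ayx]]].
  by apply/asboolP; exists x.
apply/mem_set; have [<-//|yx] := pselect (y = x).
have y0 := Apos _ Ay.
have bnd z : 0 < enorm z -> edot z gamma / enorm z \in `[(-1 : R), 1].
  move=> z0; rewrite in_itv/= -ler_norml normrM normfV (ger0_norm (ltW z0)).
  by rewrite ler_pdivrMr// mul1r (le_trans (edot_le _ _))// g1 mulr1.
have x0 : 0 < enorm x by rewrite -nyx.
have dyx : edot y gamma = edot x gamma.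
  have := congr1 cos ayx; rewrite /angle !acosK ?bnd// nyx => /mulIf; apply.
  by rewrite invr_neq0// gt_eqF.
have [e [e1 eperp <-]] := mirror nyx yx.
by apply: Arefl => //; exact: eperp.
Qed.

(** The direction of [m], and any direction if [m] is zero. *)
Lemma axis_exists m : exists2 gamma, enorm gamma = 1 &
  forall e, edot e gamma = 0 -> edot e m = 0.
Proof.
have [m0|m0] := eqVneq (enorm m) 0.
  exists [tuple (i == ord0)%:R | i < N].
    rewrite /enorm /edot (bigD1 ord0)//= big1 ?addr0 => [|i i0].
      by rewrite !tnth_mktuple eqxx mulr1 sqrtr1.
    by rewrite !tnth_mktuple (negbTE i0) mulr0.
  move=> e _; have := edot_le e m; rewrite m0 mulr0 normr_le0.
  by move/eqP.
pose gamma : T := [tuple tnth m i / enorm m | i < N].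
have gE e : edot e gamma = edot e m / enorm m.
  by rewrite /edot mulr_suml; apply: eq_bigr => i _; rewrite tnth_mktuple mulrA.
exists gamma.
  rewrite /enorm gE edotC gE -sqr_enorm (_ : _ / _ / _ = 1) ?sqrtr1//.
  by field.
by move=> e; rewrite gE => /eqP; rewrite mulf_eq0 invr_eq0 (negbTE m0) orbF => /eqP.
Qed.

End axial_symmetry.

Lemma ip_gt0 d (T : measurableType d) (R : realType)
    (mu : {measure set T -> \bar R}) (B : set T) (f : T -> R) :
  measurable B -> mu B != 0%E -> l2 mu setT f -> (forall x, B x -> f x != 0) ->
  0 < ip mu setT f f.
Proof.
move=> mB B0 l2f fB; rewrite lt_neqAle ip_ge0 andbT eq_sym; apply: contra_neq B0 => f0.
have iF := l2_integrable measurableT l2f l2f.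
have : (\int[mu]_x `|(f x * f x)%:E| = 0)%E.
  rewrite -[RHS]/((0 : R)%:E) -f0 (ipE measurableT l2f); apply: eq_integral => x _.
  by rewrite gee0_abs ?lee_fin -?expr2 ?sqr_ge0.
move=> /(ae_eq_integral_abs _ measurableT (measurable_int _ iF))[Z [mZ Z0 BZ]].
apply/eqP; rewrite -measure_le0 -[leRHS]Z0; apply: le_measure; rewrite ?inE//.
move=> x Bx; apply: BZ => /= /(_ I) [] /eqP.
by rewrite mulf_eq0 orbb; apply/negP; exact: fB.
Qed.

Section moment_vector.
Context (R : realType) (n : nat) (s : R).
Local Notation N := n.+1.
Local Notation T := (euclid R N).
Local Notation mu := (@lebesgueN R N).
Local Notation k := (@kern R N s).
Variables (Om : set T) (rho : R) (u : T -> R).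
Hypothesis Om_ball : forall x, Om x -> edist x origin < rho.
Hypothesis au : adm mu k Om u.

Definition moment : T := [tuple fine (\int[mu]_x (tnth x i * u x ^+ 2)%:E) | i < N].

Lemma coord_integrable i : mu.-integrable setT (fun x => (tnth x i * u x ^+ 2)%:E).
Proof.
have [m_u l2u _ u0] := au.
have iu : mu.-integrable setT (fun x => (rho%:E * (u x * u x)%:E)%E).
  by apply: integrableZl => //; exact: (l2_integrable measurableT l2u l2u).
apply: le_integrable iu; first exact: measurableT.
  apply/measurable_EFinP; apply: measurable_funM; first exact: measurable_coord.
  by apply: measurable_funX.
move=> x _; rewrite -EFinM /= lee_fin -expr2.
have [Omx|nOmx] := pselect (Om x); last by rewrite (u0 _ nOmx) expr0n/= !mulr0.
have := coord_le_edist x origin i; rewrite tnth_mktuple subr0 => xi.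
have rx := Om_ball Omx; have rho0 := le_lt_trans (edist_ge0 x origin) rx.
rewrite normrM [leRHS]normrM (gtr0_norm rho0).
by apply: ler_wpM2r => //; apply: le_trans xi _; exact: ltW.
Qed.

Lemma edot_sqrE (e x : T) :
  (edot x e * u x ^+ 2)%:E = (\sum_(i < N) (tnth e i)%:E * (tnth x i * u x ^+ 2)%:E)%E.
Proof.
rewrite sumEFin /edot mulr_suml; congr EFin; apply: eq_bigr => i _; ring.
Qed.

Lemma edot_integrable (e : T) : mu.-integrable setT (fun x => (edot x e * u x ^+ 2)%:E).
Proof.
have -> : (fun x => (edot x e * u x ^+ 2)%:E) =
    (fun x => \sum_(i < N) (tnth e i)%:E * (tnth x i * u x ^+ 2)%:E)%E.
  by apply/funext => x; exact: edot_sqrE.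
apply: integrable_sum => [|i _]; first exact: measurableT.
by apply: integrableZl => //; exact: coord_integrable.
Qed.

Lemma integral_edot (e : T) :
  (\int[mu]_x (edot x e * u x ^+ 2)%:E = (edot e moment)%:E)%E.
Proof.
transitivity (\int[mu]_x (\sum_(i < N) (tnth e i)%:E * (tnth x i * u x ^+ 2)%:E))%E.
  by apply: eq_integral => x _; exact: edot_sqrE.
rewrite integral_sum; first last.
- by move=> i; apply: integrableZl => //; exact: coord_integrable.
- exact: measurableT.
rewrite -sumEFin; apply: eq_bigr => i _.
rewrite integralZl; [|exact: measurableT|exact: coord_integrable].
rewrite tnth_mktuple EFinM fineK//.
exact: (integrable_fin_num _ (coord_integrable i)).
Qed.

End moment_vector.

Section annulus_volume.
Context (R : realType) (n : nat) (r rho : R).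
Local Notation N := n.+1.
Local Notation T := (euclid R N).
Local Notation mu := (@lebesgueN R N).
Hypothesis r0 : 0 < r.
Hypothesis rrho : r < rho.

Lemma annulus_neq0 : mu (annulus r rho) != 0%E.
Proof.
pose p : T := [tuple if i == ord0 then (r + rho) / 2 else 0 | i < N].
have pn : enorm p = (r + rho) / 2.
  rewrite /enorm /edot (bigD1 ord0)//= big1 ?addr0 => [|i i0].
    rewrite !tnth_mktuple eqxx -expr2 sqrtr_sqr ger0_norm//.
    by rewrite divr_ge0// addr_ge0 ?(ltW r0)// ltW// (lt_trans r0).
  by rewrite !tnth_mktuple (negbTE i0) mulr0.
pose h := (rho - r) / 2.
have h0 : 0 < h by rewrite divr_gt0// subr_gt0.
have sub : [set x : T | edist x p < h] `<=` annulus r rho.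
  move=> x /= xp; apply/annulusE.
  have := enorm_lip x p; rewrite pn ler_norml => /andP[a1 a2].
  by move: xp; rewrite /h => xp; apply/andP; split; lra.
apply/eqP => z; have := ball_edist_ge p h0 (ltn0Sn n).
apply/negP; rewrite -ltNge; apply: (@le_lt_trans _ _ (mu (annulus r rho))).
  apply: le_measure; rewrite ?inE; [exact: measurable_ball_edist|exact: measurable_annulus|].
  exact: sub.
by rewrite z lte_fin exprn_gt0// divr_gt0// mulr_gt0// ltr0n.
Qed.

End annulus_volume.

(** * The optimal set *)

(** Lebesgue measure is complete. *)
Lemma ae_eq_set (R : realType) (N : nat) (A D : set (euclid R N)) : measurable A ->
  {ae @lebesgueN R N, forall x, A x <-> D x} ->
  measurable D /\ lebesgueN D = lebesgueN A.
Proof.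
move=> mA AD.
have nAD : (@lebesgueN R N).-negligible (A `\` D).
  apply: negligibleS AD => x [Ax Dx] /= H; exact/Dx/H.
have nDA : (@lebesgueN R N).-negligible (D `\` A).
  apply: negligibleS AD => x [Dx Ax] /= H; exact/Ax/H.
have mAD := lebesgueN_complete nAD; have mDA := lebesgueN_complete nDA.
have null (Z : set (euclid R N)) : measurable Z -> (@lebesgueN R N).-negligible Z ->
    lebesgueN Z = 0%E by move=> mZ /(negligibleP _ mZ).
have mD : measurable D.
  rewrite (_ : D = (A `\` (A `\` D)) `|` (D `\` A)).
    by apply: measurableU => //; exact: measurableD.
  apply/seteqP; split => x; last by move=> [[Ax nAD']|[]//]; apply: contrapT => nDx; exact: nAD'.
  by move=> Dx; have [Ax|nAx] := pselect (A x); [left; split => // -[]|right].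
have le (X Y : set (euclid R N)) : measurable X -> measurable Y -> measurable (X `\` Y) ->
    (@lebesgueN R N).-negligible (X `\` Y) -> (lebesgueN X <= lebesgueN Y)%E.
  move=> mX mY mXY nXY.
  apply: (@le_trans _ _ (lebesgueN (Y `|` (X `\` Y)))).
    apply: le_measure; rewrite ?inE; [exact: mX|exact: measurableU|].
    by move=> x Xx; have [Yx|nYx] := pselect (Y x); [left|right].
  apply: le_trans (measureU2 _ mY mXY) _.
  by rewrite [X in (_ + X)%E](null _ mXY nXY) adde0.
by split => //; apply/eqP; rewrite eq_le (le D A)// (le A D).
Qed.

Section optimal_set.
Context (R : realType) (n : nat) (s r rho c alpha lam : R).
Local Notation N := n.+1.
Local Notation T := (euclid R N).
Local Notation mu := (@lebesgueN R N).
Local Notation k := (@kern R N s).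
Local Notation Om := (annulus r rho : set T).
Hypothesis s01 : 0 < s < 1.
Hypothesis r0 : 0 < r.
Hypothesis rrho : r < rho.
Hypothesis c0 : 0 < c.
Hypothesis alpha0 : 0 < alpha.
Variables (A : set T) (u : T -> R).
Hypothesis mA : measurable A.
Hypothesis AOm : A `<=` Om.
Hypothesis minA : forall W, measurable W -> W `<=` Om -> mu W = mu A ->
  forall psi, adm mu k Om psi -> lam * ip mu setT psi psi <= Qform mu k W c alpha psi.
Hypothesis au : adm mu k Om u.
Hypothesis u0 : forall x, 0 <= u x.
Hypothesis iu : 0 < ip mu setT u u.
Hypothesis Qu : Qform mu k A c alpha u <= lam * ip mu setT u u.

Let mOm : measurable Om := measurable_annulus r rho.
Let mk : measurable_fun setT (fun z : T * T => k z.1 z.2) := @measurable_kern2 R n s.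
Let k0 : forall x y : T, 0 <= k x y := @kern_ge0 R N s.
Let m_u : measurable_fun setT u. Proof. by have [] := au. Qed.

Let lam0 : 0 <= lam.
Proof.
have := le_trans (Qform_ge0 mu k A c0 (ltW alpha0) u) Qu.
by rewrite pmulr_lge0.
Qed.

Lemma minimizer_pos : {ae mu, forall x, Om x -> 0 < u x}.
Proof.
apply: (ae_pos_minimizer mk k0 (fun x y => @kern_gt0 R N s x y) mOm c0 alpha0 lam0 (W := A)
  (phi := tent r rho) (b := rho) mA (minA mA AOm erefl) au u0 iu Qu).
- exact: tent_adm.
- by move=> x; rewrite tent_ge0 tent_le// (lt_trans r0).
- by move=> x; exact: tent_pos.
Qed.

Lemma optimal_sublevel : exists J : set R, (forall a b, a <= b -> J b -> J a) /\
  {ae mu, forall x, A x <-> Om x /\ J (u x)}.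
Proof.
apply: (minimizing_set_is_sublevel mOm (annulus_lty n r rho) mA AOm alpha0 minA au u0 Qu
  minimizer_pos).
by move=> S1 S2; exact: annulus_separate.
Qed.

Lemma annulus_reflection (e x : T) : edot e e = 1 -> Om x -> Om (reflection e x).
Proof. by move=> e1 /annulusE Omx; apply/annulusE; rewrite enorm_reflection. Qed.

(** The first moment of [u ^ 2] in the direction [e] vanishes, so the sign found in
[minimizer_rigid] can only be zero. *)
Lemma minimizer_reflection (e : T) : edot e e = 1 -> edot e (moment u) = 0 ->
  {ae mu, forall x, u (reflection e x) = u x}.
Proof.
move=> e1 em; have [J [Jdown AJ]] := optimal_sublevel.
have msg := measurable_preserving (preserving_reflection e1).
have sg_mu (B : set T) : measurable B -> mu (reflection e @^-1` B) = mu B.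
  by move=> _; exact: lebesgueN_preserved (preserving_reflection e1).
have e_sg (x : T) : edot (reflection e x) e = - edot x e.
  by rewrite edot_reflection e1; ring.
have e_fix (x : T) : edot x e = 0 -> reflection e x = x.
  move=> xe; apply/eq_from_tnth => i; rewrite tnth_mktuple xe; ring.
apply: (moment_rigid msg sg_mu e_sg e_fix m_u u0).
- exact: edot_integrable (@annulus_ball R n r rho) au e.
- by rewrite (integral_edot (@annulus_ball R n r rho) au) em.
- apply: (minimizer_rigid mk k0 mOm mA c0 minA au Qu Jdown AJ msg (reflectionK e1) sg_mu
    (measurable_edot e) e_sg e_fix).
  + by move=> x y; exact: kern_reflection.
  + by move=> x y; exact: kern_reflection_lt.
  + by move=> x; exact: annulus_reflection.
Qed.

(** The set where [representative u] lies in [J] differs from [A] by a null set, and is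
invariant under all reflections that fix the axis. *)
Theorem optimal_set_axially_symmetric : exists D : set T,
  [/\ measurable D, D `<=` Om, mu D = mu A, {ae mu, forall x, A x <-> D x} &
    exists2 gamma : T, enorm gamma = 1 & axially_symmetric gamma D].
Proof.
have [J [Jdown AJ]] := optimal_sublevel.
have [gamma g1 gm] := axis_exists (moment u).
pose D := Om `&` [set x | J (representative u x)].
have DA : {ae mu, forall x, A x <-> D x}.
  by apply: filterS2 AJ (representative_ae s01 au u0) => x H ru; rewrite /D /= ru.
have [mD muD] : measurable D /\ mu D = mu A.
  exact: ae_eq_set mA DA.
exists D; split; [exact: mD|by move=> x []|exact: muD|exact: DA|].
exists gamma; first exact: g1.
apply: (axially_symmetric_of_reflections g1).
  by move=> x [/annulusE/andP[rx _] _]; exact: lt_trans rx.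
move=> e e1 eg x [Omx Jx]; split; first exact: annulus_reflection.
have ue := minimizer_reflection e1 (gm _ eg).
by rewrite /= (representative_reflection e1 m_u u0 ue).
Qed.

End optimal_set.

Section existence_on_annulus.
Context (R : realType) (n : nat) (s r rho c alpha : R) (A : set (euclid R n.+1)).
Local Notation T := (euclid R n.+1).
Local Notation mu := (@lebesgueN R n.+1).
Local Notation k := (@kern R n.+1 s).
Local Notation Om := (annulus r rho : set T).
Hypothesis s01 : 0 < s < 1.
Hypothesis r0 : 0 < r.
Hypothesis rrho : r < rho.
Hypothesis c0 : 0 < c.
Hypothesis alpha0 : 0 < alpha.
Hypothesis mA : measurable A.

(** Replacing a minimizer by its absolute value keeps the [L^2] norms and does not
increase the energy. *)
Lemma nonneg_minimizer : exists lam u, [/\ adm mu k Om u, (forall x, 0 <= u x),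
  0 < ip mu setT u u, Qform mu k A c alpha u <= lam * ip mu setT u u &
  forall psi, adm mu k Om psi -> lam * ip mu setT psi psi <= Qform mu k A c alpha psi].
Proof.
have mOm : measurable Om := measurable_annulus r rho.
have mk : measurable_fun setT (fun z : T * T => k z.1 z.2) := @measurable_kern2 R n s.
have k0 : forall x y : T, 0 <= k x y := @kern_ge0 R n.+1 s.
have rho0 : 0 < rho := lt_trans r0 rrho.
have nontrivial : exists psi, adm mu k Om psi /\ 0 < ip mu setT psi psi.
  have at_ := tent_adm n s01 r0 rrho; exists (tent r rho); split; first exact: at_.
  have [_ l2t _ _] := at_.
  apply: (ip_gt0 mOm (annulus_neq0 n r0 rrho) l2t) => x Omx.
  by rewrite gt_eqF// tent_pos.
have [w [aw w1 minw]] := minimizer_exists mk k0 mOm (annulus_lty n r rho) mA c0 (ltW alpha0)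
  (fine_cells_bounded s01 rho0 (@annulus_ball R n r rho)) nontrivial.
have [m_w l2w _ w0] := aw.
pose u x := `|w x|.
have m_u : measurable_fun setT u by exact: measurableT_comp m_w.
have [au Eu] : adm mu k Om u /\ energy mu k u <= energy mu k w.
  apply: (adm_contraction mk aw m_u).
  - by move=> x /w0; rewrite /u => ->; rewrite normr0.
  - by move=> x; rewrite normr_id.
  - by move=> x y; exact: ler_dist_dist.
have ipu B : ip mu B u u = ip mu B w w.
  by apply: eq_Rintegral => x _; rewrite /u -normrM ger0_norm// -expr2 sqr_ge0.
exists (Qform mu k A c alpha w), u; split.
- exact: au.
- by move=> x; exact: normr_ge0.
- by rewrite ipu w1.
- by rewrite ipu w1 mulr1 /Qform ipu lerD2r ler_pM2l.
- exact: minw.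
Qed.

End existence_on_annulus.

Theorem corollary3p8 (R : realType) (N : nat) (s r rho alpha : R)
    (D : set (euclid R N)) (V : euclid R N -> R) :
  (2 <= N)%N -> 0 < s < 1 -> 0 < r < rho -> 0 < alpha ->
  let Omega := annulus r rho in
  let V0 := fun x => alpha * \1_D x in
  measurable D -> D `<=` Omega ->
  rearrangements Omega V0 V ->
  (forall W, rearrangements Omega V0 W ->
    (lambda1 s Omega (cst 1%R) V <= lambda1 s Omega (cst 1%R) W)%E) ->
  exists D' : set (euclid R N),
    [/\ measurable D', D' `<=` Omega, lebesgueN D' = lebesgueN D,
        {ae @lebesgueN R N, forall x, Omega x -> V x = alpha * \1_D' x} &
        exists2 gamma : euclid R N, enorm gamma = 1 &
          axially_symmetric gamma D'].
Proof.
move=> N2 s01 /andP[r0 rrho] alpha0 Omega V0 mD DO [mV VD] Vmin.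
case: N N2 D V @Omega @V0 mD DO mV VD Vmin => // n _ D V Om V0 mD DO mV VD Vmin.
have mOm : measurable Om := measurable_annulus r rho.
have Omoo : (lebesgueN Om < +oo)%E := annulus_lty n r rho.
have [A [mA AO muA VA]] := rearrangement_indic mOm Omoo alpha0 DO mV VD.
have c0 : 0 < fraclap_const n.+1 s / 2 by rewrite divr_gt0// fraclap_const_gt0.
have [lam [u [au u0 iu Qu minA]]] := nonneg_minimizer s01 r0 rrho c0 alpha0 mA.
have minW W : measurable W -> W `<=` Om -> lebesgueN W = lebesgueN A ->
    forall psi, adm (@lebesgueN R n.+1) (@kern R n.+1 s) Om psi ->
    lam * ip (@lebesgueN R n.+1) setT psi psi <=
    Qform (@lebesgueN R n.+1) (@kern R n.+1 s) W (fraclap_const n.+1 s / 2) alpha psi.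
  move=> mW WO muW psi apsi.
  have [i0|i0] := eqVneq (ip (@lebesgueN R n.+1) setT psi psi) 0.
    by rewrite i0 mulr0; exact: (Qform_ge0 _ _ _ c0 (ltW alpha0)).
  have ipos : 0 < ip (@lebesgueN R n.+1) setT psi psi by rewrite lt_neqAle eq_sym i0 ip_ge0.
  rewrite -ler_pdivlMr// -lee_fin.
  have mW1 : measurable_fun Om (fun x => alpha * \1_W x).
    by apply: measurable_funM; [exact: measurable_cst|exact: measurable_indic].
  have W1 : {ae @lebesgueN R n.+1, forall x, Om x -> alpha * \1_W x = alpha * \1_W x}.
    exact: aeW.
  apply: le_trans (le_lambda1 mOm mA AO mV VA minA) _.
  apply: le_trans (lambda1_le mOm mW WO mW1 W1 apsi ipos).
  apply: Vmin; split; first exact: mW1.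
  move=> t; rewrite /V0 (level_indic _ t alpha0 WO) (level_indic _ t alpha0 DO).
  case: ifP => // _; case: ifP => // _; exact: etrans muW muA.
have [D' [mD' D'O muD' AD' sym]] :=
  optimal_set_axially_symmetric s01 r0 rrho c0 alpha0 mA AO minW au u0 iu Qu.
exists D'; split; [exact: mD'|exact: D'O|by rewrite muD'| |exact: sym].
apply: filterS2 VA AD' => x Vx AD Omx; rewrite (Vx Omx); congr (_ * _).
rewrite !indicE; congr (_%:R); congr nat_of_bool.
by apply/idP/idP => /set_mem /AD /mem_set.
Qed.
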